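(* Let $\mathbb{K}$ be a field, let $h<n$ be positive integers and $R=\mathbb{K}[x_1,\dots,x_n]$. Let $\mathcal{D}_n^h$ be the Betti cone generated by all Betti diagrams of Stanley-Reisner ideals (squarefree monomial ideals) in $R$ of height $h$. Then $$\dim\mathcal{D}_n^h=\frac{n(n-1)}{2}-\frac{h(h-1)}{2}+1.$$
   Context: $R$ is standard graded. For a finitely generated graded $R$-module $M$ with minimal graded free resolution $0\to\bigoplus_{d}R(-d)^{\beta_{p,d}}\to\dots\to\bigoplus_d R(-d)^{\beta_{0,d}}\to M\to0$, the Betti diagram of $M$ is $\beta(M)=(\beta_{i,d})_{0\le i\le n,\,d\in\mathbb{Z}}$, viewed as a vector in the rational vector space $\bigoplus_{d\in\mathbb{Z}}\mathbb{Q}^{n+1}$. Ideals are resolved as $R$-modules. A simplicial complex $\Delta$ on $[n]=\{1,\dots,n\}$ is a set of subsets of $[n]$ closed under taking subsets (not every singleton need be a face). Its Stanley-Reisner ideal is $I_\Delta=\langle \prod_{i\in\sigma}x_i : \sigma\subseteq[n],\sigma\notin\Delta\rangle$. Generators of degree one are allowed. The Betti cone generated by a set of diagrams is the convex cone of nonnegative rational linear combinations of them; its dimension is the dimension of its $\mathbb{Q}$-linear span. *)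

(* Defs.v *)
From HB Require Import structures.
From mathcomp Require Import all_boot all_order all_algebra.
From mathcomp Require Import freeg mpoly.

Set Implicit Arguments.
Unset Strict Implicit.
Unset Printing Implicit Defensive.

Import GRing.Theory.

Local Open Scope ring_scope.

(* The library's [idealr_closed] includes [1 \notin P], so these are proper.
   Ideals are boolean predicates, which under classical logic and choice is no
   restriction. *)
Definition is_prime_ideal (A : comNzRingType) (P : {pred A}) : Prop :=
  idealr_closed P /\ prime_idealr_closed P.

Definition proper_incl (A : Type) (P Q : {pred A}) : Prop :=
  {subset P <= Q} /\ exists2 x, x \in Q & x \notin P.

(* There is a chain Q 0 < Q 1 < ... < Q m = P of prime ideals. *)
Definition has_prime_chain (A : comNzRingType) (P : {pred A}) (m : nat) : Prop :=
  exists Q : nat -> {pred A},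
    [/\ forall i, (i <= m)%N -> is_prime_ideal (Q i),
        forall i, (i < m)%N -> proper_incl (Q i) (Q i.+1)
      & Q m =i P].

Definition prime_height (A : comNzRingType) (P : {pred A}) (h : nat) : Prop :=
  has_prime_chain P h /\ forall m, has_prime_chain P m -> (m <= h)%N.

(* The least height of a prime ideal containing I; the unit ideal has no
   height in this sense. *)
Definition ideal_height (A : comNzRingType) (I : A -> Prop) (h : nat) : Prop :=
  (exists P : {pred A},
     [/\ is_prime_ideal P, forall x, I x -> x \in P & prime_height P h]) /\
  (forall (P : {pred A}) (m : nat),
     is_prime_ideal P -> (forall x, I x -> x \in P) -> prime_height P m ->
     (h <= m)%N).

Definition simplicial_complex (n : nat) (Delta : {set {set 'I_n}}) : Prop :=
  forall s t : {set 'I_n}, s \in Delta -> t \subset s -> t \in Delta.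

Definition stanley_reisner (K : fieldType) (n : nat) (Delta : {set {set 'I_n}})
    (p : {mpoly K[n]}) : Prop :=
  exists c : {set 'I_n} -> {mpoly K[n]},
    p = \sum_(s : {set 'I_n} | s \notin Delta) c s * \prod_(i in s) 'X_i.

Definition zhomog (K : fieldType) (n : nat) (e : int) (p : {mpoly K[n]}) : Prop :=
  match e with
  | Posz d => p \is d.-homog
  | Negz _ => p = 0
  end.

(* A graded free module \bigoplus_j R(-d_j) is given by the sequence
   [:: d_0; d_1; ...] of its twists; its elements are row vectors and maps act
   by right multiplication. A matrix entry from R(-a) to R(-b) of a degree 0
   map is homogeneous of degree a - b. *)
Record min_graded_resolution (K : fieldType) (n : nat)
    (I : {mpoly K[n]} -> Prop) := MinGradedResolution {
  twists : nat -> seq int;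
  diff : forall i : nat,
    'M[{mpoly K[n]}]_(size (twists i.+1), size (twists i));
  augm : 'cV[{mpoly K[n]}]_(size (twists 0));
  twists_finite : exists p : nat, forall i, (p < i)%N -> twists i = [::];
  diff_homog : forall i (j : 'I_(size (twists i.+1))) (k : 'I_(size (twists i))),
    zhomog ((twists i.+1)`_j - (twists i)`_k) (diff i j k);
  augm_homog : forall j : 'I_(size (twists 0)), zhomog (twists 0)`_j (augm j 0);
  augm_image : forall p : {mpoly K[n]},
    I p <-> exists v : 'rV_(size (twists 0)), v *m augm = p%:M;
  augm_exact : forall v : 'rV_(size (twists 0)),
    v *m augm = 0 <-> exists w, v = w *m diff 0;
  diff_exact : forall i (v : 'rV_(size (twists i.+1))),
    v *m diff i = 0 <-> exists w, v = w *m diff i.+1;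
  (* minimality: the image of diff i lies in (x_1, ..., x_n) F_i *)
  diff_minimal : forall i j k, (diff i j k)@_0%MM = 0
}.

(* The rational vector space \bigoplus_(d : int) rat^(n+1), realized as the
   free rat-module on the pairs (i, d). *)
Definition betti_space (n : nat) : lmodType rat :=
  {freeg ('I_n.+1 * int)%type / rat}.

Definition is_betti_diagram (K : fieldType) (n : nat) (I : {mpoly K[n]} -> Prop)
    (beta : betti_space n) : Prop :=
  exists F : min_graded_resolution I,
    forall (i : 'I_n.+1) (d : int),
      coeff (i, d) beta = (count_mem d (twists F i))%:R.

Definition rat_span (V : lmodType rat) (S : V -> Prop) (v : V) : Prop :=
  exists (m : nat) (c : 'I_m -> rat) (u : 'I_m -> V),
    (forall i, S (u i)) /\ v = \sum_(i < m) c i *: u i.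

Definition convex_cone (V : lmodType rat) (S : V -> Prop) (v : V) : Prop :=
  exists (m : nat) (c : 'I_m -> rat) (u : 'I_m -> V),
    [/\ forall i, S (u i), forall i, 0 <= c i & v = \sum_(i < m) c i *: u i].

Definition cone_dim (V : lmodType rat) (C : V -> Prop) (N : nat) : Prop :=
  exists b : 'I_N -> V,
    [/\ forall i, rat_span C (b i),
        forall c : 'I_N -> rat, \sum_(i < N) c i *: b i = 0 -> forall i, c i = 0
      & forall v, rat_span C v -> exists c : 'I_N -> rat,
          v = \sum_(i < N) c i *: b i].

Definition sr_betti_cone (K : fieldType) (n h : nat) : betti_space n -> Prop :=
  convex_cone (fun beta : betti_space n =>
    exists Delta : {set {set 'I_n}},
      [/\ simplicial_complex Delta,
          ideal_height (@stanley_reisner K n Delta) h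
        & is_betti_diagram (@stanley_reisner K n Delta) beta]).

(* Main.v *)
(** Let [I] be the ideal of [Delta]. Tor of [I] against [K] is read off the Koszul
    complex, and for each variable [x] the exact sequence
    [0 -> L(-1) -> L (+) J(-1) -> I -> 0], with [L] and [J] the ideals of the
    deletion and the link of [x], bounds it inductively: [beta_(i,d)] vanishes
    unless [i + 1 < d <= n] and [d - i <= n - h + 1], or [d = i + 1] and [i < h].
    The same sequence shows that [1 - sum_(i,d) (-1)^i beta_(i,d) t^d] is
    divisible by [(1 - t)^h]. On diagrams with such a support, the entries off
    the linear strand [d = i + 1] together with the value of the alternating sum
    at [t = 1] are then coordinates, which bounds the dimension from above.

    Conversely, for each position of row [c = d - i >= 2] and homological degree
    [i] there is an ideal with entries only in rows [1] and [c]: for [i < h],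
    [i] variables plus all squarefree monomials of degree [c] in [h - i + c - 1]
    further variables; for [i >= h], [h - 1] variables plus
    [x_S (y_1, ..., y_k)] with [|S| = c - 1] and [k = i - h + 2]. These diagrams
    and that of [(x_1, ..., x_h)] are independent: row [c] eliminates the second
    family by its top entry, divisibility then kills the linear strand as well,
    whose top entries eliminate the first family.

    As for heights, a chain of [m] strict inclusions of primes yields, from the
    monomials in elements witnessing strictness, [B^m] linearly independent
    polynomials of degree [O(B)], so [m <= n]; hence the height of [I] is [n]
    minus the largest size of a face. *)

Require Import Defs.
From HB Require Import structures.
From mathcomp Require Import all_boot all_order all_algebra.
From mathcomp Require Import freeg mpoly.
From mathcomp Require Import zify ring.
From Stdlib Require Import Classical ClassicalEpsilon.

Set Implicit Arguments.
Unset Strict Implicit.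
Unset Printing Implicit Defensive.

Import Order.TTheory GRing.Theory Num.Theory.

Local Open Scope ring_scope.

(** * The Koszul complex *)

(** Betti numbers are hardly ever computed. The upper bound needs only which entries can be nonzero,
    and vanishing passes along an exact sequence without forming connecting homomorphisms; the
    alternating sums come from dimensions of graded pieces. For independence, one nonzero entry or
    the value at t = 1 is enough. The entry is found as an explicit Koszul cycle at the end of the
    linear strand, or as a coefficient of the Hilbert numerator in a degree met by a single
    homological degree.

    The linear strand adds one dimension instead of h: its polynomial p has degree at most h and no
    constant term, and p(1) - p is a constant multiple of (t - 1)^h, fixed by its value p(1) at t =
    0. Writing p(1) for the constant 1 keeps the divisibility linear in the diagram. Row by row the
    other positions number (n - 1) + (n - 2) + ... + h.

    A diagram exists only through a resolution, so the lower bound also has to construct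
    resolutions; there the Tor bounds stand in for Hilbert's basis and syzygy theorems. *)

Section Koszul.
Variable A : comNzRingType.
Implicit Types (E : lmodType A) (xs : seq A).

(* A pair [(a, b)] of chains on [xs] stands for the chain [a + e_x /\ b] on
   [x :: xs]; the sign in [kdiff] makes the square vanish. *)
Fixpoint kchains E xs : lmodType A :=
  if xs is _ :: xs' then (kchains E xs' * kchains E xs')%type else E.

Fixpoint kdiff E xs : kchains E xs -> kchains E xs :=
  if xs is x :: xs' return kchains E xs -> kchains E xs then
    fun c => (kdiff c.1 + x *: c.2, - kdiff c.2)
  else fun=> 0.

(** Each [e_x] has homological and internal degree one. The grading is a predicate on an ambient
    module, so that a graded submodule and its ambient module share one type of chains. *)
Fixpoint kdeg E (G : int -> E -> Prop) xs (i : nat) (d : int) :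
    kchains E xs -> Prop :=
  if xs is _ :: xs' return kchains E xs -> Prop then
    fun c => kdeg G i d c.1 /\
             if i is i'.+1 then kdeg G i' (d - 1) c.2 else c.2 = 0
  else fun e => if i is 0 then G d e else e = 0.

Definition koszul_exact E (G : int -> E -> Prop) xs (i : nat) (d : int) : Prop :=
  forall c : kchains E xs, kdeg G i d c -> kdiff c = 0 ->
    exists2 b : kchains E xs, kdeg G i.+1 d b & kdiff b = c.

Record graded_for xs E (G : int -> E -> Prop) : Prop := GradedFor {
  graded0 : forall d, G d 0;
  gradedB : forall d u v, G d u -> G d v -> G d (u - v);
  gradedX : forall d x u, x \in xs -> G d u -> G (d + 1) (x *: u)
}.

Lemma graded_for_subset xs ys E (G : int -> E -> Prop) :
  {subset ys <= xs} -> graded_for xs G -> graded_for ys G.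
Proof. by move=> yx [G0 GB GX]; split=> // d x u /yx; apply: GX. Qed.

Lemma graded_for_cons x xs E (G : int -> E -> Prop) :
  graded_for (x :: xs) G -> graded_for xs G.
Proof. by apply: graded_for_subset => y ys; rewrite in_cons ys orbT. Qed.

Section OneModule.
Variables (E : lmodType A) (G : int -> E -> Prop).

Lemma kdiffB xs : {morph @kdiff E xs : b c / b - c}.
Proof.
elim: xs => [|x xs IH] b c /=; first by rewrite subr0.
apply: (@etrans _ _ (kdiff b.1 + x *: b.2 - (kdiff c.1 + x *: c.2),
                     - kdiff b.2 - - kdiff c.2)) => //.
by congr pair; rewrite IH ?scalerBr opprD //; exact: addrACA.
Qed.

Lemma kdiff0 xs : kdiff (0 : kchains E xs) = 0.
Proof. by rewrite -[X in kdiff X](subrr 0) kdiffB subrr. Qed.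

Lemma kdiffN xs : {morph @kdiff E xs : c / - c}.
Proof. by move=> c; rewrite -sub0r kdiffB kdiff0 sub0r. Qed.

Lemma kdiffD xs : {morph @kdiff E xs : b c / b + c}.
Proof. by move=> b c; rewrite -{1}[c]opprK kdiffB kdiffN opprK. Qed.

Lemma kdiffZ xs r : {morph @kdiff E xs : c / r *: c}.
Proof.
elim: xs => [|x xs IH] c /=; first by rewrite scaler0.
by congr pair; rewrite /= !IH ?scalerN // scalerDr !scalerA mulrC.
Qed.

Lemma kdiff_sq xs (c : kchains E xs) : kdiff (kdiff c) = 0.
Proof.
elim: xs c => [|x xs IH] c //=.
by rewrite kdiffD kdiffZ kdiffN !IH oppr0 add0r scalerN subrr oppr0.
Qed.

Lemma kdeg0 xs i d : graded_for xs G -> kdeg G i d (0 : kchains E xs).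
Proof.
elim: xs i d => [|x xs IH] [|i] d gG //=; first exact: graded0 gG _.
- by split=> //; apply: IH (graded_for_cons gG).
- by split; apply: IH (graded_for_cons gG).
Qed.

Lemma kdegB xs i d (b c : kchains E xs) : graded_for xs G ->
  kdeg G i d b -> kdeg G i d c -> kdeg G i d (b - c).
Proof.
elim: xs i d b c => [|x xs IH] [|i] d b c gG /=; first exact: (gradedB gG).
- by move=> -> ->; rewrite subrr.
- move=> [b1 ->] [c1 ->]; rewrite subrr; split=> //.
  by apply: IH => //; apply: graded_for_cons gG.
- move=> [b1 b2] [c1 c2].
  by split; apply: IH => //; apply: graded_for_cons gG.
Qed.

Lemma kdegN xs i d (c : kchains E xs) : graded_for xs G ->
  kdeg G i d c -> kdeg G i d (- c).
Proof. by move=> gG cd; rewrite -sub0r; apply: kdegB => //; apply: kdeg0. Qed.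

Lemma kdegD xs i d (b c : kchains E xs) : graded_for xs G ->
  kdeg G i d b -> kdeg G i d c -> kdeg G i d (b + c).
Proof. by move=> gG bd cd; rewrite -[c]opprK; apply: kdegB => //; apply: kdegN. Qed.

Lemma kdegX xs i d x (c : kchains E xs) : graded_for (x :: xs) G ->
  kdeg G i d c -> kdeg G i (d + 1) (x *: c).
Proof.
elim: xs i d c => [|y xs IH] [|i] d c gG /=.
- by apply: (gradedX gG); rewrite mem_head.
- by move=> ->; rewrite scaler0.
- move=> [c1 ->]; rewrite scaler0; split=> //; apply: IH c1.
  by apply: graded_for_subset gG => z; rewrite !inE => /orP[] ->; rewrite ?orbT.
- move=> [c1 c2].
  have gG' : graded_for (x :: xs) G.
    by apply: graded_for_subset gG => z; rewrite !inE => /orP[] ->; rewrite ?orbT.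
  split; first exact: IH c1.
  by rewrite addrAC; apply: IH c2.
Qed.

Lemma kdiff_deg0 xs d (c : kchains E xs) : kdeg G 0 d c -> kdiff c = 0.
Proof.
elim: xs d c => [|x xs IH] d c //= [c1 c2].
by rewrite (IH _ _ c1) c2 scaler0 kdiff0 addr0 oppr0.
Qed.

Lemma kdeg_diff xs i d (c : kchains E xs) : graded_for xs G ->
  kdeg G i.+1 d c -> kdeg G i d (kdiff c).
Proof.
elim: xs i d c => [|x xs IH] i d c gG /=.
  by move=> _; case: i => //=; apply: graded0 gG _.
have gG' := graded_for_cons gG.
move=> [c1 c2]; split.
  apply: kdegD => //; first exact: IH.
  by rewrite -[d](subrK 1); apply: kdegX.
case: i c1 c2 => [|i] c1 c2; first by rewrite (kdiff_deg0 c2) oppr0.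
by apply: kdegN => //; apply: IH.
Qed.

(** All coefficients of a chain of homological degree i and total degree d have degree d - i. *)
Lemma kdeg_triv xs i d (c : kchains E xs) :
  (forall u, G (d - i%:Z) u -> u = 0) -> kdeg G i d c -> c = 0.
Proof.
elim: xs i d c => [|x xs IH] [|i] d c Gd //=.
- by move=> Gc; apply: Gd; rewrite subr0.
- by case: c => a b /= [/(IH _ _ _ Gd) -> ->].
- case: c => a b /= [/(IH _ _ _ Gd) -> /IH ->] // u.
  by move=> Gu; apply: Gd; rewrite intS opprD addrA.
Qed.

Lemma koszul_exact_triv xs i d : graded_for xs G ->
  (forall u, G (d - i%:Z) u -> u = 0) -> koszul_exact G xs i d.
Proof.
move=> gG Gd c cd _; exists 0; first exact: kdeg0.
by rewrite kdiff0 (kdeg_triv Gd cd).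
Qed.

End OneModule.

Lemma kdeg_shift E (G : int -> E -> Prop) xs a i d (c : kchains E xs) :
  kdeg (fun e => G (e - a)) i d c <-> kdeg G i (d - a) c.
Proof.
elim: xs i d c => [|x xs IH] [|i] d c //=.
  by split=> -[/IH c1 c2].
split=> -[/IH c1 c2]; split=> //; first by rewrite addrAC; apply/IH.
by apply/IH; rewrite addrAC.
Qed.

Lemma koszul_exact_shift E (G : int -> E -> Prop) xs a i d :
  koszul_exact (fun e => G (e - a)) xs i d <-> koszul_exact G xs i (d - a).
Proof.
split=> H c cd c0.
  have [b bd bc] := H c (iffRL (kdeg_shift G a i d c) cd) c0.
  by exists b => //; exact: iffLR (kdeg_shift G a _ d b) bd.
have [b bd bc] := H c (iffLR (kdeg_shift G a i d c) cd) c0.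
by exists b => //; exact: iffRL (kdeg_shift G a _ d b) bd.
Qed.

Lemma eq_kdeg E (G G' : int -> E -> Prop) xs i d (c : kchains E xs) :
  (forall e u, G e u <-> G' e u) -> kdeg G i d c <-> kdeg G' i d c.
Proof.
move=> eqG; elim: xs i d c => [|x xs IH] [|i] d c //=; first by split=> -[/IH c1 c2].
by split=> -[/IH c1 /IH c2].
Qed.

Lemma eq_koszul_exact E (G G' : int -> E -> Prop) xs i d :
  (forall e u, G e u <-> G' e u) -> koszul_exact G xs i d <-> koszul_exact G' xs i d.
Proof.
move=> eqG; have eqG' e u : G' e u <-> G e u by split=> /eqG.
split=> H c cd c0.
  have [b bd bc] := H c (iffLR (eq_kdeg _ _ _ eqG') cd) c0.
  by exists b => //; exact: iffLR (eq_kdeg _ _ _ eqG) bd.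
have [b bd bc] := H c (iffLR (eq_kdeg _ _ _ eqG) cd) c0.
by exists b => //; exact: iffLR (eq_kdeg _ _ _ eqG') bd.
Qed.

Section Functoriality.
Variables (E E' : lmodType A).

Fixpoint kmap (f : E -> E') xs : kchains E xs -> kchains E' xs :=
  if xs is _ :: xs' return kchains E xs -> kchains E' xs then
    fun c => (kmap f c.1, kmap f c.2)
  else f.

Lemma kmapB f xs : {morph f : u v / u - v} -> {morph kmap f (xs := xs) : u v / u - v}.
Proof. by move=> fB; elim: xs => [|x xs IH] //= u v; rewrite !IH. Qed.

Lemma kmap0 f xs : {morph f : u v / u - v} -> kmap f (0 : kchains E xs) = 0.
Proof. by move=> fB; rewrite -[X in kmap f X](subrr 0) kmapB // subrr. Qed.

Lemma kmap_diff f xs (c : kchains E xs) : {morph f : u v / u - v} ->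
  {in xs, forall x u, f (x *: u) = x *: f u} ->
  kmap f (kdiff c) = kdiff (kmap f c).
Proof.
move=> fB fX; have fZ x : x \in xs -> forall ys, {morph kmap f (xs := ys) : u / x *: u}.
  by move=> xxs; elim=> [|y ys IH] u //=; rewrite ?fX // !IH.
elim: xs c fX fZ => [|x xs IH] c fX fZ /=; first by rewrite -(subrr 0) fB subrr.
have fD ys : {morph kmap f (xs := ys) : u v / u + v}.
  move=> u v; rewrite -{1}[v]opprK -[- v]sub0r !kmapB // (kmap0 _ fB) sub0r.
  by rewrite opprK.
have fN ys : {morph kmap f (xs := ys) : u / - u}.
  by move=> u; rewrite -sub0r kmapB // (kmap0 _ fB) sub0r.
rewrite fD fN fZ ?mem_head // !IH // => y yxs; try apply: fX; try apply: fZ.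
all: by rewrite in_cons yxs orbT.
Qed.

Lemma kdeg_map f (G : int -> E -> Prop) (G' : int -> E' ->
    Prop) xs a i d (c : kchains E xs) :
  f 0 = 0 ->
  (forall d u, G d u -> G' (d + a) (f u)) -> kdeg G i d c -> kdeg G' i (d + a) (kmap f c).
Proof.
move=> f0 fG; have k0 ys : kmap f (0 : kchains E ys) = 0.
  by elim: ys => //= y ys ->.
elim: xs i d c => [|x xs IH] [|i] d c /=; first exact: fG.
- by move=> ->.
- by move=> [/IH c1 ->].
- by move=> [/IH c1 /IH c2]; rewrite addrAC.
Qed.

End Functoriality.
End Koszul.

Section LinearFun.
Variables (A : comNzRingType) (E E' : lmodType A) (f : E -> E').
Hypothesis f_lin : linear f.

Lemma linear_funB : {morph f : u v / u - v}.
Proof. by move=> u v; rewrite addrC -scaleN1r f_lin scaleN1r addrC. Qed.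

Lemma linear_fun0 : f 0 = 0.
Proof. by rewrite -[X in f X](subrr 0) linear_funB subrr. Qed.

Lemma linear_funZ r : {morph f : u / r *: u}.
Proof. by move=> u; rewrite -[r *: u]addr0 f_lin linear_fun0 addr0. Qed.

Lemma linear_funD : {morph f : u v / u + v}.
Proof. by move=> u v; rewrite -[u]scale1r f_lin !scale1r. Qed.

Lemma linear_fun_sum I (r : seq I) (P : pred I) (F : I -> E) :
  f (\sum_(i <- r | P i) F i) = \sum_(i <- r | P i) f (F i).
Proof. by apply: (big_morph f linear_funD linear_fun0). Qed.

End LinearFun.

(** * Pieces of the long exact sequence of Tor *)

Section ShortExact.
Variable A : comNzRingType.

(** Exactness is asked on the graded pieces only; [f] and [g] are maps of the ambient modules, which
    need not form an exact sequence. *)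
Record short_exact (E1 E2 E3 : lmodType A) (G1 : int -> E1 -> Prop)
    (G2 : int -> E2 -> Prop) (G3 : int -> E3 -> Prop)
    (f : E1 -> E2) (g : E2 -> E3) : Prop := ShortExact {
  se_linl : linear f;
  se_linr : linear g;
  se_degl : forall d u, G1 d u -> G2 d (f u);
  se_degr : forall d u, G2 d u -> G3 d (g u);
  se_inj : forall d u, G1 d u -> f u = 0 -> u = 0;
  se_comp : forall d u, G1 d u -> g (f u) = 0;
  se_ker : forall d v, G2 d v -> g v = 0 -> exists2 u, G1 d u & f u = v;
  se_surj : forall d w, G3 d w -> exists2 v, G2 d v & g v = w
}.

Variables (E1 E2 E3 : lmodType A) (G1 : int -> E1 -> Prop)
  (G2 : int -> E2 -> Prop) (G3 : int -> E3 -> Prop)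
  (f : E1 -> E2) (g : E2 -> E3).
Hypothesis S : short_exact G1 G2 G3 f g.

Lemma kchains_inj xs i d (c : kchains E1 xs) :
  kdeg G1 i d c -> kmap f c = 0 -> c = 0.
Proof.
elim: xs i d c => [|x xs IH] [|i] d c //=; first exact: (se_inj S).
- by case: c => a b /= [/IH Ha ->] [/Ha ->].
- by case: c => a b /= [/IH Ha /IH Hb] [/Ha -> /Hb ->].
Qed.

Lemma kchains_ker xs i d (c : kchains E2 xs) :
  kdeg G2 i d c -> kmap g c = 0 ->
      exists2 b : kchains E1 xs, kdeg G1 i d b & kmap f b = c.
Proof.
have f0 := linear_fun0 (se_linl S); have fB := linear_funB (se_linl S).
elim: xs i d c => [|x xs IH] [|i] d c //=; first exact: (se_ker S).
- by move=> -> _; exists 0.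
- case: c => a b /= [/IH Ha ->] [/Ha [a' da' <-] _].
  by exists (a', 0); rewrite //= kmap0.
- case: c => a b /= [/IH Ha /IH Hb] [/Ha [a' da' <-] /Hb [b' db' <-]].
  by exists (a', b').
Qed.

Lemma kchains_surj xs i d (c : kchains E3 xs) :
  kdeg G3 i d c -> exists2 b : kchains E2 xs, kdeg G2 i d b & kmap g b = c.
Proof.
have g0 := linear_fun0 (se_linr S); have gB := linear_funB (se_linr S).
elim: xs i d c => [|x xs IH] [|i] d c //=; first exact: (se_surj S).
- by move=> ->; exists 0.
- case: c => a b /= [/IH [a' da' <-] ->].
  by exists (a', 0); rewrite //= kmap0.
- case: c => a b /= [/IH [a' da' <-] /IH [b' db' <-]].
  by exists (a', b').
Qed.

Lemma kchains_comp xs i d (c : kchains E1 xs) :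
  kdeg G1 i d c -> kmap g (kmap f c) = 0.
Proof.
have f0 := linear_fun0 (se_linl S); have g0 := linear_fun0 (se_linr S).
have k0 ys : kmap g (kmap f (0 : kchains E1 ys)) = 0.
  by rewrite kmap0 ?kmap0 //; apply: linear_funB; [apply: se_linr S|apply: se_linl S].
elim: xs i d c => [|x xs IH] [|i] d c /=; first exact: (se_comp S).
- by move=> ->; rewrite f0.
- by case: c => a b /= [/IH -> ->]; rewrite k0.
- by case: c => a b /= [/IH -> /IH ->].
Qed.

Variable xs : seq A.
Hypotheses (gr1 : graded_for xs G1) (gr2 : graded_for xs G2).

Let fB := linear_funB (se_linl S).
Let gB := linear_funB (se_linr S).
Let f_diff (c : kchains E1 xs) : kmap f (kdiff c) = kdiff (kmap f c).
Proof. by apply: kmap_diff => // x _ u; apply: linear_funZ (se_linl S) _ _. Qed.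
Let g_diff (c : kchains E2 xs) : kmap g (kdiff c) = kdiff (kmap g c).
Proof. by apply: kmap_diff => // x _ u; apply: linear_funZ (se_linr S) _ _. Qed.
Let f_deg i d (c : kchains E1 xs) : kdeg G1 i d c -> kdeg G2 i d (kmap f c).
Proof.
move=> cd; rewrite -[d]addr0; apply: kdeg_map cd; first exact: linear_fun0 (se_linl S).
by move=> e u; rewrite addr0; apply: (se_degl S).
Qed.
Let g_deg i d (c : kchains E2 xs) : kdeg G2 i d c -> kdeg G3 i d (kmap g c).
Proof.
move=> cd; rewrite -[d]addr0; apply: kdeg_map cd; first exact: linear_fun0 (se_linr S).
by move=> e u; rewrite addr0; apply: (se_degr S).
Qed.

(** The boundary of a lift of a cycle comes from a cycle of [G1]; once that one bounds, the lift can
    be corrected to a cycle of [G2]. *)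
Lemma koszul_exact_quo i d : koszul_exact G2 xs i d ->
  (if i is i'.+1 then koszul_exact G1 xs i' d else True) -> koszul_exact G3 xs i d.
Proof.
move=> ex2 ex1 c cd c0; have [b bd bc] := kchains_surj cd; subst c.
suff [b' bd' [bb' bd'0]] : exists2 b', kdeg G2 i d b' & kmap g b' = kmap g b /\ kdiff
    b' = 0.
  have [a ad ab] := ex2 _ bd' bd'0.
  by exists (kmap g a); [exact: g_deg | rewrite -g_diff ab].
case: i cd bd ex1 ex2 => [|i] cd bd ex1 ex2.
  by exists b; last by rewrite (kdiff_deg0 bd).
have := kdeg_diff gr2 bd => /kchains_ker; rewrite g_diff c0 => /(_ erefl) [a ad ab].
have da : kdiff a = 0.
  case: i ad {cd bd ex1 ex2} => [|i] ad; first exact: kdiff_deg0 ad.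
  by apply: (kchains_inj (kdeg_diff gr1 ad)); rewrite f_diff ab kdiff_sq.
have [a' ad' aa'] := ex1 _ ad da.
exists (b - kmap f a'); first by apply: kdegB => //; apply: f_deg.
rewrite (kmapB gB) (kchains_comp ad') subr0; split=> //.
by rewrite kdiffB -f_diff aa' ab subrr.
Qed.

(** The second hypothesis says that Tor_i(G1) maps to zero in Tor_i(G2), rather than that Tor_i(G2)
    vanishes: for a minimal cover and i = 0 only the former holds. *)
Lemma koszul_exact_sub i d : koszul_exact G3 xs i.+1 d ->
  (forall a : kchains E1 xs, kdeg G1 i d a ->
     kdeg G2 i d (kmap f a) -> kdiff (kmap f a) = 0 ->
     exists2 b : kchains E2 xs, kdeg G2 i.+1 d b & kdiff b = kmap f a) ->
  koszul_exact G1 xs i d.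
Proof.
move=> ex3 ex2 a ad a0.
have [||b bd ba] := ex2 a ad; [exact: f_deg|by rewrite -f_diff a0 kmap0|].
have [| |c cd cb] := ex3 (kmap g b); first exact: g_deg.
  by rewrite -g_diff ba (kchains_comp ad).
have [c' cd' cc'] := kchains_surj cd; subst c.
have [| |a' ad' aa'] := @kchains_ker xs i.+1 d (b - kdiff c').
- by apply: kdegB => //; apply: kdeg_diff.
- by rewrite (kmapB gB) g_diff cb subrr.
exists a' => //; apply/eqP; rewrite -subr_eq0; apply/eqP.
apply: (kchains_inj (i := i) (d := d)); first by apply: kdegB => //; apply: kdeg_diff.
by rewrite (kmapB fB) f_diff aa' kdiffB kdiff_sq subr0 ba subrr.
Qed.

Lemma koszul_exact_mid i d : koszul_exact G1 xs i d -> koszul_exact G3 xs i d ->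
  koszul_exact G2 xs i d.
Proof.
move=> ex1 ex3 b bd b0.
have [| |c cd cb] := ex3 (kmap g b); first exact: g_deg.
  by rewrite -g_diff b0 kmap0.
have [c' cd' cc'] := kchains_surj cd; subst c.
have [| |a ad aa] := @kchains_ker xs i d (b - kdiff c').
- by apply: kdegB => //; apply: kdeg_diff.
- by rewrite (kmapB gB) g_diff cb subrr.
have [|a' ad' aa'] := ex1 a ad.
  case: i ex1 ex3 bd cd cd' ad => [|i] _ _ _ _ _ ad; first exact: kdiff_deg0 ad.
  apply: (kchains_inj (kdeg_diff gr1 ad)).
  by rewrite f_diff aa kdiffB b0 kdiff_sq subr0.
exists (kmap f a' + c'); first by apply: kdegD => //; apply: f_deg.
by rewrite kdiffD -f_diff aa' aa subrK.
Qed.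

End ShortExact.

(** * Homogeneous polynomials *)

Section Homogeneous.
Variables (K : fieldType) (n : nat).
Local Notation R := {mpoly K[n]}.

Lemma zhomogP d (p : R) :
  zhomog d p <-> forall m, p@_m != 0 -> (mdeg m)%:Z = d.
Proof.
case: d => d /=; split.
- by move/dhomogP => H m; rewrite -mcoeff_msupp => /H /= ->.
- by move=> H; apply/dhomogP => m; rewrite mcoeff_msupp => /H [].
- by move=> -> m; rewrite mcoeff0 eqxx.
- by move=> H; apply/mpolyP => m; rewrite mcoeff0; apply/eqP/negP => /negP /H.
Qed.

Lemma zhomog0 d : zhomog d (0 : R).
Proof. by apply/zhomogP => m; rewrite mcoeff0 eqxx. Qed.

Lemma zhomogB d (p q : R) : zhomog d p -> zhomog d q -> zhomog d (p - q).
Proof.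
move=> /zhomogP Hp /zhomogP Hq; apply/zhomogP => m; rewrite mcoeffB => nz.
have [p0|/Hp //] := eqVneq p@_m 0.
by apply: Hq; apply: contraNneq nz => ->; rewrite p0 subr0.
Qed.

Lemma zhomogN d (p : R) : zhomog d p -> zhomog d (- p).
Proof. by rewrite -sub0r; apply: zhomogB; apply: zhomog0. Qed.

Lemma zhomogD d (p q : R) : zhomog d p -> zhomog d q -> zhomog d (p + q).
Proof. by move=> Hp Hq; rewrite -[q]opprK; apply: zhomogB => //; apply: zhomogN. Qed.

Lemma zhomogM d e (p q : R) : zhomog d p -> zhomog e q -> zhomog (d + e) (p * q).
Proof.
case: d e => d [] e Hp Hq; first exact: dhomogM.
- by rewrite (Hq : q = 0) mulr0; apply: zhomog0.
- by rewrite (Hp : p = 0) mul0r; apply: zhomog0.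
- by rewrite (Hp : p = 0) mul0r; apply: zhomog0.
Qed.

Lemma zhomogC c : zhomog 0 (c%:MP : R).
Proof.
apply/zhomogP => m; rewrite mcoeffC; case: (eqVneq m 0%MM) => [->|_];
    first by rewrite mdeg0.
by rewrite mulr0 eqxx.
Qed.

Lemma zhomogX i : zhomog 1 ('X_i : R).
Proof. by rewrite /= dhomogX /= mdeg1. Qed.

Lemma zhomog_const d (p : R) : zhomog d p -> d != 0 -> p@_0%MM = 0.
Proof.
move=> /zhomogP H d0; apply/eqP; apply: contraNT d0 => /H <-.
by rewrite mdeg0.
Qed.

Lemma zhomog_eqC (p : R) : zhomog 0 p -> p = (p@_0%MM)%:MP.
Proof.
move=> /zhomogP H; apply/mpolyP => m; rewrite mcoeffC.
case: eqP => [->|m0]; first by rewrite mulr1.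
rewrite mulr0; apply/eqP; apply: contraT => /H [] /eqP.
by rewrite mdeg_eq0 => /eqP.
Qed.

Lemma zhomog_lt0 d (p : R) : (d < 0)%R -> zhomog d p -> p = 0.
Proof. by case: d. Qed.

Lemma mcoeff_bounded (c : 'X_{1..n} -> K) k (m : 'X_{1..n}) :
  (forall m, (k <= mdeg m)%N -> c m = 0) ->
  (\sum_(m : 'X_{1..n < k}) c m *: 'X_[m])@_m = c m.
Proof.
move=> c0; have [mk|km] := ltnP (mdeg m) k; first exact: mcoeff_mpoly.
rewrite c0 // raddf_sum big1 // => m' _ /=; rewrite mcoeffZ mcoeffX.
case: eqP => [mm|]; last by rewrite mulr0.
by have := bmdeg m'; rewrite mm ltnNge km.
Qed.

Lemma mcoeffXM i (p : R) m :
  ('X_i * p)@_m = if (0 < m i)%N then p@_(m - U_(i)) else 0.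
Proof.
rewrite mulrC; case: ifPn => [mi|mi].
  have {1}-> : m = (U_(i) + (m - U_(i)))%MM.
    by rewrite addmC submK // lep1mP -lt0n.
  by rewrite mcoeffMX.
apply: memN_msupp_eq0; rewrite (perm_mem (msuppMX _ _)); apply/mapP => -[m' _ mm].
by move: mi; rewrite mm mnmDE mnm1E eqxx.
Qed.

(** The left inverse of multiplication by ['X_i] that drops the terms free of ['X_i]. The bound
    [msize p] merely makes the sum finite. *)
Definition mshift i (p : R) : R :=
  \sum_(m : 'X_{1..n < msize p}) p@_(m + U_(i)) *: 'X_[m].

Lemma mcoeff_mshift i p m : (mshift i p)@_m = p@_(m + U_(i)).
Proof.
rewrite [LHS](@mcoeff_bounded (fun m => p@_(m + U_(i)))) // => m' H.
apply: memN_msupp_eq0; apply: msize_mdeg_ge.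
by rewrite mdegD (leq_trans H) ?leq_addr.
Qed.

Lemma mshiftB i : {morph mshift i : p q / p - q}.
Proof. by move=> p q; apply/mpolyP => m; rewrite mcoeffB !mcoeff_mshift mcoeffB. Qed.

Lemma mshiftXK i p : mshift i ('X_i * p) = p.
Proof.
apply/mpolyP => m; rewrite mcoeff_mshift mcoeffXM mnmDE mnm1E eqxx addn1 /=.
by rewrite addmK.
Qed.

Lemma mshiftX i j p : i != j -> mshift i ('X_j * p) = 'X_j * mshift i p.
Proof.
move=> ij; apply/mpolyP => m; rewrite mcoeff_mshift !mcoeffXM mcoeff_mshift.
rewrite mnmDE mnm1E (negbTE ij) addn0; case: ifPn => // mj; congr mcoeff.
apply/mnmP => k; rewrite !(mnmBE, mnmDE, mnm1E).
by have [<-|] := eqVneq j k; rewrite ?(negbTE ij) ?addn0 // !subn0.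
Qed.

Lemma zhomog_mshift i d p : zhomog d p -> zhomog (d - 1) (mshift i p).
Proof.
move=> /zhomogP H; apply/zhomogP => m; rewrite mcoeff_mshift => /H <-.
by rewrite mdegD mdeg1 addn1 intS addrC addKr.
Qed.

Lemma zhomog_irrelevant d (p : R) : zhomog d p -> p@_0%MM = 0 ->
  exists2 f : 'I_n -> R, (forall i, zhomog (d - 1) (f i)) & p = \sum_i 'X_i * f i.
Proof.
move=> hp p0.
(* Each nonconstant monomial is charged to one variable dividing it, so that no term is counted
   twice. *)
pose fst (m : 'X_{1..n}) := [pick i | (0 < m i)%N].
pose c i m := if fst (m + U_(i))%MM == Some i then p@_(m + U_(i)) else 0.
exists (fun i => \sum_(m : 'X_{1..n < msize p}) c i m *: 'X_[m]).
  move=> i; apply/zhomogP => m; rewrite mcoeff_bounded.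
    rewrite /c; case: ifP => [_ |]; last by rewrite eqxx.
    by rewrite -mcoeff_mshift; have /zhomogP := zhomog_mshift i hp; apply.
  move=> m' H; rewrite /c; case: ifP => // _.
  by rewrite memN_msupp_eq0 // msize_mdeg_ge // mdegD (leq_trans H) ?leq_addr.
apply/mpolyP => m; rewrite raddf_sum /=.
have E i : ('X_i * (\sum_(m : 'X_{1..n < msize p}) c i m *: 'X_[m]))@_m =
    if fst m == Some i then p@_m else 0.
  rewrite mcoeffXM mcoeff_bounded; last first.
    move=> m' H; rewrite /c; case: ifP => // _.
    by rewrite memN_msupp_eq0 // msize_mdeg_ge // mdegD (leq_trans H) ?leq_addr.
  case: ifPn => [mi|mi].
    by rewrite /c submK // lep1mP -lt0n.
  case: eqP => //; rewrite /fst; case: pickP => //= j mj [ji].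
  by rewrite -ji mj in mi.
rewrite (eq_bigr _ (fun i _ => E i)) /fst; case: pickP => [i mi|m0].
  by rewrite (bigD1 i) //= eqxx big1 ?addr0 // => j /negbTE ji;
      case: eqP => // -[] /esym/eqP; rewrite ji.
rewrite big1 // -[RHS]p0; congr mcoeff; apply/mnmP => i; rewrite mnm0E.
by apply/eqP; rewrite -leqn0 leqNgt m0.
Qed.

End Homogeneous.

(** * Vanishing of Tor *)

Section TorVanishing.
Variables (K : fieldType) (n : nat).
Local Notation R := {mpoly K[n]}.
Local Notation xvars s := [seq ('X_i : R) | i <- s].

Record graded_module (E : lmodType R) (G : int -> E -> Prop) : Prop := GradedModule {
  gmod0 : forall d, G d 0;
  gmodB : forall d u v, G d u -> G d v -> G d (u - v);
  gmodM : forall a d r u, zhomog a r -> G d u -> G (d + a) (r *: u)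
}.

Lemma gmodD (E : lmodType R) (G : int -> E -> Prop) d u v : graded_module G ->
  G d u -> G d v -> G d (u + v).
Proof.
by case=> G0 GB _ Gu Gv; rewrite -[v]opprK -[- v]sub0r; apply: (GB) => //; apply: (GB).
Qed.

Lemma gmod_sum (E : lmodType R) (G : int -> E ->
    Prop) d I (r : seq I) (P : pred I) (F : I -> E) :
  graded_module G -> (forall i, P i -> G d (F i)) -> G d (\sum_(i <- r | P i) F i).
Proof.
move=> gG H; elim/big_ind: _ => // [|u v]; first exact: gmod0.
exact: gmodD.
Qed.

Lemma gmodZ (E : lmodType R) (G : int -> E -> Prop) d c u : graded_module G ->
  G d u -> G d (c%:MP *: u).
Proof. by move=> gG Gu; rewrite -[d]addr0; apply: gmodM (zhomogC _ _) Gu. Qed.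

Lemma gmod_graded_for s (E : lmodType R) (G : int -> E -> Prop) :
  graded_module G -> graded_for (xvars s) G.
Proof.
move=> gG; split; [exact: gmod0 gG|exact: gmodB gG|].
by move=> d x u /mapP[i _ ->]; apply: (gmodM gG); apply: zhomogX.
Qed.

(* Vanishing of [Tor_i(G, K)_d], computed by the Koszul complex of [G]. *)
Definition tor_vanish (E : lmodType R) (G : int -> E -> Prop) i d :=
  koszul_exact G (xvars (enum 'I_n)) i d.

Definition in_irrelevant (E : lmodType R) (G : int -> E -> Prop) d (u : E) : Prop :=
  exists2 f : 'I_n -> E, (forall i, G (d - 1) (f i)) & u = \sum_i 'X_i *: f i.

Fixpoint kchain0 (E : lmodType R) (xs : seq R) (e : E) : kchains E xs :=
  if xs is _ :: xs' return kchains E xs then (kchain0 xs' e, 0) else e.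

Section Degree0.
Variables (E : lmodType R) (G : int -> E -> Prop).
Hypothesis gG : graded_module G.

Lemma kdeg_chain0 xs d e : G d e -> kdeg G 0 d (kchain0 xs e).
Proof. by move=> Ge; elim: xs => [|x xs IH] //=. Qed.

Lemma kdeg0P xs d (c : kchains E xs) : kdeg G 0 d c ->
  exists2 e, G d e & c = kchain0 xs e.
Proof.
elim: xs c => [|x xs IH] c /=; first by exists c.
by case: c => a b /= [/IH[e Ge ->] ->]; exists e.
Qed.

Lemma kchain0B xs : {morph @kchain0 E xs : u v / u - v}.
Proof.
elim: xs => [|x xs IH] //= u v; rewrite IH.
apply: (@etrans _ _ (kchain0 xs u - kchain0 xs v, 0 - 0)) => //.
by rewrite subrr.
Qed.

Lemma kchain0Z xs r : {morph @kchain0 E xs : u / r *: u}.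
Proof.
elim: xs => [|x xs IH] //= u; rewrite IH.
apply: (@etrans _ _ (r *: kchain0 xs u, r *: 0)) => //.
by rewrite scaler0.
Qed.

Lemma kboundary0P (s : seq 'I_n) d e : uniq s ->
  (exists2 b, kdeg G 1 d b & kdiff b = kchain0 (xvars s) e) <->
  (exists2 f : 'I_n -> E, (forall i, G (d - 1) (f i)) & e = \sum_(i <- s) 'X_i *: f i).
Proof.
elim: s e => [|i s IH] e /=.
  move=> _; split=> [[b _ <-]|[f _ ->]]; last by exists 0; rewrite ?big_nil.
  by exists (fun=> 0) => [i|]; [apply: gmod0|rewrite big_nil].
case/andP=> iNs us; split.
  case=> -[a b] /= [da db] [] ab _.
  have [u Gu ub] := kdeg0P db; subst b.
  have /(proj1 (IH _ us))[f Gf ef] : exists2 b, kdeg G 1 d b & kdiff b = kchain0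
      (xvars s) (e - 'X_i *: u).
    exists a => //; rewrite kchain0B kchain0Z -ab addrK //.
  exists (fun j => if j == i then u else f j).
    by move=> j; case: ifP.
  rewrite big_cons eqxx -[LHS](subrK ('X_i *: u)) ef addrC; congr (_ + _).
  rewrite !big_seq; apply: eq_bigr => j js.
  by case: eqP => // ji; rewrite -ji js in iNs.
case=> f Gf; rewrite big_cons => ef.
have [|a da ab] := proj2 (IH (e - 'X_i *: f i) us).
  by exists f => //; rewrite ef addrC addKr.
exists (a, kchain0 (xvars s) (f i)) => /=; first by split=> //; apply: kdeg_chain0.
rewrite ab kchain0B kchain0Z subrK; congr pair.
by rewrite (kdiff_deg0 (kdeg_chain0 _ (Gf i))) oppr0.
Qed.

Lemma kboundary0_irrelevant d e :
  (exists2 b, kdeg G 1 d b & kdiff b = kchain0 (xvars (enum 'I_n)) e) <->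
  in_irrelevant G d e.
Proof.
have [H1 H2] := kboundary0P d e (enum_uniq 'I_n).
by split=> [/H1|] [f Gf ef]; [exists f|apply: H2; exists f] => //; rewrite ef big_enum.
Qed.

(** Tor_0 is the quotient of the module by the irrelevant ideal times it, that is, the space of
    minimal generators. *)
Lemma tor_vanish0P d :
  tor_vanish G 0 d <-> forall e, G d e -> in_irrelevant G d e.
Proof.
split=> [H e Ge|H c /[dup] cd /kdeg0P[e Ge ->] _]; last first.
  by case: (iffRL (kboundary0_irrelevant d e) (H e Ge)) => b bd be; exists b.
apply/(kboundary0_irrelevant d e).
by apply: H; [exact: kdeg_chain0|exact: kdiff_deg0 (kdeg_chain0 _ Ge)].
Qed.

End Degree0.

(* [D i] divides by the variable [X_i] and kills what is free of it: it
   contracts the part of the Koszul complex that involves [X_i]. *)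
Lemma koszul_exact_division (E : lmodType R) (G : int -> E -> Prop)
    (D : 'I_n -> E -> E) s i d : graded_module G ->
  (forall i, {morph D i : u v / u - v}) ->
  (forall i u, D i ('X_i *: u) = u) ->
  (forall i j u, i != j -> D i ('X_j *: u) = 'X_j *: D i u) ->
  (forall i d u, G d u -> G (d - 1) (D i u)) ->
  uniq s -> koszul_exact G (xvars s) i.+1 d.
Proof.
move=> gG DB DK DX DG; elim: s i d => [|x s IH] i d /=.
  by move=> _ c -> _; exists 0.
case/andP=> xs us [a b] /= [da db] [] ab b0.
have gs := @gmod_graded_for s E G gG.
have D0 : D x 0 = 0 by rewrite -[X in D x X](subrr 0) DB subrr.
have Dd (c : kchains E (xvars s)) : kmap (D x) (kdiff c) = kdiff (kmap (D x) c).
  apply: kmap_diff => // _ /mapP[j js ->] u; apply: DX.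
  by apply: contraNneq xs => ->.
have Ddeg k e (c : kchains E (xvars s)) : kdeg G k e c -> kdeg G k (e - 1) (kmap (D x) c).
  by apply: kdeg_map => //; apply: DG.
have KX ys (c : kchains E ys) : kmap (D x) ('X_x *: c) = c.
  by elim: ys c => [|y ys IHy] c //=; case: c => c1 c2 /=; rewrite !IHy.
(* Dividing the first component of the cycle equation by the variable expresses [b] through [a]. *)
have eb : b = - kdiff (kmap (D x) a).
  have da' : kdiff a = - ('X_x *: b) by apply/eqP; rewrite -addr_eq0 ab.
  by rewrite -Dd da' -[X in kmap _ X]sub0r kmapB // (kmap0 _ (DB x)) sub0r KX opprK.
(* With this correction the first component becomes a cycle on the remaining variables. *)
have [||c dc cc] := IH i d us (a - 'X_x *: kmap (D x) a).
- apply: kdegB => //; rewrite -[d](subrK 1).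
  by apply: (kdegX (@gmod_graded_for (x :: s) E G gG)); apply: Ddeg.
- by rewrite kdiffB kdiffZ -[RHS]ab eb scalerN.
exists (c, kmap (D x) a) => /=; first by split=> //; apply: Ddeg.
by rewrite cc subrK -eb.
Qed.

Definition free_deg (tw : seq int) (d : int) (v : 'rV[R]_(size tw)) : Prop :=
  forall k : 'I_(size tw), zhomog (d - tw`_k) (v 0 k).

Section Free.
Variable tw : seq int.
Local Notation F := ('rV[R]_(size tw)).

Lemma free_graded : graded_module (@free_deg tw).
Proof.
split=> [d k|d u v du dv k|a d r u hr du k]; rewrite !mxE.
- exact: zhomog0.
- exact: zhomogB.
- by rewrite addrAC addrC; apply: zhomogM.
Qed.

Lemma free_tor_vanish i d : tor_vanish (@free_deg tw) i.+1 d.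
Proof.
apply: (@koszul_exact_division _ _ (fun i => map_mx (@mshift K n i))).
- exact: free_graded.
- by move=> j u v; apply/rowP => k; rewrite !mxE mshiftB.
- by move=> j u; apply/rowP => k; rewrite !mxE mshiftXK.
- by move=> j l u jl; apply/rowP => k; rewrite !mxE mshiftX.
- by move=> j e u du k; rewrite mxE addrAC; apply: zhomog_mshift.
- exact: enum_uniq.
Qed.

Lemma free_irrelevant d (v : F) : free_deg d v ->
  (forall k, (v 0 k)@_0%MM = 0) -> in_irrelevant (@free_deg tw) d v.
Proof.
move=> dv v0.
have H (k : 'I_(size tw)) : exists f : {ffun 'I_n ->
    R}, (forall i, zhomog (d - tw`_k - 1) (f i)) /\ v 0 k = \sum_i 'X_i * f i.
  have [f Hf Ef] := zhomog_irrelevant (dv k) (v0 k).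
  by exists (finfun f); split=> [i|]; [rewrite ffunE|rewrite Ef;
      apply: eq_bigr => i _; rewrite ffunE].
have /fin_all_exists[f Hf] := H.
exists (fun i => \row_k f k i) => [i k|].
  by rewrite mxE addrAC; case: (Hf k).
apply/rowP => k; rewrite summxE; case: (Hf k) => _ ->.
by apply: eq_bigr => i _; rewrite !mxE.
Qed.

Lemma free_unit (k : 'I_(size tw)) : free_deg tw`_k (delta_mx 0 k : F).
Proof.
move=> l; rewrite mxE /=; case: eqP => [->|_].
  by rewrite subrr; apply: zhomogC.
exact: zhomog0.
Qed.

End Free.
End TorVanishing.

(** * Minimal covers and resolutions *)

Section MinimalCover.
Variables (K : fieldType) (n : nat).
Local Notation R := {mpoly K[n]}.

(** One step of a minimal graded free resolution; [mc_min] places the kernel inside the irrelevant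
    ideal times the free module. *)
Record minimal_cover (E : lmodType R) (G : int -> E -> Prop) (tw : seq int)
    (phi : 'rV[R]_(size tw) -> E) : Prop := MinimalCover {
  mc_linear : linear phi;
  mc_deg : forall d v, free_deg d v -> G d (phi v);
  mc_surj : forall d e, G d e -> exists2 v, free_deg d v & phi v = e;
  mc_min : forall d v, free_deg d v -> phi v = 0 -> forall k, (v 0 k)@_0%MM = 0
}.

Definition ker_deg (E : lmodType R) (tw : seq int) (phi : 'rV[R]_(size tw) -> E)
  d v : Prop := free_deg d v /\ phi v = 0.

Variables (E : lmodType R) (G : int -> E -> Prop) (tw : seq int)
  (phi : 'rV[R]_(size tw) -> E).
Hypotheses (gG : graded_module G) (mc : minimal_cover G phi).

Lemma ker_graded : graded_module (ker_deg phi).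
Proof.
have lin := mc_linear mc; have [F0 FB FM] := @free_graded K n tw.
split=> [d|d u v [du u0] [dv v0]|a d r u hr [du u0]].
- by split; [exact: F0|exact: linear_fun0 lin].
- by split; [exact: FB|rewrite (linear_funB lin) u0 v0 subrr].
- by split; [exact: FM|rewrite (linear_funZ lin) u0 scaler0].
Qed.

Lemma ker_short_exact : short_exact (ker_deg phi) (@free_deg K n tw) G id phi.
Proof.
split=> //; first exact: mc_linear mc.
- by move=> d u [].
- exact: mc_deg mc.
- by move=> d u [].
- by move=> d v dv v0; exists v.
- exact: mc_surj mc.
Qed.

(** Dimension shifting. For i = 0 the free module may have nonzero Tor_0, but by minimality the
    kernel maps to zero in it. *)
Lemma cover_tor_vanish i d : tor_vanish G i.+1 d <-> tor_vanish (ker_deg phi) i d.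
Proof.
have S := ker_short_exact.
have g1 := @gmod_graded_for _ _ (enum 'I_n) _ _ ker_graded.
have g2 := @gmod_graded_for _ _ (enum 'I_n) _ _ (@free_graded K n tw).
split=> H; last first.
  exact: (koszul_exact_quo S g1 g2 (i := i.+1) (@free_tor_vanish _ _ _ _ _) H).
apply: (koszul_exact_sub S g1 g2 H); case: i {H} => [|i] a da; last first.
  by move=> df d0; apply: free_tor_vanish.
have [u [du u0] -> _ _] := kdeg0P da.
have -> : kmap id (kchain0 [seq 'X_i | i <- enum 'I_n] u) = kchain0 _ u.
  by elim: [seq _ | _ <- _] => //= x xs ->; rewrite kmap0.
apply/kboundary0_irrelevant; first exact: free_graded.
exact: free_irrelevant du (mc_min mc du u0).
Qed.

(** If the image of a basis vector were in the irrelevant ideal times the module, it would lift to a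
    vector [w] without constant terms, and the basis vector minus [w] would be a kernel element with
    a unit entry. *)
Lemma cover_twist d : d \in tw -> ~ tor_vanish G 0 d.
Proof.
move=> /(nthP 0)[j jtw <-] /(tor_vanish0P gG) H.
pose k := Ordinal jtw;
    have dk : free_deg tw`_k (delta_mx 0 k : 'rV[R]__) := free_unit _ _ k.
have [f Gf ef] := H _ (mc_deg mc dk).
have Hf i : exists v, free_deg (tw`_k - 1) v /\ phi v = f i.
  by have [v dv vf] := mc_surj mc (Gf i); exists v.
have /fin_all_exists[g Hg] := Hf.
pose w : 'rV[R]_(size tw) := \sum_i 'X_i *: g i.
have lin := mc_linear mc.
have dw : free_deg tw`_k w.
  rewrite /w; apply: (@gmod_sum K n _ (@free_deg K n tw)) => [|i _];
      first exact: free_graded.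
  rewrite -[tw`_k](subrK 1).
  by apply: (gmodM (@free_graded K n tw)); [exact: zhomogX|case: (Hg i)].
have w0 : phi (delta_mx 0 k - w) = 0.
  rewrite (linear_funB lin) ef (linear_fun_sum lin) -sumrB big1 // => i _.
  by rewrite (linear_funZ lin); case: (Hg i) => _ ->; rewrite subrr.
have w1 : (w 0 k)@_0%MM = 0.
  rewrite summxE raddf_sum big1 // => i _.
  by rewrite /= mxE mcoeffXM mnm0E.
move: w dw w0 w1 => w dw w0 w1.
have := mc_min mc (gmodB (@free_graded K n tw) dk dw) w0 k.
rewrite !mxE !eqxx mcoeffB w1 subr0 mcoeff1 eqxx.
by move/eqP; rewrite oner_eq0.
Qed.

(** When d is no twist, the entries of a vector of degree d have nonzero degree, hence no constant
    term. *)
Lemma cover_notwist d : d \notin tw -> tor_vanish G 0 d.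
Proof.
move=> dtw; apply/(tor_vanish0P gG) => e /(mc_surj mc)[v dv <-].
have [f df ->] : in_irrelevant (@free_deg K n tw) d v.
  apply: free_irrelevant => // k; apply: zhomog_const (dv k) _.
  by rewrite subr_eq0; apply: contraNneq dtw => ->; apply: mem_nth.
have lin := mc_linear mc.
exists (fun i => phi (f i)); first by move=> i; exact: (mc_deg mc (df i)).
by rewrite (linear_fun_sum lin); apply: eq_bigr => i _; rewrite (linear_funZ lin).
Qed.

End MinimalCover.

(** * Homogeneous components *)

Section Components.
Variables (K : fieldType) (n : nat).
Local Notation R := {mpoly K[n]}.

Definition zcomp (d : int) (p : R) : R :=
  \sum_(m : 'X_{1..n < msize p}) (if (mdeg m)%:Z == d then p@_m else 0) *: 'X_[m].

Lemma mcoeff_zcomp d p m : (zcomp d p)@_m = if (mdeg m)%:Z == d then p@_m else 0.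
Proof.
rewrite [LHS](@mcoeff_bounded _ _ (fun m => if (mdeg m)%:Z == d then p@_m else 0)) //.
by move=> m' H; rewrite memN_msupp_eq0 ?msize_mdeg_ge // if_same.
Qed.

Lemma zhomog_zcomp d p : zhomog d (zcomp d p).
Proof. by apply/zhomogP => m; rewrite mcoeff_zcomp;
    case: (eqVneq (mdeg m)%:Z d) => //; rewrite eqxx. Qed.

Lemma zcomp_id d p : zhomog d p -> zcomp d p = p.
Proof.
move=> /zhomogP H; apply/mpolyP => m; rewrite mcoeff_zcomp; case: eqP => // md.
by apply/esym/eqP; apply: contraT => /H.
Qed.

Lemma zcompD d : {morph zcomp d : p q / p + q}.
Proof.
by move=> p q; apply/mpolyP => m; rewrite mcoeffD !mcoeff_zcomp; case: ifP;
    rewrite ?mcoeffD ?addr0.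
Qed.

Lemma zcomp0 d : zcomp d 0 = 0.
Proof. by apply: zcomp_id; apply: zhomog0. Qed.

Lemma zcomp_sum d I (r : seq I) (P : pred I) (F : I -> R) :
  zcomp d (\sum_(i <- r | P i) F i) = \sum_(i <- r | P i) zcomp d (F i).
Proof. by apply: (big_morph _ (zcompD d) (zcomp0 d)). Qed.

Lemma zcompM a b p q : zhomog b q -> zcomp (a + b) (p * q) = zcomp a p * q.
Proof.
move=> hq; apply/mpolyP => m; rewrite mcoeff_zcomp; case: eqP => [mab|mab].
  rewrite !mcoeffM; apply: eq_bigr => -[k1 k2] /= /eqP mk.
  rewrite mcoeff_zcomp; have [->|nz] := eqVneq q@_k2 0; first by rewrite !mulr0.
  have /zhomogP/(_ _ nz) kb := hq.
  suff -> : (mdeg k1)%:Z == a by [].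
  apply/eqP; apply: (addIr b); rewrite -mab -kb -PoszD -mdegD; congr (Posz (mdeg _)).
  exact: esym mk.
apply/esym/eqP; apply: contraT => nz; case: mab.
by have /zhomogP := zhomogM (zhomog_zcomp a p) hq; apply.
Qed.

Lemma zcomp_partition p k : (msize p <= k)%N -> p = \sum_(d < k) zcomp (d : nat)%:Z p.
Proof.
move=> pk; apply/mpolyP => m; rewrite raddf_sum /=.
under eq_bigr do rewrite mcoeff_zcomp.
have [km|mk] := leqP k (mdeg m).
  rewrite memN_msupp_eq0 ?msize_mdeg_ge ?(leq_trans pk) // big1 // => i _.
  exact: if_same.
rewrite (bigD1 (Ordinal mk)) //= eqxx big1 ?addr0 // => i im.
by rewrite ifN // eqz_nat eq_sym.
Qed.

(** The exactness conditions of a resolution range over arbitrary vectors. Since components commute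
    with homogeneous matrices, they can be transferred to and from single degrees. *)
Definition row_comp (tw : seq int) (d : int) (v : 'rV[R]_(size tw)) : 'rV[R]_(size tw) :=
  \row_k zcomp (d - tw`_k) (v 0 k).

Lemma free_deg_row_comp tw d v : free_deg d (@row_comp tw d v).
Proof. by move=> k; rewrite mxE; apply: zhomog_zcomp. Qed.

Lemma row_comp_id tw d (v : 'rV[R]_(size tw)) : free_deg d v -> row_comp d v = v.
Proof. by move=> dv; apply/rowP => k; rewrite mxE zcomp_id. Qed.

Definition homog_mx (tw' tw : seq int) (D : 'M[R]_(size tw', size tw)) : Prop :=
  forall (j : 'I_(size tw')) (k : 'I_(size tw)), zhomog (tw'`_j - tw`_k) (D j k).

Lemma row_compM tw' tw (D : 'M[R]_(size tw', size tw)) d v : homog_mx D ->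
  row_comp d (v *m D) = row_comp d v *m D.
Proof.
move=> hD; apply/rowP => k; rewrite !mxE zcomp_sum; apply: eq_bigr => j _.
rewrite mxE -(zcompM _ _ (hD j k)).
by congr zcomp; rewrite addrA subrK.
Qed.

Lemma free_deg_mulmx tw' tw (D : 'M[R]_(size tw', size tw)) d v : homog_mx D ->
  free_deg d v -> free_deg d (v *m D).
Proof. by move=> hD /row_comp_id <-; rewrite -row_compM //; apply: free_deg_row_comp. Qed.

End Components.

(** * Tor detects the twists of a resolution *)

Section ResolutionTwists.
Variables (K : fieldType) (n : nat).
Local Notation R := {mpoly K[n]}.

Record graded_ideal (I : R -> Prop) : Prop := GradedIdeal {
  gi0 : I 0;
  giB : forall p q, I p -> I q -> I (p - q);
  giM : forall p q, I q -> I (p * q);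
  gi_comp : forall d p, I p -> I (zcomp d p)
}.

Definition ideal_deg (I : R -> Prop) (d : int) (p : R^o) : Prop := zhomog d p /\ I p.

Lemma ideal_graded I : graded_ideal I -> graded_module (ideal_deg I).
Proof.
case=> I0 IB IM _; split=> [d|d u v [du Iu] [dv Iv]|a d r u hr [du Iu]].
- by split=> //; apply: zhomog0.
- by split; [exact: zhomogB|exact: IB].
- by split; [rewrite addrC; exact: zhomogM|exact: IM].
Qed.

Variables (I : R -> Prop) (F : min_graded_resolution I).
Hypothesis gI : graded_ideal I.

Definition augm_fun (v : 'rV[R]_(size (twists F 0))) : R^o := (v *m augm F) 0 0.
Definition diff_fun i (v : 'rV[R]_(size (twists F i.+1))) : 'rV[R]_(size (twists F i)) :=
  v *m diff F i.
Arguments diff_fun : clear implicits.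

(** The kernel of the map out of the i-th free module, graded by degree. *)
Definition syz_deg i : int -> 'rV[R]_(size (twists F i)) -> Prop :=
  if i is i'.+1 then ker_deg (diff_fun i') else ker_deg augm_fun.

Lemma augm_homog_mx : @homog_mx K n (twists F 0) [:: 0] (augm F).
Proof. by move=> j k; rewrite ord1 subr0; apply: augm_homog. Qed.

Lemma augm_fun0 v : augm_fun v = 0 <-> v *m augm F = 0.
Proof.
rewrite /augm_fun; split=> [H|->]; last by rewrite mxE.
by apply/rowP => k; rewrite ord1 H mxE.
Qed.

Lemma min_const i (w : 'rV[R]_(size (twists F i.+1))) k : ((w *m diff F i) 0 k)@_0%MM = 0.
Proof.
rewrite mxE raddf_sum big1 // => j _ /=.
by rewrite (rmorphM (mcoeff (0%MM : 'X_{1..n}))) /= diff_minimal mulr0.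
Qed.

Lemma augm_cover : minimal_cover (ideal_deg I) augm_fun.
Proof.
split.
- by move=> r u v; rewrite /augm_fun mulmxDl -scalemxAl !mxE.
- move=> d v dv; split.
    by have := @free_deg_mulmx _ _ _ _ _ d v augm_homog_mx dv 0; rewrite subr0.
  apply/(augm_image F); exists v; apply/matrixP => i j.
  by rewrite !ord1 [RHS]mxE eqxx.
- move=> d e [de /(augm_image F)[v vE]]; exists (row_comp d v);
    first exact: (@free_deg_row_comp K n _ d v).
  rewrite /augm_fun -(@row_compM _ _ _ [:: 0] _ d v augm_homog_mx) vE mxE.
  by rewrite subr0 mxE eqxx zcomp_id.
- move=> d v dv /augm_fun0/augm_exact[w ->] k; exact: min_const.
Qed.

Lemma syz_cover i : minimal_cover (@syz_deg i) (diff_fun i).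
Proof.
have hD j : homog_mx (diff F j) by move=> k l; apply: diff_homog.
split.
- by move=> r u v; rewrite /diff_fun mulmxDl -scalemxAl.
- move=> d v dv; have dv' : free_deg d (diff_fun i v) by apply: free_deg_mulmx.
  case: i v dv dv' => [|i] v dv dv'; split=> //.
    by apply/augm_fun0/augm_exact; exists v.
  by apply/diff_exact; exists v.
- move=> d e; have H : (exists w, e = w *m diff F i) -> free_deg d e ->
      exists2 v, free_deg d v & diff_fun i v = e.
    case=> w -> de; exists (row_comp d w); first exact: (@free_deg_row_comp K n _ d w).
    by rewrite /diff_fun -row_compM // row_comp_id.
  case: i e H => [|i] e H [de e0]; apply: H => //.
    by apply/augm_exact/augm_fun0.
  exact/diff_exact.
- by move=> d v dv /diff_exact[w ->] k; apply: min_const.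
Qed.

Lemma syz_graded i : graded_module (@syz_deg i).
Proof.
case: i => [|i]; first exact: ker_graded augm_cover.
exact: ker_graded (syz_cover i).
Qed.

Lemma syz_tor_vanish i j d :
  tor_vanish (ideal_deg I) (i + j).+1 d <-> tor_vanish (@syz_deg i) j d.
Proof.
elim: i j => [|i IH] j.
  exact (cover_tor_vanish augm_cover j d).
rewrite addSnnS; split=> [/IH|] H.
  exact: (proj1 (cover_tor_vanish (syz_cover i) _ _)) H.
by apply/IH; apply: (proj2 (cover_tor_vanish (syz_cover i) _ _)) H.
Qed.

(** Only the occurrence of a twist is detected, not its multiplicity; multiplicities enter solely
    through Hilbert series. *)
Lemma resolution_twists i d :
  (d \in twists F i -> ~ tor_vanish (ideal_deg I) i d) /\
  (d \notin twists F i -> tor_vanish (ideal_deg I) i d).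
Proof.
case: i => [|i].
  split; first exact: cover_twist (ideal_graded gI) augm_cover _.
  exact: cover_notwist (ideal_graded gI) augm_cover _.
split=> H.
  rewrite -[i]addn0 => /syz_tor_vanish;
      exact: cover_twist (syz_graded i) (syz_cover i) _ H.
rewrite -[i]addn0; apply/syz_tor_vanish.
exact: cover_notwist (syz_graded i) (syz_cover i) _ H.
Qed.

End ResolutionTwists.

(** * Dimension of graded pieces *)

Lemma wide_kernel (K : fieldType) p q (A : 'M[K]_(p, q)) : (q < p)%N ->
  exists2 x : 'rV[K]_p, x != 0 & x *m A = 0.
Proof.
move=> qp; have : kermx A != 0.
  by rewrite kermx_eq0 -row_leq_rank -ltnNge (leq_ltn_trans (rank_leq_col A)).
case/rowV0Pn => x /sub_kermxP xA x0; by exists x.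
Qed.

Definition hilbR (n : nat) (d : int) : nat :=
  if d is Posz e then #|{: {m : 'X_{1..n < e.+1} | mdeg m == e}}| else 0.
Arguments hilbR : simpl never.

Section Dimension.
Variables (K : fieldType) (n : nat).
Local Notation R := {mpoly K[n]}.
Local Notation hilbR := (hilbR n).

Section Families.
Variable E : lmodType R.
Implicit Types (P : E -> Prop).

(** [E] is a module over the polynomial ring, so elements of [K] act as constant polynomials. *)
Definition lin_indep (T : finType) (u : T -> E) : Prop :=
  forall c : T -> K, \sum_t (c t)%:MP *: u t = 0 -> forall t, c t = 0.

Definition spanned (T : finType) (u : T -> E) (e : E) : Prop :=
  exists c : T -> K, e = \sum_t (c t)%:MP *: u t.

Definition has_dim P N : Prop :=
  exists (T : finType) (u : T -> E),
    [/\ #|T| = N, forall t, P (u t), lin_indep u & forall e, P e -> spanned u e].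

Record subspace P : Prop := Subspace {
  sub0 : P 0;
  subB : forall u v, P u -> P v -> P (u - v);
  subZ : forall c u, P u -> P (c%:MP *: u)
}.

Lemma subspace_sum P I (r : seq I) (F : I -> E) : subspace P ->
  (forall i, P (F i)) -> P (\sum_(i <- r) F i).
Proof.
case=> P0 PB PZ H; elim/big_ind: _ => // u v Pu Pv.
by rewrite -[v]opprK -[- v]sub0r; apply: (PB) => //; apply: PB.
Qed.

Lemma indep_leq (S T : finType) (v : S -> E) (u : T -> E) :
  lin_indep v -> (forall s, spanned u (v s)) -> (#|S| <= #|T|)%N.
Proof.
move=> iv sp; rewrite leqNgt; apply/negP => TS.
have H s : exists c : {ffun T -> K}, v s = \sum_t (c t)%:MP *: u t.
  by have [c ->] := sp s; exists (finfun c); apply: eq_bigr => t _; rewrite ffunE.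
have /fin_all_exists[a Ha] := H.
have [x x0 xA] := wide_kernel (\matrix_(i < #|S|, j < #|T|) a (enum_val i) (enum_val
    j)) TS.
case/eqP: x0; apply/rowP => i; rewrite mxE -[i]enum_valK.
apply: (iv (fun s => x 0 (enum_rank s))).
under eq_bigr do rewrite Ha scaler_sumr.
rewrite exchange_big big1 // => t _.
transitivity ((\sum_s x 0 (enum_rank s) * a s t)%:MP *: u t).
  rewrite rmorph_sum /= scaler_suml; apply: eq_bigr => s _.
  by rewrite scalerA -rmorphM.
rewrite [X in X%:MP](_ : _ = 0) ?mpolyC0 ?scale0r //.
move/rowP/(_ (enum_rank t)): xA; rewrite !mxE => xt; rewrite -[RHS]xt.
rewrite (reindex (@enum_val S predT)) /=; last exact/onW_bij/enum_val_bij.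
by apply: eq_bigr => j _; rewrite !mxE enum_valK enum_rankK.
Qed.

Lemma has_dim_inj P M N : has_dim P M -> has_dim P N -> M = N.
Proof.
case=> T [u [<- Pu iu su]] [S [v [<- Pv iv sv]]].
by apply/eqP; rewrite eqn_leq (indep_leq iu (fun t => sv _ (Pu t))) (indep_leq iv
    (fun t => su _ (Pv t))).
Qed.

Lemma has_dim0 P : subspace P -> (forall e, P e -> e = 0) -> has_dim P 0.
Proof.
move=> sP H; exists void, (fun=> 0); split=> //; first by rewrite card_void.
by move=> e /H ->; exists (fun=> 0); rewrite big1 // => -[].
Qed.

Lemma eq_has_dim P Q N : (forall e, P e <-> Q e) -> has_dim P N -> has_dim Q N.
Proof.
move=> PQ [T [u [cT Pu iu su]]]; exists T, u; split=> // [t|e /PQ]; last exact: su.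
exact/PQ.
Qed.

Lemma lin_indep_extend (S : finType) (v : S -> E) (e : E) :
  lin_indep v -> ~ spanned v e ->
  lin_indep (fun x : S + unit => if x is inl s then v s else e).
Proof.
move=> iv nsp c; rewrite big_sumType /= [X in _ + X](big_pred1 tt) => [|[]//] c0.
have ct : c (inr tt) = 0.
  apply/eqP/negP => /negP nz; apply: nsp.
  exists (fun s => - (c (inr tt))^-1 * c (inl s)).
  have -> : e = (- (c (inr tt))^-1)%:MP *: \sum_s (c (inl s))%:MP *: v s.
    move/eqP: c0; rewrite addr_eq0 => /eqP ->.
    by rewrite scalerN scalerA -rmorphM mulNr mulVf //= mpolyCN mpolyC1 scaleN1r opprK.
  by rewrite scaler_sumr; apply: eq_bigr => s _; rewrite scalerA -mpolyCM.
rewrite ct mpolyC0 scale0r addr0 in c0.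
by case=> [s|[]] //; apply: (iv (fun s => c (inl s))).
Qed.

(** An independent family is extended until it spans; the bound N stops the process. *)
Lemma has_dim_exists P N : subspace P ->
  (forall (S : finType) (v : S -> E), (forall s, P (v s)) -> lin_indep v ->
      (#|S| <= N)%N) ->
  exists2 M, has_dim P M & (M <= N)%N.
Proof.
move=> sP bound.
suff H k (S : finType) (v : S -> E) : (forall s, P (v s)) -> lin_indep v ->
    (N - #|S| < k)%N -> exists2 M, has_dim P M & (M <= N)%N.
  by apply: (H N.+1 void (fun=> 0)) => //; rewrite ltnS leq_subr.
elim: k S v => [|k IH] S v Pv iv kN //.
have [sp|] := classic (forall e, P e -> spanned v e).
  by exists #|S|; [exists S, v|exact: (bound S v)].
move=> H; have [e He] := not_all_ex_not _ _ H; have [Pe nsp] := imply_to_and _ _ He.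
have iw := lin_indep_extend iv nsp.
have Pw (x : S + unit) : P (if x is inl s then v s else e) by case: x.
apply: (IH _ _ Pw iw); have := bound _ _ Pw iw; rewrite card_sum card_unit addn1 => SN.
by rewrite subnS prednK ?subn_gt0 // -ltnS.
Qed.

Lemma sub_has_dim P Q N : subspace P -> (forall e, P e -> Q e) -> has_dim Q N ->
  exists M, has_dim P M.
Proof.
move=> sP PQ [T [u [cT Qu iu su]]].
have [|M HM _] := @has_dim_exists P N sP; last by exists M.
move=> S v Pv iv; rewrite -cT; apply: indep_leq iv _ => s.
by apply/su/PQ.
Qed.

Lemma gmod_subspace (G : int -> E -> Prop) d : graded_module G -> subspace (G d).
Proof.
move=> gG; split; [exact: gmod0|exact: gmodB|].
by move=> c u; apply: gmodZ.
Qed.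

End Families.

Lemma has_dim_exact (E1 E2 E3 : lmodType R) (P1 : E1 -> Prop) (P2 : E2 -> Prop)
    (P3 : E3 -> Prop) (f : E1 -> E2) (g : E2 -> E3) a c :
  linear f -> linear g -> subspace P2 ->
  (forall u, P1 u -> P2 (f u)) -> (forall u, P2 u -> P3 (g u)) ->
  (forall u, P1 u -> f u = 0 -> u = 0) -> (forall u, P1 u -> g (f u) = 0) ->
  (forall v, P2 v -> g v = 0 -> exists2 u, P1 u & f u = v) ->
  (forall w, P3 w -> exists2 v, P2 v & g v = w) -> subspace P1 ->
  has_dim P1 a -> has_dim P3 c -> has_dim P2 (a + c).
Proof.
move=> lf lg sP2 f12 g23 finj gf ker surj sP1.
move=> [T1 [u1 [<- Pu1 iu1 su1]]] [T3 [u3 [<- Pu3 iu3 su3]]].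
have H t : exists v, P2 v /\ g v = u3 t.
  by have [v Pv gv] := surj _ (Pu3 t); exists v.
have /fin_all_exists[w Hw] := H.
exists (T1 + T3)%type, (fun x => match x with inl t => f (u1 t) | inr t => w t end).
have gsum (e : T3 -> K) : g (\sum_t (e t)%:MP *: w t) = \sum_t (e t)%:MP *: u3 t.
  rewrite (linear_fun_sum lg); apply: eq_bigr => t _.
  by rewrite (linear_funZ lg); case: (Hw t) => _ ->.
have fsum (e : T1 -> K) : f (\sum_t (e t)%:MP *: u1 t) = \sum_t (e t)%:MP *: f (u1 t).
  by rewrite (linear_fun_sum lf); apply: eq_bigr => t _; rewrite (linear_funZ lf).
have P1sum (e : T1 -> K) : P1 (\sum_t (e t)%:MP *: u1 t).
  by apply: subspace_sum => // t; apply: subZ.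
split.
- by rewrite card_sum.
- by case=> t; [apply: f12|case: (Hw t)].
- move=> e; rewrite big_sumType /= -fsum => e0.
  have er : forall t, e (inr t) = 0.
    apply: (iu3 (fun t => e (inr t))); rewrite -gsum.
    have := linear_fun0 lg; rewrite -{1}e0 (linear_funD lg) gf ?add0r //.
  case=> // t; apply: (iu1 (fun t => e (inl t))); apply: finj; first exact: P1sum.
  by move: e0; rewrite [X in _ + X]big1 ?addr0 // => s _; rewrite er mpolyC0 scale0r.
- move=> v Pv; have [c3 ec3] := su3 _ (g23 _ Pv).
  have [||x Px fx] := ker (v - \sum_t (c3 t)%:MP *: w t).
  + apply: subB => //; apply: subspace_sum => // t.
    by apply: subZ => //; case: (Hw t).
  + by rewrite (linear_funB lg) gsum ec3 subrr.
  have [c1 ec1] := su1 _ Px.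
  exists (fun x => match x with inl t => c1 t | inr t => c3 t end).
  by rewrite big_sumType /= -fsum -ec1 fx subrK.
Qed.

Lemma has_dim_short_exact (E1 E2 E3 : lmodType R) (G1 : int -> E1 -> Prop)
    (G2 : int -> E2 -> Prop) (G3 : int -> E3 -> Prop) f g d a c :
  short_exact G1 G2 G3 f g -> graded_module G1 -> graded_module G2 ->
  has_dim (G1 d) a -> has_dim (G3 d) c -> has_dim (G2 d) (a + c).
Proof.
move=> S g1 g2; apply: (has_dim_exact (se_linl S) (se_linr S)).
- exact: gmod_subspace.
- exact: (se_degl S).
- exact: (se_degr S).
- exact: (se_inj S).
- exact: (se_comp S).
- exact: (se_ker S).
- exact: (se_surj S).
- exact: gmod_subspace.
Qed.

Definition zhomogR (d : int) (p : R^o) : Prop := zhomog d p.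

Lemma zhomogR_graded : graded_module zhomogR.
Proof.
split=> [d|d u v|a d r u hr du]; [exact: zhomog0|exact: zhomogB|].
by rewrite addrC; apply: zhomogM.
Qed.

Lemma has_dimR d : has_dim (zhomogR d) (hilbR d).
Proof.
case: d => e; last first.
  by apply: has_dim0 => //; apply: gmod_subspace zhomogR_graded.
pose T := {m : 'X_{1..n < e.+1} | mdeg m == e}.
exists T, (fun m : T => 'X_[val (val m)]); split=> //.
- by move=> m; rewrite /zhomogR /= dhomogX /=; case: m.
- move=> c c0 t; have := congr1 (mcoeff (val (val t))) c0.
  rewrite mcoeff0 raddf_sum (bigD1 t) //= big1 ?addr0 => [|s st].
    by rewrite mcoeffCM mcoeffX eqxx mulr1.
  rewrite mcoeffCM mcoeffX; case: eqP; rewrite ?mulr0 // => /val_inj/val_inj sE.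
  by rewrite sE eqxx in st.
- move=> p /= hp; exists (fun m : T => p@_(val (val m))).
  apply/mpolyP => m; rewrite raddf_sum /=.
  have [me|me] := eqVneq (mdeg m) e.
    have mb : (mdeg m < e.+1)%N by rewrite me.
    have mE : mdeg (BMultinom mb) == e by rewrite /= me.
    rewrite (bigD1 (Sub (BMultinom mb) mE : T)) //= big1 ?addr0 => [|s st].
      by rewrite mcoeffCM mcoeffX eqxx mulr1.
    rewrite mcoeffCM mcoeffX; case: eqP; rewrite ?mulr0 // => sE.
    by case/eqP: st; apply/val_inj/val_inj.
  rewrite big1 => [|s _].
    apply/eqP; apply: contraNT me; rewrite -mcoeff_msupp.
    by move/dhomogP: hp => H /H ->.
  rewrite mcoeffCM mcoeffX; case: eqP; rewrite ?mulr0 // => sE.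
  by case/eqP: me; rewrite -sE; case: s {sE} => s /= /eqP.
Qed.

Lemma hilbR0 : hilbR 0 = 1%N.
Proof.
apply: (@has_dim_inj _ (zhomogR 0)); first exact: has_dimR.
exists unit, (fun=> 1); rewrite card_unit; split=> //.
- by move=> _; exact: zhomogC.
- move=> c; rewrite (big_pred1 tt) => [|[]//]; case: tt => c0 [].
  by move/eqP: c0; rewrite [_ *: _]mulr1 mpolyC_eq0 => /eqP.
- move=> e he; exists (fun=> e@_0%MM); rewrite (big_pred1 tt) => [|[]//].
  by rewrite [_ *: _]mulr1; apply: zhomog_eqC.
Qed.

Lemma has_dim_free tw d :
  has_dim (@free_deg K n tw d) (\sum_(a <- tw) hilbR (d - a)).
Proof.
(* Vectors supported on the first j coordinates: each step of this filtration adds one shifted copy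
   of the ring. *)
pose G j (d : int) (v : 'rV[R]_(size tw)) :=
  free_deg d v /\ forall k : 'I_(size tw), (j <= k)%N -> v 0 k = 0.
have gG j : graded_module (G j).
  have [F0 FB FM] := @free_graded K n tw.
  split=> [e|e u v [du u0] [dv v0]|a e r u hr [du u0]].
  - by split=> // k _; rewrite mxE.
  - by split=> [|k jk]; [exact: FB|rewrite !mxE u0 // v0 // subr0].
  - by split=> [|k jk]; [exact: FM|rewrite mxE u0 // mulr0].
have H j : (j <= size tw)%N -> has_dim (G j d) (\sum_(i < j) hilbR (d - tw`_i)).
  elim: j => [_|j IH jtw].
    rewrite big_ord0; apply: has_dim0; first exact: gmod_subspace.
    by move=> v [_ v0]; apply/rowP => k; rewrite v0 // mxE.
  have jt : (j < size tw)%N by [].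
  rewrite big_ord_recr /=.
  pose k := Ordinal jt.
  apply: (@has_dim_short_exact _ _ _ (G j) (G j.+1) (fun d => zhomogR (d - tw`_j))
     id (fun v : 'rV[R]_(size tw) => v 0 k : R^o) d) => //; last 2 first.
  - by apply: IH; apply: ltnW.
  - exact: has_dimR.
  split=> //.
  - by move=> r u v; rewrite !mxE.
  - by move=> e u [du u0]; split=> // l jl; apply: u0; apply: ltnW.
  - by move=> e u [du u0]; apply: (du k).
  - by move=> e u [du u0]; apply: u0.
  - move=> e v [dv v0] vk; exists v => //; split=> // l.
    rewrite leq_eqVlt => /orP[/eqP jl|]; last exact: v0.
    by rewrite -vk; congr (v 0 _); apply: val_inj.
  - move=> e w hw; exists (w *: delta_mx 0 k); last by rewrite !mxE !eqxx mulr1.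
    split=> [l|l jl]; rewrite !mxE /=.
      have [->|_] := eqVneq l k; first by rewrite mulr1.
      by rewrite mulr0; apply: zhomog0.
    by case: eqP jl => [->|_]; rewrite ?ltnn ?mulr0.
rewrite (big_nth 0) big_mkord; apply: eq_has_dim (H _ (leqnn _)) => v.
by split=> [[]//|dv]; split=> // k; rewrite leqNgt ltn_ord.
Qed.

End Dimension.

(** * Squarefree monomial ideals *)

Section GradedConstructions.
Variables (K : fieldType) (n : nat).
Local Notation R := {mpoly K[n]}.

Lemma gmod_shift (E : lmodType R) (G : int -> E -> Prop) a :
  graded_module G -> graded_module (fun d => G (d - a)).
Proof.
case=> G0 GB GM; split=> [d|d u v|b d r u hr Gu]; [exact: G0|exact: GB|].
by rewrite addrAC; apply: GM.
Qed.

Lemma gmod_prod (E E' : lmodType R) (G : int -> E -> Prop) (G' : int -> E' -> Prop) :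
  graded_module G -> graded_module G' ->
  graded_module (fun d (p : (E * E')%type) => G d p.1 /\ G' d p.2).
Proof.
case=> G0 GB GM [G0' GB' GM'].
split=> [d|d u v [u1 u2] [v1 v2]|b d r u hr [u1 u2]].
- by split; [exact: G0|exact: G0'].
- by split; [exact: GB|exact: GB'].
- by split; [exact: GM|exact: GM'].
Qed.

Lemma prod_short_exact (E E' : lmodType R) (G : int -> E -> Prop) (G' : int -> E' ->
    Prop) :
  graded_module G -> graded_module G' ->
  short_exact G (fun d (p : (E * E')%type) => G d p.1 /\ G' d p.2) G'
    (fun u => (u, 0)) snd.
Proof.
move=> gG gG'; split=> //.
- move=> r u v; apply: (@etrans _ _ (r *: u + v, r *: 0 + 0)) => //.
  by rewrite scaler0 addr0.
- by move=> d u Gu; split=> //; apply: gmod0.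
- by move=> d u [].
- by move=> d u _ [].
- by move=> d [u v] /= [Gu _] ->; exists u.
- by move=> d w Gw; exists (0, w) => //; split=> //; apply: gmod0.
Qed.

End GradedConstructions.

Section MonomialIdeals.
Variables (K : fieldType) (n : nat).
Local Notation R := {mpoly K[n]}.
Implicit Types (N : pred {set 'I_n}) (s t V Z : {set 'I_n}) (i : 'I_n).

Definition mon_supp (m : 'X_{1..n}) : {set 'I_n} := [set i | (0 < m i)%N].

(** For an up-closed [N] this is the squarefree monomial ideal whose nonfaces are [N]: membership of
    a monomial depends on its support alone. *)
Definition mon_ideal N (p : R) : Prop := forall m, p@_m != 0 -> N (mon_supp m).

Definition upset N : Prop := forall s t, s \subset t -> N s -> N t.

(** Deletion and link keep all n variables and ignore [i], so that inductions never change the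
    ring. *)
Definition deletion N i : pred {set 'I_n} := fun s => N (s :\ i).
Definition link N i : pred {set 'I_n} := fun s => N (i |: s).

Definition mon_tor_vanish N k d := tor_vanish (ideal_deg (mon_ideal N)) k d.

Lemma upset_deletion N i : upset N -> upset (deletion N i).
Proof. by move=> uN s t st; apply: uN; apply: setSD. Qed.

Lemma upset_link N i : upset N -> upset (link N i).
Proof. by move=> uN s t st; apply: uN; apply: setUS. Qed.

Lemma mon_suppD m m' : mon_supp (m + m')%MM = mon_supp m :|: mon_supp m'.
Proof. by apply/setP => j; rewrite !inE mnmDE addn_gt0. Qed.

Lemma mon_supp1 i : mon_supp U_(i)%MM = [set i].
Proof. by apply/setP => j; rewrite !inE mnm1E eq_sym; case: eqP. Qed.

Lemma card_mon_supp m : (#|mon_supp m| <= mdeg m)%N.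
Proof.
rewrite mdegE -sum1_card big_mkcond leq_sum //= => i _.
by rewrite inE; case: (m i).
Qed.

Lemma mon_ideal_graded N : upset N -> graded_ideal (mon_ideal N).
Proof.
move=> uN; split.
- by move=> m; rewrite mcoeff0 eqxx.
- move=> p q Ip Iq m; rewrite mcoeffB => nz.
  have [p0|/Ip//] := eqVneq p@_m 0.
  by apply: Iq; apply: contraNneq nz => ->; rewrite p0 subr0.
- move=> p q Iq m; rewrite -mcoeff_msupp => /msuppM_le/allpairsP[[k1 k2] /= [_ k2q ->]].
  apply: (uN (mon_supp k2)); first by rewrite mon_suppD subsetUr.
  by apply: Iq; rewrite -mcoeff_msupp.
- by move=> d p Ip m; rewrite mcoeff_zcomp; case: ifP => [_|]; [exact: Ip|rewrite eqxx].
Qed.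

Lemma mon_deg_graded N : upset N -> graded_module (ideal_deg (mon_ideal N)).
Proof. by move=> uN; apply/ideal_graded/mon_ideal_graded. Qed.

Lemma eq_mon_tor N N' k d : N =1 N' -> mon_tor_vanish N k d -> mon_tor_vanish N' k d.
Proof.
move=> eN; apply: (proj1 (eq_koszul_exact _ _ _ _)) => e u.
by split=> -[hu Iu]; split=> // m /Iu; rewrite eN.
Qed.

Definition del_link_deg N i d (p : (R^o * R^o)%type) : Prop :=
  ideal_deg (mon_ideal (deletion N i)) d p.1 /\ ideal_deg (mon_ideal (link N i)) (d -
      1) p.2.

(* Every monomial of the ideal is in the deletion or [X_i] times one of the
   link, and the overlap is [X_i] times the deletion. *)
Lemma del_link_exact N i : upset N ->
  short_exact (fun d => ideal_deg (mon_ideal (deletion N i)) (d - 1))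
    (del_link_deg N i) (ideal_deg (mon_ideal N))
    (fun p => (- ('X_i * p), p)) (fun p => p.1 + 'X_i * p.2).
Proof.
move=> uN; have uD := upset_deletion (i := i) uN; have uL := upset_link (i := i) uN.
have hX d (p : R) : zhomog (d - 1) p -> zhomog d ('X_i * p).
  by move=> hp; rewrite -[d](subrK 1) addrC; apply: zhomogM hp; apply: zhomogX.
have [D0 DB DM _] := mon_ideal_graded uD.
have sX (m : 'X_{1..n}) : (0 < m i)%N -> i |: mon_supp (m - U_(i))%MM = mon_supp m.
  by move=> mi; rewrite -mon_supp1 -mon_suppD addmC submK // lep1mP -lt0n.
split.
- move=> r u v; apply: (@etrans _ _ (r * - ('X_i * u) - 'X_i * v, r *: u + v)) => //.
  by congr pair; rewrite mulrDr opprD mulrN -[_ *: _]/(_ * _) mulrCA.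
- by move=> r u v /=; rewrite mulrDr scalerDr -[r *: u.2]/(r * u.2) mulrCA addrACA.
- move=> d p [hp Ip]; split; split => //=.
  + by apply: zhomogN; apply: hX.
  + by rewrite -sub0r; apply: DB => //; apply: DM.
  + by move=> m /Ip; apply: uN; apply: (subset_trans (subsetDl _ _)); apply: subsetUr.
- move=> d [p q] /= [[hp Ip] [hq Iq]]; split; first by apply: zhomogD => //; apply: hX.
  move=> m; rewrite mcoeffD mcoeffXM => nz.
  have [p0|/Ip] := eqVneq p@_m 0; last by apply: uN; apply: subsetDl.
  move: nz; rewrite p0 add0r; case: ifP => [mi /Iq|]; last by rewrite eqxx.
  by rewrite /link sX.
- by move=> d p _ [].
- by move=> d p _ /=; rewrite addNr.
- move=> d [p q] /= [[hp Ip] [hq Iq]] /eqP; rewrite addr_eq0 => /eqP pq.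
  exists q; last by rewrite pq.
  split=> // m qm; have := Ip (m + U_(i))%MM.
  rewrite pq mcoeffN mcoeffXM mnmDE mnm1E eqxx addn1 /= addmK oppr_eq0 => /(_ qm).
  by rewrite /deletion mon_suppD mon_supp1 setDUl setDv setU0.
- move=> d p [hp Ip].
  (* The first component collects the terms of p free of ['X_i], the second the quotients of the
     others. *)
  exists (p - 'X_i * mshift i p, mshift i p); last by rewrite /= subrK.
  have cE m : (p - 'X_i * mshift i p)@_m = if (0 < m i)%N then 0 else p@_m.
    rewrite mcoeffB mcoeffXM mcoeff_mshift; case: ifP => mi; last by rewrite subr0.
    by rewrite submK ?subrr // lep1mP -lt0n.
  split; split => /=.
  + apply/zhomogP => m; rewrite cE; case: ifP; first by rewrite eqxx.
    by move/zhomogP: hp => hp _; apply: hp.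
  + move=> m; rewrite cE; case: ifPn => [_|mi /Ip]; first by rewrite eqxx.
    rewrite /deletion (_ : mon_supp m :\ i = mon_supp m) //.
    by apply/setP => j; rewrite !inE; case: eqP => // ->; rewrite (negbTE mi).
  + exact: zhomog_mshift.
  + move=> m; rewrite mcoeff_mshift => /Ip.
    by rewrite /link mon_suppD mon_supp1 setUC.
Qed.

(** The deletion and the link control Tor_k of the middle term of the sequence above, and Tor_(k-1)
    of the shifted deletion is where the connecting map lands. *)
Lemma mon_tor_step N i k d : upset N -> mon_tor_vanish (deletion N i) k d ->
  mon_tor_vanish (link N i) k (d - 1) ->
  (if k is k'.+1 then mon_tor_vanish (deletion N i) k' (d - 1) else True) ->
  mon_tor_vanish N k d.
Proof.
move=> uN hD hL hD'.
have gD := mon_deg_graded (upset_deletion (i := i) uN).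
have gD1 := gmod_shift 1 gD.
have gL := gmod_shift 1 (mon_deg_graded (upset_link (i := i) uN)).
have fg := @gmod_graded_for K n (enum 'I_n).
have gB : graded_module (@del_link_deg N i) by exact: (gmod_prod gD gL).
have S := prod_short_exact gD gL; rewrite -/(del_link_deg N i) in S.
apply: (koszul_exact_quo (i := k) (d := d) (del_link_exact i uN) (fg _ _ gD1) (fg _ _
    gB)).
  apply: (koszul_exact_mid (i := k) (d := d) S (fg _ _ gD) (fg _ _ gB)); first exact: hD.
  exact: (proj2 (koszul_exact_shift _ _ _ _ _)) hL.
case: k hD' {hD hL} => // k hD'.
exact: (proj2 (koszul_exact_shift _ _ _ _ _)) hD'.
Qed.

Lemma mon_tor_all N k d : (forall s, N s) -> (k != 0%N) || (d != 0) ->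
  mon_tor_vanish N k d.
Proof.
move=> allN kd; apply: (proj1 (@eq_koszul_exact _ R^o (@zhomogR K n) _ _ _ _ _)).
  by move=> e u; split=> [hu|[]//]; split=> // m _; apply: allN.
case: k kd => [|k] /= kd.
  apply/tor_vanish0P; first exact: zhomogR_graded.
  move=> e he; have [f fh ef] := zhomog_irrelevant he (zhomog_const he kd).
  by exists f.
apply: (@koszul_exact_division K n R^o (@zhomogR K n) (@mshift K n)).
- exact: zhomogR_graded.
- exact: mshiftB.
- exact: mshiftXK.
- by move=> i j u ij; apply: mshiftX.
- by move=> i e u; apply: zhomog_mshift.
- exact: enum_uniq.
Qed.

Lemma mon_tor_low N c k (d : int) : upset N ->
  (forall s, N s -> (c <= #|s|)%N) -> d < k%:Z + c%:Z -> mon_tor_vanish N k d.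
Proof.
move=> uN Nc dkc; apply: koszul_exact_triv.
  by apply: gmod_graded_for; apply: mon_deg_graded.
move=> u [/zhomogP hu Iu]; apply/mpolyP => m; rewrite mcoeff0; apply/eqP.
apply: contraT => nz; have := hu _ nz; have := Nc _ (Iu _ nz).
have := card_mon_supp m; lia.
Qed.

Lemma mon_tor_none N k d : upset N -> (forall s, ~~ N s) -> mon_tor_vanish N k d.
Proof.
move=> uN noN; apply: (@mon_tor_low N (`|d|.+1)) => //; last by lia.
by move=> s; rewrite (negbTE (noN s)).
Qed.

(** [V] contains all variables that matter; deletion and link remove one of them, and [#|V|] is the
    measure of the inductions below. *)
Definition depends_on V N : Prop := forall s, N s = N (s :&: V).

Lemma depends_deletion V N i : depends_on V N -> depends_on (V :\ i) (deletion N i).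
Proof.
move=> dV s; rewrite /deletion dV [RHS]dV; congr N; apply/setP => j.
by rewrite !inE; case: (j == i); case: (j \in s); case: (j \in V).
Qed.

Lemma depends_link V N i : depends_on V N -> depends_on (V :\ i) (link N i).
Proof.
move=> dV s; rewrite /link dV [RHS]dV; congr N; apply/setP => j.
by rewrite !inE; case: (j == i); case: (j \in s); case: (j \in V).
Qed.

(** Betti numbers of squarefree ideals sit in squarefree multidegrees; the induction on [V] obtains
    the resulting bound on the total degree without a multigrading. *)
Lemma mon_tor_support V N k (d : int) : upset N -> depends_on V N ->
  #|V|%:Z < d -> mon_tor_vanish N k d.
Proof.
move cV: #|V| => v; elim: v V N k d cV => [|v IH] V N k d cV uN dV vd.
  have N0 s : N s = N set0 by rewrite dV (cards0_eq cV) setI0.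
  have [h|h] := boolP (N set0).
    by apply: mon_tor_all => [s|]; [rewrite N0|lia].
  by apply: mon_tor_none => // s; rewrite N0.
have /card_gt0P[i iV] : (0 < #|V|)%N by rewrite cV.
have cV' : #|V :\ i| = v by have := cardsD1 i V; rewrite iV cV; lia.
have uD := upset_deletion (i := i) uN; have dD := depends_deletion i dV.
apply: (mon_tor_step (i := i)) => //.
- by apply: (IH (V :\ i)) => //; lia.
- by apply: (IH (V :\ i)) => //; [exact: upset_link|exact: depends_link|lia].
- by case: k => // k; apply: (IH (V :\ i)) => //; lia.
Qed.

(** The regularity is at most one more than the largest size of a face. Faces of the link lose a
    vertex, so [D] drops by one just as the degree does; [D = 0] forces the whole ring. *)
Lemma mon_tor_reg V N D k (d : int) : upset N -> depends_on V N ->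
  (forall s, s \subset V -> ~~ N s -> (#|s| < D)%N) -> k%:Z + D%:Z < d ->
  mon_tor_vanish N k d.
Proof.
move cV: #|V| => v; elim: v V N D k d cV => [|v IH] V N D k d cV uN dV ND kd;
    have [D0|D0] := posnP D.
1, 3: apply: mon_tor_all => [s|]; last by lia.
1, 2: by apply: (uN set0); rewrite ?sub0set //;
    apply/negPn/negP => /(ND _ (sub0set _)); rewrite D0.
  have N0 s : N s = N set0 by rewrite dV (cards0_eq cV) setI0.
  have [h|h] := boolP (N set0).
    by apply: mon_tor_all => [s|]; [rewrite N0|lia].
  by apply: mon_tor_none => // s; rewrite N0.
have /card_gt0P[i iV] : (0 < #|V|)%N by rewrite cV.
have cV' : #|V :\ i| = v by have := cardsD1 i V; rewrite iV cV; lia.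
have uD := upset_deletion (i := i) uN; have dD := depends_deletion i dV.
have HD s : s \subset V :\ i -> ~~ deletion N i s -> (#|s| < D)%N.
  move=> sV; rewrite /deletion => Ns; have := ND s; apply.
    by apply: subset_trans sV (subsetDl _ _).
  apply: contra Ns => Ns; rewrite (_ : s :\ i = s) //; apply/setP => j; rewrite !inE.
  by case: eqP => [->|//]; case: (boolP (i \in s)) => // /(subsetP sV); rewrite !inE eqxx.
apply: (mon_tor_step (i := i)) => //.
- by apply: (IH (V :\ i)) HD kd.
- apply: (IH (V :\ i) _ D.-1) => //; [exact: upset_link|exact: depends_link| |lia].
  move=> s sV; rewrite /link => Ns; have := ND (i |: s); rewrite cardsU1.
  have -> : i \notin s by apply/negP => /(subsetP sV); rewrite !inE eqxx.
  move=> /(_ _ Ns); rewrite add1n => H; suff : (#|s|.+1 < D)%N by lia.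
  by apply: H; rewrite subUset sub1set iV (subset_trans sV (subsetDl _ _)).
- by case: k kd => // k kd; apply: (IH (V :\ i) _ D) => //; lia.
Qed.

(** Below row c only the variables in [Z] are visible, and they contribute a Koszul complex: row 1,
    homological degrees below [#|Z|]. The link of a variable of the ideal is the whole ring, so the
    induction runs through deletions. *)
Lemma mon_tor_linear N Z c k (d : int) : upset N -> (forall i, i \in Z -> N [set i]) ->
  (forall s, N s -> (s :&: Z != set0) || (c <= #|s|)%N) ->
  d < k%:Z + c%:Z -> (d == k%:Z + 1) ==> (#|Z| <= k)%N -> mon_tor_vanish N k d.
Proof.
move cZ: #|Z| => z; elim: z Z N k d cZ => [|z IH] Z N k d cZ uN ZN Nc kd dk.
  apply: (mon_tor_low (c := c)) => // s /Nc.
  by rewrite (cards0_eq cZ) setI0 eqxx.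
have /card_gt0P[i iZ] : (0 < #|Z|)%N by rewrite cZ.
have cZ' : #|Z :\ i| = z by have := cardsD1 i Z; rewrite iZ cZ; lia.
have uD := upset_deletion (i := i) uN.
have HD k' d' : d' < k'%:Z + c%:Z -> (d' == k'%:Z + 1) ==> (z <= k')%N ->
    mon_tor_vanish (deletion N i) k' d'.
  apply: (IH (Z :\ i)) => // [j|s].
    rewrite !inE /deletion => /andP[ji /ZN jN].
    by rewrite (_ : [set j] :\ i = [set j]) //; apply/setP => l; rewrite !inE;
       case: eqP => // ->; rewrite eq_sym (negbTE ji).
  rewrite /deletion => /Nc/orP[H|cs]; apply/orP.
    by left; move: H; rewrite setIDA -setIDAC.
  by right; apply: leq_trans cs (subset_leq_card (subsetDl _ _)).
apply: (mon_tor_step (i := i)) => //.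
- by apply: HD => //; lia.
- apply: mon_tor_all; last by lia.
  by move=> s; apply: uN (ZN _ iZ); rewrite sub1set !inE eqxx.
- by case: k kd dk => // k kd dk; apply: HD; lia.
Qed.

End MonomialIdeals.

(** * Row bound for the cone ideals; the end of the linear strand *)

Section LinearGenerators.
Variables (K : fieldType) (n : nat).
Local Notation R := {mpoly K[n]}.
Implicit Types (N : pred {set 'I_n}) (s V Z S Y : {set 'I_n}) (i : 'I_n).

(** Faces can be large here, so [mon_tor_reg] is in general too weak. Deleting a variable of [S]
    leaves the ideal of the variables in [Z], and its link shortens [S]; once [S] is empty, the
    ideal is generated by variables. *)
Lemma mon_tor_cone_reg N Z S Y k (d : int) : upset N ->
  [disjoint S & Z] -> [disjoint S & Y] ->
  (forall s, N s = (s :&: Z != set0) || (S \subset s) && (s :&: Y != set0)) ->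
  k%:Z + #|S|%:Z + 1 < d -> mon_tor_vanish K N k d.
Proof.
move cS: #|S| => m; elim: m S N k d cS => [|m IH] S N k d cS uN SZ SY NE kd.
  have NE' s : N s = (s :&: (Z :|: Y) != set0).
    by rewrite NE (cards0_eq cS) sub0set /= setIUr setU_eq0 negb_and.
  apply: (@mon_tor_reg K n (Z :|: Y) N 1) => //; last by lia.
    by move=> s; rewrite !NE' -setIA setIid.
  move=> s; rewrite NE' negbK => /setIidPl -> /eqP ->.
  by rewrite cards0.
have /card_gt0P[i iS] : (0 < #|S|)%N by rewrite cS.
have iZ : i \notin Z by apply: contraL iS => iZ; rewrite (disjointFl SZ).
have iY : i \notin Y by apply: contraL iS => iY; rewrite (disjointFl SY).
have cS' : #|S :\ i| = m by have := cardsD1 i S; rewrite iS cS; lia.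
have uD := upset_deletion (i := i) uN.
have subI s (B : {set 'I_n}) : i \notin B -> (s :\ i) :&: B = s :&: B.
  move=> iB; apply/setP => j; rewrite !inE; case: eqP => // ->.
  by rewrite (negbTE iB) ?andbF.
have addI s (B : {set 'I_n}) : i \notin B -> (i |: s) :&: B = s :&: B.
  move=> iB; apply/setP => j; rewrite !inE; case: eqP => // ->.
  by rewrite (negbTE iB) ?andbF.
have DE s : deletion N i s = (s :&: Z != set0).
  rewrite /deletion NE subI //.
  have -> : (S \subset s :\ i) = false.
    by apply/negP => /subsetP/(_ _ iS); rewrite !inE eqxx.
  by rewrite orbF.
have HD k' (d' : int) : k'%:Z + 1 < d' -> mon_tor_vanish K (deletion N i) k' d'.
  move=> kd'; apply: (@mon_tor_reg K n Z _ 1) => //.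
    by move=> s; rewrite !DE -setIA setIid.
  by move=> s; rewrite DE negbK => /setIidPl -> /eqP ->; rewrite cards0.
apply: (mon_tor_step (i := i)) => //.
- by apply: HD; lia.
- apply: (IH (S :\ i)) => //; last by lia.
  + exact: upset_link.
  + by apply: disjointWl SZ; apply: subsetDl.
  + by apply: disjointWl SY; apply: subsetDl.
  + move=> s; rewrite /link NE !addI // subDset; congr (_ || _ && _).
- by case: k kd => // k kd; apply: HD; lia.
Qed.

Implicit Types l : seq 'I_n.
Local Notation xvars l := [seq ('X_i : R) | i <- l].

(** The exterior product of the basis elements belonging to [Z], with coefficient 1. *)
Fixpoint wedge Z l : kchains R^o (xvars l) :=
  if l is i :: l' return kchains R^o (xvars l) then
    if i \in Z then (0, wedge Z l') else (wedge Z l', 0)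
  else 1.

Lemma wedge_scale_neq0 Z l (r : R) : r != 0 -> r *: wedge Z l != 0.
Proof.
move=> r0; elim: l => [|i l IH] /=; first by rewrite [_ *: _]mulr1.
case: ifP => _; apply: contra IH => /eqP H.
  by have := congr1 snd H => /= ->.
by have := congr1 fst H => /= ->.
Qed.

Lemma kdiff_wedge_neq0 Z l : (0 < count (mem Z) l)%N -> kdiff (wedge Z l) != 0.
Proof.
elim: l => //= i l IH; case: ifP => iZ /= H.
  apply/eqP => /(congr1 fst)/= /eqP; rewrite kdiff0 add0r; apply/negP.
  by apply: wedge_scale_neq0; rewrite -msupp_eq0 msuppX.
by apply/eqP => /(congr1 fst)/= /eqP; rewrite scaler0 addr0; apply/negP/IH.
Qed.

Lemma kdeg_wedge Z l : kdeg (@zhomogR K n) (count (mem Z) l) (count (mem Z) l)%:Z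
    (wedge Z l).
Proof.
have gG l' := @gmod_graded_for K n l' _ _ (@zhomogR_graded K n).
elim: l => [|j l IH] /=; first exact: zhomogC.
case: ifP => jZ /=; rewrite ?add1n ?add0n.
  by split; [exact: kdeg0 (gG l)|rewrite intS addrC addKr].
by split=> //; case: (count _ l) => //= c; exact: kdeg0 (gG l).
Qed.

Lemma kdeg_wedge_scale N Z l i : upset N -> N [set i] ->
  kdeg (ideal_deg (mon_ideal N)) (count (mem Z) l) ((count (mem Z) l)%:Z + 1)
    ('X_i *: wedge Z l).
Proof.
move=> uN Ni; have gG l' := @gmod_graded_for K n l' _ _ (mon_deg_graded K uN).
elim: l => [|j l IH] /=.
  split; first by rewrite [_ *: _]mulr1; apply: zhomogX.
  rewrite [_ *: _]mulr1 => m; rewrite mcoeffX; case: (eqVneq U_(i)%MM m) => [<- _|];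
      last by rewrite eqxx.
  by rewrite mon_supp1.
case: ifP => jZ /=; rewrite ?add1n ?add0n scaler0.
  by split; [exact: kdeg0 (gG l)|rewrite addrK intS addrC].
by split=> //; case: (count _ l) => //= c; exact: kdeg0 (gG l).
Qed.

Lemma kdeg_kdiff_wedge N Z l : upset N -> (forall i, i \in Z -> N [set i]) ->
  (0 < count (mem Z) l)%N ->
  kdeg (ideal_deg (mon_ideal N)) (count (mem Z) l).-1 (count (mem Z) l)%:Z
    (kdiff (wedge Z l)).
Proof.
move=> uN NZ; have gG l' := @gmod_graded_for K n l' _ _ (mon_deg_graded K uN).
elim: l => //= j l IH; case: ifP => jZ /=; rewrite ?add1n ?add0n => c0.
  split; first by rewrite kdiff0 add0r intS addrC; apply: kdeg_wedge_scale => //;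
      apply: NZ.
  move: (kdeg_wedge Z l) IH c0; case: (count _ l) => /= [/kdiff_deg0 -> _ _|c _ IH _].
    by rewrite oppr0.
  by apply: kdegN (gG l) _; rewrite intS addrC addKr; apply: IH.
split; first by rewrite scaler0 addr0; apply: IH.
by rewrite kdiff0 oppr0; case: (_.-1) => // c; exact: kdeg0 (gG l).
Qed.

(* The Koszul boundary of the wedge of the variables in [Z] is a cycle with
   coefficients in the ideal, and it bounds nothing there by degree. *)
Lemma mon_tor_linear_neq0 N Z : upset N -> ~~ N set0 ->
  (forall i, i \in Z -> N [set i]) -> (0 < #|Z|)%N ->
  ~ mon_tor_vanish K N #|Z|.-1 #|Z|%:Z.
Proof.
move=> uN N0 NZ; have <- : count (mem Z) (enum 'I_n) = #|Z|.
  by rewrite enumT -size_filter cardE /enum_mem.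
move=> Z0 H; have [] := H _ (kdeg_kdiff_wedge uN NZ Z0) (kdiff_sq _).
move=> b; rewrite prednK // => bd be; have := kdiff_wedge_neq0 Z0.
(* By degree the coefficients of [b] are constants, and a proper monomial ideal contains no nonzero
   constant. *)
rewrite -be (kdeg_triv _ bd) ?kdiff0 ?eqxx // => u [hu Iu].
rewrite subrr in hu; rewrite (zhomog_eqC hu); apply/eqP; rewrite mpolyC_eq0.
apply: contraR N0 => /Iu; rewrite (_ : mon_supp 0%MM = set0) //.
by apply/setP => i; rewrite !inE mnm0E.
Qed.

End LinearGenerators.

(** * Hilbert series *)

Section HilbertSeries.
Variables (K : fieldType) (n : nat).
Local Notation R := {mpoly K[n]}.
Local Notation hilbR := (hilbR n).
Implicit Types (N : pred {set 'I_n}) (k q : {poly rat}) (d e : int).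

(* The coefficient of [t^e] in [k(t)] times the Hilbert series of the ring. *)
Definition hilb_conv k e : rat :=
  if e is Posz e' then \sum_(j < e'.+1) k`_j * (hilbR (e' - j)%N)%:R else 0.

Lemma hilb_convD k k' e : hilb_conv (k + k') e = hilb_conv k e + hilb_conv k' e.
Proof.
case: e => e /=; last by rewrite addr0.
by rewrite -big_split; apply: eq_bigr => j _; rewrite coefD mulrDl.
Qed.

Lemma hilb_convN k e : hilb_conv (- k) e = - hilb_conv k e.
Proof.
case: e => e /=; last by rewrite oppr0.
by rewrite -sumrN; apply: eq_bigr => j _; rewrite coefN mulNr.
Qed.

Lemma hilb_conv0 e : hilb_conv 0 e = 0.
Proof. by case: e => e //=; rewrite big1 // => j _; rewrite coef0 mul0r. Qed.

Lemma hilb_conv1 e : hilb_conv 1 e = (hilbR e)%:R.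
Proof.
case: e => e //=; rewrite big_ord_recl subn0 coef1 mul1r big1 ?addr0 // => j _.
by rewrite coef1 mul0r.
Qed.

Lemma hilb_convX k e : hilb_conv ('X * k) e = hilb_conv k (e - 1).
Proof.
case: e => [[|e]|e] //; first by rewrite /= big_ord1 coefXM mul0r.
rewrite (_ : e.+1%:Z - 1 = e); last by lia.
rewrite /= big_ord_recl coefXM mul0r add0r.
by apply: eq_bigr => j _; rewrite coefXM.
Qed.

Lemma hilb_convXn a e : hilb_conv 'X^a e = (hilbR (e - a%:Z))%:R.
Proof.
elim: a e => [|a IH] e; first by rewrite subr0 hilb_conv1.
by rewrite exprS hilb_convX IH intS opprD addrA.
Qed.

(** The Hilbert series of the ring has constant term 1, so it can be cancelled. *)
Lemma hilb_conv_inj k k' : (forall e : nat, hilb_conv k e = hilb_conv k' e) -> k = k'.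
Proof.
move=> H; apply/eqP; rewrite -subr_eq0; apply/eqP.
have {}H (e : nat) : hilb_conv (k - k') e = 0.
  by rewrite hilb_convD hilb_convN H subrr.
move: (k - k') H => {k k'} k H; apply/polyP => e; rewrite coef0.
elim/ltn_ind: e => e IH; have := H e.
rewrite /= big_ord_recr /= subnn (hilbR0 K n : hilbR 0%N = 1%N) mulr1 big1 ?add0r //
    => j _.
by rewrite IH ?mul0r.
Qed.

Definition has_hilb (P : int -> R^o -> Prop) k : Prop :=
  forall e, exists2 M, has_dim (P e) M & M%:R = hilb_conv k e.

Lemma has_hilb_inj P k k' : has_hilb P k -> has_hilb P k' -> k = k'.
Proof.
move=> H H'; apply: hilb_conv_inj => e; have [M hM <-] := H e.
by have [M' hM' <-] := H' e; rewrite (has_dim_inj hM hM').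
Qed.

(* The series is recorded as [1 - k], the numerator for the quotient ring. *)
Definition mon_hilb N q := has_hilb (ideal_deg (mon_ideal N)) (1 - q).

Lemma mon_has_dim N d : upset N -> exists M, has_dim (ideal_deg (@mon_ideal K n N) d) M.
Proof.
move=> uN; apply: (sub_has_dim _ _ (has_dimR K n d)); last by move=> p [].
exact: gmod_subspace (mon_deg_graded K uN).
Qed.

(** Additivity of dimension along the deletion-link sequence; the 1 in [1 - q] is preserved because
    (1 - t) + t = 1. *)
Lemma mon_hilb_step N i q1 q2 : upset N -> mon_hilb (deletion N i) q1 ->
  mon_hilb (link N i) q2 -> mon_hilb N ((1 - 'X) * q1 + 'X * q2).
Proof.
move=> uN h1 h2 e.
have gD := mon_deg_graded K (upset_deletion (i := i) uN).
have gL := gmod_shift 1 (mon_deg_graded K (upset_link (i := i) uN)).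
have gB : graded_module (@del_link_deg K n N i) by exact: (gmod_prod gD gL).
have [a ha ea] := h1 e; have [a' ha' ea'] := h1 (e - 1).
have [b hb eb] := h2 (e - 1); have [c hc] := mon_has_dim e uN.
exists c => //.
have B1 := has_dim_short_exact (d := e) (prod_short_exact gD gL) gD gB ha hb.
have B2 := has_dim_short_exact (d := e) (del_link_exact K i uN) (gmod_shift 1 gD) gB
    ha' hc.
have /(congr1 (fun m => m%:R : rat)) := has_dim_inj B1 B2.
rewrite !natrD ea ea' eb => E.
have -> : 1 - ((1 - 'X) * q1 + 'X * q2) = (1 - q1) + - ('X * (1 - q1)) + 'X * (1 -
    q2) by ring.
rewrite 2!hilb_convD hilb_convN !hilb_convX.
by apply: (@addrI _ (hilb_conv (1 - q1) (e - 1))); rewrite -E; ring.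
Qed.

Lemma mon_hilb_all N : (forall s, N s) -> mon_hilb N 0.
Proof.
move=> allN e; exists (hilbR e); last by rewrite subr0 hilb_conv1.
apply: eq_has_dim (has_dimR K n e) => p.
by split=> [hp|[]//]; split=> // m _; apply: allN.
Qed.

Lemma mon_hilb_none N : upset N -> (forall s, ~~ N s) -> mon_hilb N 1.
Proof.
move=> uN noN e; exists 0%N; last by rewrite subrr hilb_conv0.
apply: has_dim0; first exact: gmod_subspace (mon_deg_graded K uN).
move=> p [_ Ip]; apply/mpolyP => m; rewrite mcoeff0; apply/eqP.
by apply: contraT => /Ip; rewrite (negbTE (noN _)).
Qed.

Lemma eq_mon_hilb N N' q : N =1 N' -> mon_hilb N q -> mon_hilb N' q.
Proof.
move=> eN h e; have [M hM eM] := h e; exists M => //.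
by apply: eq_has_dim hM => p; split=> -[hp Ip]; split=> // m /Ip; rewrite eN.
Qed.

(** The deletion may lose one from the codimension, which the factor 1 - t restores. The link keeps
    it: faces lose a vertex while [V] loses an element. *)
Lemma mon_hilb_dvd V N h : upset N -> depends_on V N ->
  (forall s : {set 'I_n}, s \subset V -> ~~ N s -> (#|s| + h <= #|V|)%N) ->
  exists2 q, mon_hilb N q & (('X - 1) ^+ h %| q)%R.
Proof.
move cV: #|V| => v; elim: v V N h cV => [|v IH] V N h cV uN dV Nh.
  have N0 s : N s = N set0 by rewrite dV (cards0_eq cV) setI0.
  have [H|H] := boolP (N set0).
    by exists 0; [apply: mon_hilb_all => s; rewrite N0|rewrite dvdp0].
  have := Nh _ (sub0set _) H; rewrite leqn0 addn_eq0 => /andP[_ /eqP ->].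
  by exists 1; [apply: mon_hilb_none => // s; rewrite N0|rewrite expr0 dvdpp].
have /card_gt0P[i iV] : (0 < #|V|)%N by rewrite cV.
have cV' : #|V :\ i| = v by have := cardsD1 i V; rewrite iV cV; lia.
have iN (s : {set 'I_n}) : s \subset V :\ i -> i \notin s.
  by move=> sV; apply/negP => /(subsetP sV); rewrite !inE eqxx.
have [||s sV Ns|q1 h1 d1] := IH (V :\ i) (deletion N i) h.-1 cV'.
- exact: upset_deletion.
- exact: depends_deletion.
- suff : (#|s| + h <= v.+1)%N by have := subset_leq_card sV; rewrite cV'; lia.
  apply: Nh; first exact: subset_trans sV (subsetDl _ _).
  apply: contra Ns; rewrite /deletion (_ : s :\ i = s) //; apply/setP => j.
  by rewrite !inE; case: eqP => // ->; rewrite (negbTE (iN _ sV)).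
have [||s sV Ns|q2 h2 d2] := IH (V :\ i) (link N i) h cV'.
- exact: upset_link.
- exact: depends_link.
- have := Nh (i |: s); rewrite cardsU1 iN // => H.
  by rewrite -ltnS -addSn -add1n; apply: H => //;
      rewrite subUset sub1set iV (subset_trans sV (subsetDl _ _)).
exists ((1 - 'X) * q1 + 'X * q2); first exact: mon_hilb_step h1 h2.
apply: dvdp_add; last exact: dvdp_mull.
case: h d1 {Nh d2} => [|h] /= d1; first by rewrite expr0 dvd1p.
by rewrite exprS dvdp_mul // -opprB -scaleN1r dvdpZl ?oppr_eq0 ?oner_eq0 ?dvdpp.
Qed.

End HilbertSeries.

(** * Hilbert series from a resolution *)

Section ResolutionHilbert.
Variables (K : fieldType) (n : nat) (I : {mpoly K[n]} -> Prop).
Variable F : min_graded_resolution I.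
Hypotheses (gI : graded_ideal I) (tw_ge0 : forall i a, a \in twists F i -> (0 <= a)%R).

Definition twist_poly i : {poly rat} := \sum_(a <- twists F i) 'X^(absz a).

Lemma has_dim_twists i e :
  exists2 f, has_dim (@free_deg K n (twists F i) e) f & f%:R = hilb_conv n
      (twist_poly i) e.
Proof.
exists (\sum_(a <- twists F i) hilbR n (e - a)); first exact: has_dim_free.
rewrite /twist_poly natr_sum (big_morph _ (fun k k' => hilb_convD n k k' e)
    (hilb_conv0 n e)).
rewrite !big_seq; apply: eq_bigr => a /tw_ge0 a0.
by rewrite hilb_convXn gez0_abs.
Qed.

(** Induction on the number k of free modules still to come; past the last one the syzygies are
    zero. *)
Lemma syz_hilb p : (forall i, (p < i)%N -> twists F i = [::]) ->
  forall k i e M, (p <= i + k)%N -> has_dim (@syz_deg _ _ _ F i e) M ->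
  M%:R = hilb_conv n (\sum_(j < k) (-1) ^+ j *: twist_poly (i.+1 + j)) e.
Proof.
move=> Fp; elim=> [|k IH] i e M.
  rewrite addn0 => pi hM; rewrite big_ord0 hilb_conv0.
  suff h0 : has_dim (@syz_deg _ _ _ F i e) 0 by rewrite (has_dim_inj hM h0).
  apply: has_dim0; first exact: gmod_subspace (syz_graded F i).
  move=> v /(mc_surj (syz_cover F i))[w _ <-].
  have w0 : w = 0.
    by apply/rowP => l; exfalso; case: l => l; rewrite Fp.
  by rewrite w0 (linear_fun0 (mc_linear (syz_cover F i))).
rewrite addnS -addSn => pik hM.
have S := ker_short_exact (syz_cover F i).
have gS := syz_graded F i.+1.
have gF := @free_graded K n (twists F i.+1).
have [f hf ef] := has_dim_twists i.+1 e.
have [M' hM'] : exists M', has_dim (@syz_deg _ _ _ F i.+1 e) M'.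
  by apply: (sub_has_dim _ _ hf); [exact: gmod_subspace gS|move=> v []].
have B := has_dim_short_exact (d := e) S gS gF hM' hM.
have /(congr1 (fun m => m%:R : rat)) := has_dim_inj B hf.
rewrite natrD ef (IH i.+1 e M' pik hM') big_ord_recl expr0 scale1r addn0 => E.
rewrite hilb_convD -E [X in _ = _ + hilb_conv n X e](_ : _ = - \sum_(j < k) (-1) ^+ j
    *: twist_poly (i.+2 + j)).
  by rewrite hilb_convN; ring.
rewrite -sumrN; apply: eq_bigr => j _ /=.
by rewrite exprS mulN1r scaleNr addnS addSn.
Qed.

Lemma resolution_hilb p : (forall i, (p < i)%N -> twists F i = [::]) ->
  has_hilb (ideal_deg I) (\sum_(j < p.+1) (-1) ^+ j *: twist_poly j).
Proof.
move=> Fp e.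
have S := ker_short_exact (augm_cover F).
have gS := syz_graded F 0; have gF := @free_graded K n (twists F 0).
have [M hM] : exists M, has_dim (ideal_deg I e) M.
  apply: (sub_has_dim _ _ (has_dimR K n e)); last by move=> q [].
  exact: gmod_subspace (ideal_graded gI).
exists M => //.
have [f hf ef] := has_dim_twists 0 e.
have [M' hM'] : exists M', has_dim (@syz_deg _ _ _ F 0 e) M'.
  by apply: (sub_has_dim _ _ hf); [exact: gmod_subspace gS|move=> v []].
have B := has_dim_short_exact (d := e) S gS gF hM' hM.
have /(congr1 (fun m => m%:R : rat)) := has_dim_inj B hf.
rewrite natrD ef (@syz_hilb p Fp p 0 e M') ?add0n // => E.
rewrite big_ord_recl expr0 scale1r hilb_convD -E.
rewrite [X in _ = _ + hilb_conv n X e](_ : _ = - \sum_(j < p) (-1) ^+ j *: twist_poly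
    (1 + j)).
  by rewrite hilb_convN; ring.
by rewrite -sumrN; apply: eq_bigr => j _ /=; rewrite exprS mulN1r scaleNr.
Qed.

End ResolutionHilbert.

(** * Stanley-Reisner ideals as monomial ideals *)

Section StanleyReisner.
Variables (K : fieldType) (n : nat).
Local Notation R := {mpoly K[n]}.
Implicit Types (Delta : {set {set 'I_n}}) (s : {set 'I_n}).

Definition nonface Delta : pred {set 'I_n} := fun s => s \notin Delta.

Lemma upset_nonface Delta : simplicial_complex Delta -> upset (nonface Delta).
Proof. by move=> sD s t st; apply: contra => tD; apply: sD tD st. Qed.

Lemma prodX_mesym1 s : \prod_(i in s) 'X_i = 'X_[mesym1 s] :> R.
Proof.
rewrite mprodXE; congr mpolyX; apply/mnmP => j; rewrite mnm_sumE mnmE.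
rewrite (eq_bigr (fun i => (i == j) : nat)) => [|i _]; last by rewrite mnm1E.
have [js|js] := boolP (j \in s).
  by rewrite (bigD1 j) //= eqxx big1 // => i /andP[_ /negbTE ->].
by rewrite big1 // => i si; case: eqP => // ij; rewrite -ij si in js.
Qed.

Lemma mon_supp_mesym1 s : mon_supp (mesym1 s) = s.
Proof. by apply/setP => i; rewrite !inE mnmE; case: (i \in s). Qed.

Lemma mesym1_mon_supp_le (m : 'X_{1..n}) : (mesym1 (mon_supp m) <= m)%MM.
Proof. by apply/mnm_lepP => i; rewrite mnmE inE; case: (m i). Qed.

Lemma stanley_reisnerE Delta (p : R) : simplicial_complex Delta ->
  stanley_reisner Delta p <-> mon_ideal (nonface Delta) p.
Proof.
move=> sD; have uN := upset_nonface sD.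
have [I0 IB IM _] := mon_ideal_graded K uN.
have ID (q r : R) : mon_ideal (nonface Delta) q -> mon_ideal (nonface Delta) r ->
    mon_ideal (nonface Delta) (q + r).
  move=> Iq Ir; have := IB _ _ Iq (IB _ _ I0 Ir); by rewrite sub0r opprK.
split=> [[c ->]|Ip].
  elim/big_ind: _ => // s sN; apply: IM; rewrite prodX_mesym1 => m.
  rewrite mcoeffX; case: (eqVneq (mesym1 s) m) => [<- _|]; last by rewrite eqxx.
  by rewrite mon_supp_mesym1.
(* Each term of p is charged to its own support, which is a nonface. *)
exists (fun s => \sum_(m <- msupp p | mon_supp m == s) p@_m *: 'X_[m - mesym1 s]).
under eq_bigr do rewrite prodX_mesym1 mulr_suml.
rewrite (exchange_big_dep xpredT) //= {1}[p]mpolyE big_seq [RHS]big_seq.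
apply: eq_bigr => m mp.
rewrite (big_pred1 (mon_supp m)).
  by rewrite -scalerAl -mpolyXD submK // mesym1_mon_supp_le.
move=> s; rewrite /= andbC eq_sym; case: eqP => // -> /=.
by apply: Ip; rewrite -mcoeff_msupp.
Qed.

End StanleyReisner.

(** * Existence of minimal graded resolutions *)

Section Generators.
Variables (K : fieldType) (n : nat).
Local Notation R := {mpoly K[n]}.
Variables (E : lmodType R) (G : int -> E -> Prop).
Hypothesis gG : graded_module G.
Implicit Types (s : seq (int * E)) (p : int * E).

Definition gspan s d (e : E) : Prop :=
  exists2 r : nat -> R, (forall k, zhomog (d - (nth (0, 0) s k).1) (r k)) &
    e = \sum_(k < size s) r k *: (nth (0, 0) s k).2.

Lemma gspan0 s d : gspan s d 0.
Proof.
exists (fun=> 0) => [k|]; first exact: zhomog0.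
by rewrite big1 // => k _; rewrite scale0r.
Qed.

Lemma gspanD s d e e' : gspan s d e -> gspan s d e' -> gspan s d (e + e').
Proof.
move=> [r hr ->] [r' hr' ->]; exists (fun k => r k + r' k) => [k|]; first exact: zhomogD.
by rewrite -big_split; apply: eq_bigr => k _; rewrite scalerDl.
Qed.

Lemma gspanM s a d r e : zhomog a r -> gspan s d e -> gspan s (d + a) (r *: e).
Proof.
move=> hr [r' hr' ->]; exists (fun k => r * r' k) => [k|].
  by rewrite addrAC addrC; apply: zhomogM.
by rewrite scaler_sumr; apply: eq_bigr => k _; rewrite scalerA.
Qed.

Lemma gspan_sum s d I (r : seq I) (P : pred I) (F : I -> E) :
  (forall i, P i -> gspan s d (F i)) -> gspan s d (\sum_(i <- r | P i) F i).
Proof. by move=> H; elim/big_ind: _ => // [|u v]; [exact: gspan0|exact: gspanD]. Qed.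

Lemma gspan_mem s p : p \in s -> gspan s p.1 p.2.
Proof.
move=> /(nthP (0, 0))[k ks <-]; exists (fun j => if j == k then 1 else 0) => [j|].
  by case: eqP => [->|_]; [rewrite subrr -mpolyC1; apply: zhomogC|apply: zhomog0].
rewrite (bigD1 (Ordinal ks)) //= eqxx scale1r big1 ?addr0 // => j.
by rewrite -val_eqE /= => /negbTE ->; rewrite scale0r.
Qed.

Lemma gspan_trans s s' d e : (forall p, p \in s -> gspan s' p.1 p.2) ->
  gspan s d e -> gspan s' d e.
Proof.
move=> H [r hr ->]; apply: gspan_sum => k _.
rewrite -[d](subrK (nth (0, 0) s k).1) addrC; apply: gspanM; first exact: hr.
by apply/H/mem_nth.
Qed.

Definition generates s : Prop :=
  (forall p, p \in s -> G p.1 p.2) /\ (forall d e, G d e -> gspan s d e).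

Lemma minimal_generates : (exists s, generates s) ->
  exists2 s, generates s & forall s', generates s' -> (size s <= size s')%N.
Proof.
case=> s; elim/(well_founded_induction (Wf_nat.well_founded_ltof _ (@size (int *
    E)%type))): s.
move=> s IH gs; have [H|] := classic (forall s', generates s' -> (size s <= size s')%N).
  by exists s.
move=> H; have [s' H'] := not_all_ex_not _ _ H; have [gs' ss'] := imply_to_and _ _ H'.
by apply: (IH s') => //; apply/ssrnat.ltP; rewrite ltnNge; apply/negP.
Qed.

(** Bases of the pieces up to degree B generate: above B, vanishing of Tor_0 writes an element
    through the preceding degree. *)
Lemma finitely_generated (B : nat) : (forall (d : int) e, (d < 0)%R -> G d e -> e = 0) ->
  (forall d, exists N, has_dim (G d) N) ->
  (forall d : int, (B%:Z < d)%R -> tor_vanish G 0 d) -> exists s, generates s.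
Proof.
move=> Gneg Gfin Gtor.
have H : exists s, (forall p, p \in s -> G p.1 p.2) /\
    forall (d : nat) e, (d < B.+1)%N -> G d e -> gspan s d e.
  elim: (B.+1) => [|D [s [sG sD]]]; first by exists [::].
  have [N [T [u [_ Tu _ su]]]] := Gfin D.
  exists (s ++ [seq (D%:Z, u t) | t <- enum T]); split.
    by move=> p; rewrite mem_cat => /orP[/sG//|/mapP[t _ ->]]; exact: Tu.
  move=> d e; rewrite ltnS leq_eqVlt => /orP[/eqP -> /su[c ->]|dD /(sD _ _ dD)].
    apply: gspan_sum => t _; rewrite -[X in gspan _ X]addr0; apply: gspanM;
        first exact: zhomogC.
    apply: (@gspan_mem _ (D%:Z, u t)); rewrite mem_cat.
    by apply/orP; right; apply/mapP; exists t; rewrite ?mem_enum ?inE.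
  by apply: gspan_trans => p ps; apply: gspan_mem; rewrite mem_cat ps.
case: H => s [sG sB]; exists s; split=> // -[] d e; last first.
  by move=> /Gneg -> //; apply: gspan0.
elim/ltn_ind: d e => d IH e Ge.
have [dB|Bd] := ltnP d B.+1; first exact: sB.
have Bd' : (B%:Z < d%:Z)%R by lia.
have [f Gf ->] := proj1 (tor_vanish0P gG d) (Gtor _ Bd') e Ge.
apply: gspan_sum => i _; rewrite -[d%:Z](subrK 1).
apply: gspanM; first exact: zhomogX.
case: d IH Bd Gf {Ge Bd'} => // d IH _ Gf.
have dE : d.+1%:Z - 1 = d by lia.
by rewrite dE; apply: IH => //; rewrite -dE.
Qed.

Lemma minimal_generators (B : nat) : (forall (d : int) e, (d < 0)%R -> G d e -> e = 0) ->
  (forall d, exists N, has_dim (G d) N) ->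
  (forall d : int, (B%:Z < d)%R -> tor_vanish G 0 d) ->
  exists (tw : seq int) (g : nat -> E),
    (forall k, (k < size tw)%N -> G tw`_k (g k)) /\
    minimal_cover G (fun v : 'rV[R]_(size tw) => \sum_k v 0 k *: g k).
Proof.
move=> Gneg Gfin Gtor;
    have /minimal_generates[s [sG Gs] smin] := finitely_generated Gneg Gfin Gtor.
exists [seq p.1 | p <- s], (fun k => (nth (0, 0) s k).2).
have nthE (k : nat) : (k < size s)%N -> [seq p.1 | p <- s]`_k = (nth (0, 0) s k).1.
  by move=> ks; rewrite (nth_map (0, 0)).
have sz : size [seq p.1 | p <- s] = size s by rewrite size_map.
split; first by move=> k; rewrite sz => ks; rewrite nthE //; apply/sG/mem_nth.
split.
- move=> r u v; rewrite scaler_sumr -big_split; apply: eq_bigr => k _.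
  by rewrite !mxE scalerDl scalerA.
- move=> d v dv /=; apply: gmod_sum => // k _.
  have ks : (k < size s)%N by rewrite -sz.
  rewrite -[d](subrK (nth (0, 0) s k).1) addrC; apply: (gmodM gG);
      last by apply/sG/mem_nth.
  by rewrite -nthE.
- move=> d e /Gs[r hr ->]; exists (\row_k r k).
    by move=> k; rewrite mxE nthE // -sz.
  under eq_bigr do rewrite mxE.
  by rewrite -!(big_mkord xpredT (fun k => r k *: (nth (0, 0) s k).2)) sz.
(* A relation with a nonzero constant at k would make the k-th generator redundant, against the
   minimal length of [s]. *)
- move=> d v dv v0 k; apply/eqP/negP => /negP nz.
  have ks : (k < size s)%N by rewrite -sz.
  have dk : d = (nth (0, 0) s k).1.
    have := dv k; rewrite nthE // => hk; apply/eqP; rewrite -subr_eq0.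
    by apply: contraNT nz => dk; rewrite (zhomog_const hk dk).
  pose c := (v 0 k)@_0%MM.
  have vk : v 0 k = c%:MP by apply: zhomog_eqC; have := dv k; rewrite nthE // dk subrr.
  pose s' := take k s ++ drop k.+1 s.
  have sub_s' p : p \in s' -> p \in s.
    by rewrite mem_cat => /orP[/mem_take|/mem_drop].
  have nth_s' (j : nat) : (j < size s)%N -> j != k -> nth (0, 0) s j \in s'.
    move=> js jk; rewrite mem_cat.
    have [jk'|kj] := ltnP j k.
      by rewrite -(nth_take (0, 0) jk') mem_nth // size_take ks.
    have kj' : (k < j)%N by rewrite ltn_neqAle eq_sym jk.
    rewrite -[j](subnKC kj') -nth_drop mem_nth ?orbT // size_drop.
    by rewrite ltn_sub2r // (leq_ltn_trans _ js).
  have gk : gspan s' (nth (0, 0) s k).1 (nth (0, 0) s k).2.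
    have -> : (nth (0, 0) s k).2 = (- c^-1)%:MP *: \sum_(j | j != k) v 0 j *: (nth
        (0, 0) s j).2.
      move: v0; rewrite (bigD1 k) //= vk => /eqP; rewrite addrC addr_eq0 => /eqP ->.
      by rewrite scalerN scalerA -mpolyCM mulNr mulVf // mpolyCN mpolyC1 scaleN1r opprK.
    rewrite -[(nth _ s k).1]addr0; apply: gspanM; first exact: zhomogC.
    apply: gspan_sum => j jk; have js : (j < size s)%N by rewrite -sz.
    rewrite -dk -[d](subrK (nth (0, 0) s j).1) addrC; apply: gspanM.
      by have := dv j; rewrite nthE.
    by apply/gspan_mem/nth_s'.
  have gs' : generates s'.
    split=> [p /sub_s'/sG //|d' e /Gs]; apply: gspan_trans => p /(nthP (0, 0))[j js <-].
    have [->//|jk] := eqVneq j k.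
    by apply/gspan_mem/nth_s'.
  have := smin _ gs'; rewrite size_cat size_take size_drop ks; lia.
Qed.

End Generators.

(** * Building a resolution stage by stage *)

Section Existence.
Variables (K : fieldType) (n : nat) (I : {mpoly K[n]} -> Prop) (B : nat).
Local Notation R := {mpoly K[n]}.
Hypotheses (gI : graded_ideal I)
  (tor_deg : forall i (d : int), (B%:Z < d)%R -> tor_vanish (ideal_deg I) i d)
  (tor_len : forall i d, (B < i)%N -> tor_vanish (ideal_deg I) i d).

Lemma row_comp_partition (tw : seq int) (v : 'rV[R]_(size tw)) : (forall a, a \in tw
    -> (0 <= a)%R) ->
  exists D : nat, v = \sum_(d < D) row_comp d%:Z v.
Proof.
(* A term m of entry k has degree [mdeg m] plus the k-th twist; this sum exceeds all such
   degrees. *)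
move=> tw0; exists (\sum_(k < size tw) (absz (tw`_k)%R + msize (v 0%R k)))%N.
apply/rowP => k; rewrite summxE; under eq_bigr do rewrite mxE.
have [a ak] : exists a : nat, tw`_k = a.
  by exists (absz tw`_k); rewrite gez0_abs // tw0 // mem_nth.
apply/mpolyP => m; rewrite raddf_sum /=; under eq_bigr do rewrite mcoeff_zcomp.
have [nz|z] := boolP (m \in msupp (v 0 k)); last first.
  by rewrite (memN_msupp_eq0 z) big1 // => d _; rewrite if_same.
have mD : (mdeg m + a < \sum_(k < size tw) (absz (tw`_k)%R + msize (v 0%R k)))%N.
  rewrite (bigD1 k) //= ak; have := msize_mdeg_lt nz; lia.
rewrite (bigD1 (Ordinal mD)) //= ak PoszD addrK eqxx big1 ?addr0 // => d dm.
rewrite ifN //; apply: contra dm => /eqP dm; rewrite -val_eqE /=; apply/eqP; lia.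
Qed.

(** Stage i pairs the i-th twists with the kernel of the map out of that free module. The type of
    vectors depends on the twists, hence the sigma type. The fourth clause yields finite length, the
    last one finite generation of the next kernel. *)
Definition stage_ok i (S : {tw : seq int & int -> 'rV[R]_(size tw) -> Prop}) : Prop :=
  [/\ graded_module (projT2 S),
      forall d v, projT2 S d v -> free_deg d v,
      forall d v k, projT2 S d v -> (v 0 k)@_0%MM = 0,
      forall a, a \in projT1 S -> (0 <= a)%R /\ ~ tor_vanish (ideal_deg I) i a &
      forall j d, tor_vanish (ideal_deg I) (i + j).+1 d -> tor_vanish (projT2 S) j d].

Definition stage i := {S | stage_ok i S}.
Definition stw i (x : stage i) : seq int := projT1 (proj1_sig x).
Definition sdeg i (x : stage i) : int -> 'rV[R]_(size (stw x)) -> Prop :=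
  projT2 (proj1_sig x).

Definition stage_map i (x : stage i) (y : stage i.+1)
    (D : 'M[R]_(size (stw y), size (stw x))) : Prop :=
  [/\ homog_mx D, minimal_cover (@sdeg _ x) (fun v : 'rV[R]_(size (stw y)) => v *m D) &
      forall d v, @sdeg _ y d v <-> ker_deg (fun v : 'rV[R]_(size (stw y)) => v *m D)
          d v].

Lemma cover_exists (E : lmodType R) (G : int -> E -> Prop) i : graded_module G ->
  (forall (d : int) e, (d < 0)%R -> G d e -> e = 0) ->
  (forall d, exists N, has_dim (G d) N) ->
  (forall j d, tor_vanish (ideal_deg I) (i + j) d -> tor_vanish G j d) ->
  exists (tw : seq int) (g : nat -> E),
    [/\ forall k, (k < size tw)%N -> G tw`_k (g k),
        minimal_cover G (fun v : 'rV[R]_(size tw) => \sum_k v 0 k *: g k) &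
        stage_ok i (existT _ tw (ker_deg (fun v : 'rV[R]_(size tw) => \sum_k v 0 k *:
            g k)))].
Proof.
move=> gG Gneg Gfin Gtor.
have [|tw [g [Gg mc]]] := minimal_generators gG (B := B) Gneg Gfin.
  by move=> d Bd; apply: Gtor; rewrite addn0; apply: tor_deg.
exists tw, g; split=> //; split=> /=.
- exact: ker_graded mc.
- by move=> d v [].
- by move=> d v k [dv v0]; exact: (mc_min mc dv v0).
- move=> a atw; have := cover_twist gG mc atw => nt; split; last first.
    by move=> Ha; apply: nt; apply: Gtor; rewrite addn0.
  rewrite leNgt; apply/negP => a0; apply: nt; apply/(tor_vanish0P gG) => e /Gneg -> //.
  exists (fun=> 0) => [j|]; first exact: gmod0.
  by rewrite big1 // => j _; rewrite scaler0.
- move=> j d Hd; apply: (proj1 (cover_tor_vanish mc j d)).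
  by apply: Gtor; rewrite addnS.
Qed.

Lemma next_stage i (x : stage i) :
  exists yD : {y : stage i.+1 & 'M[R]_(size (stw y), size (stw x))},
    stage_map (projT2 yD).
Proof.
case: x => -[tw G] ok; have [/= gG Gfree Gmin twP Gtor] := ok.
have [||j d|tw' [g [Gg mc ok']]] := @cover_exists _ G i.+1 gG.
- move=> d v d0 /Gfree dv; apply/rowP => k; rewrite mxE.
  apply: zhomog_lt0 (dv k); rewrite subr_lt0; apply: lt_le_trans d0 _.
  by case: (twP tw`_k (mem_nth _ (ltn_ord k))).
- move=> d; apply: sub_has_dim (has_dim_free K n tw d); last exact: Gfree.
  exact: gmod_subspace.
- by rewrite addSn; apply: Gtor.
pose D : 'M[R]_(size tw', size tw) := \matrix_(k < size tw') g k.
have DE v : v *m D = \sum_k v 0 k *: g k.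
  by rewrite mulmx_sum_row; apply: eq_bigr => k _; rewrite rowK.
have hD : homog_mx D.
  by move=> j k; rewrite mxE; apply: (Gfree _ _ (Gg _ (ltn_ord j))).
exists (existT _ (exist _ _ ok') D); split => //.
- case: mc => lin dg sj mn; split.
  + by move=> r u v; rewrite mulmxDl -scalemxAl.
  + by move=> d v dv; rewrite DE; apply: dg.
  + by move=> d e /sj[v dv ve]; exists v; rewrite // DE.
  + by move=> d v dv; rewrite DE; apply: mn.
- by move=> d v; rewrite /sdeg /= /ker_deg DE.
Qed.

Definition pick_next i (x : stage i) :=
  constructive_indefinite_description _ (next_stage x).

Hypothesis first : stage 0.

Fixpoint stages i : stage i :=
  if i is i'.+1 return stage i then projT1 (proj1_sig (pick_next (stages i'))) else first.

Definition stage_diff i : 'M[R]_(size (stw (stages i.+1)), size (stw (stages i))) :=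
  projT2 (proj1_sig (pick_next (stages i))).

Lemma stage_diffP i : stage_map (stage_diff i).
Proof. exact: (proj2_sig (pick_next (stages i))). Qed.

Lemma stage_ge0 i a : a \in stw (stages i) -> (0 <= a)%R.
Proof. by case: (stages i) => S [? ? ? H ?] /H[]. Qed.

(** The covers are exact degree by degree; nonnegative twists allow every vector to be cut into
    finitely many homogeneous components. *)
Lemma stage_diff_exact i (v : 'rV[R]_(size (stw (stages i.+1)))) :
  v *m stage_diff i = 0 <-> exists w, v = w *m stage_diff i.+1.
Proof.
have [hD mc _] := stage_diffP i; have [hD' mc' kerD] := stage_diffP i.+1.
have [hD0 _ ker0] := stage_diffP i.
split=> [v0|[w ->]].
  have [D vE] := row_comp_partition v (@stage_ge0 i.+1).
  have H (d : 'I_D) : exists w, row_comp d%:Z v = w *m stage_diff i.+1.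
    have : @sdeg _ (stages i.+1) d%:Z (row_comp d%:Z v).
      apply/ker0; split; first exact: free_deg_row_comp.
      rewrite -row_compM // v0; apply/rowP => k.
      by rewrite !mxE; apply: zcomp_id; apply: zhomog0.
    by move=> /(mc_surj mc')[w _ <-]; exists w.
  have /fin_all_exists[w Hw] := H.
  exists (\sum_d w d); rewrite mulmx_suml {1}vE; apply: eq_bigr => d _.
  exact: Hw.
have [D {1}->] := row_comp_partition w (@stage_ge0 i.+2).
rewrite !mulmx_suml big1 // => d _.
have dw : free_deg d%:Z (row_comp d%:Z w) by apply: free_deg_row_comp.
by have /ker0[_] := mc_deg mc' dw.
Qed.

Lemma stage_diff_minimal i j k : (stage_diff i j k)@_0%MM = 0.
Proof.
have [_ mc _] := stage_diffP i.
have [_ _ H _ _] := proj2_sig (stages i).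
rewrite -(H _ _ k (mc_deg mc (@free_unit K n (stw (stages i.+1)) j))).
by rewrite -rowE mxE.
Qed.

Lemma stage_finite i : (B < i)%N -> stw (stages i) = [::].
Proof.
move=> Bi; case E: (stw (stages i)) => [//|a s]; exfalso.
have : a \in stw (stages i) by rewrite E mem_head.
by case: (stages i) => S [? ? ? H ?] /H[_]; apply; apply: tor_len.
Qed.

End Existence.

(** The bound on d makes each kernel finitely generated, and the bound on i makes the resolution
    finite. *)
Lemma min_resolution_exists (K : fieldType) n (I : {mpoly K[n]} -> Prop) (B : nat) :
  graded_ideal I ->
  (forall i (d : int), (B%:Z < d)%R -> tor_vanish (ideal_deg I) i d) ->
  (forall i d, (B < i)%N -> tor_vanish (ideal_deg I) i d) ->
  inhabited (min_graded_resolution I).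
Proof.
move=> gI tor_deg tor_len.
have gG := ideal_graded gI.
have [||//|tw [g [Gg mc ok]]] := @cover_exists K n I B tor_deg _ (ideal_deg I) 0 gG.
- by move=> d p d0 [hp _]; apply: zhomog_lt0 d0 hp.
- move=> d; apply: sub_has_dim (has_dimR K n d); last by move=> p [].
  exact: gmod_subspace gG.
pose x0 : stage I 0 := exist _ _ ok.
pose A : 'cV[{mpoly K[n]}]_(size tw) := \col_k g k.
have AE (v : 'rV_(size tw)) : (v *m A) 0 0 = \sum_k v 0 k *: (g k : {mpoly K[n]}^o).
  by rewrite mxE; apply: eq_bigr => k _; rewrite mxE.
have tw0 a : a \in tw -> (0 <= a)%R by have [_ _ _ H _] := ok => /H[].
have AP v p : v *m A = p%:M <-> (v *m A) 0 0 = p.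
  split=> [->|<-]; first by rewrite mxE eqxx.
  by apply/rowP => k; rewrite ord1 [RHS]mxE eqxx.
have I0 := gi0 gI.
have ID p q : I p -> I q -> I (p + q).
  by move=> Ip Iq; have := giB gI Ip (giB gI I0 Iq); rewrite sub0r opprK.
pose tws i := stw (stages tor_deg x0 i).
refine (inhabits (@MinGradedResolution K n I tws
  (fun i => stage_diff tor_deg x0 i) A _ _ _ _ _ _ _)).
- by exists B => i; apply: stage_finite.
- by move=> i j k; case: (stage_diffP tor_deg x0 i) => hD _ _; apply: hD.
- by move=> j; rewrite mxE; case: (Gg _ (ltn_ord j)).
- move=> p; split=> [Ip|[v /AP <-]].
    have Hd (d : 'I_(msize p)) : exists v : 'rV_(size tw), (v *m A) 0 0 = zcomp (d :
        nat)%:Z p.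
      have : ideal_deg I (d : nat)%:Z (zcomp (d : nat)%:Z p).
        by split; [exact: zhomog_zcomp|exact: gi_comp].
      by move=> /(mc_surj mc)[v _ <-]; exists v; rewrite AE.
    have /fin_all_exists[w Hw] := Hd.
    exists (\sum_d w d); apply/AP; rewrite mulmx_suml summxE.
    by rewrite [RHS](zcomp_partition (leqnn (msize p))); apply: eq_bigr => d _.
  have [D ->] := row_comp_partition v tw0.
  rewrite mulmx_suml summxE; elim/big_ind: _ => // d _.
  have dv : free_deg (d : nat)%:Z (row_comp (d : nat)%:Z v) by apply: free_deg_row_comp.
  by rewrite AE; case: (mc_deg mc dv).
- move=> v; have [hD' mc' _] := stage_diffP tor_deg x0 0.
  have hA : @homog_mx K n tw [:: 0] A.
    by move=> j k; rewrite ord1 subr0 mxE; case: (Gg _ (ltn_ord j)).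
  have AP0 (u : 'rV_(size tw)) : u *m A = 0 <-> (u *m A) 0 0 = 0.
    split=> [->|u0]; first by rewrite mxE.
    by apply/rowP => k; rewrite ord1 u0 mxE.
  split=> [v0|[w ->]].
    have [D vE] := row_comp_partition v tw0.
    have Hd (d : 'I_D) : exists w, row_comp (d : nat)%:Z v = w *m stage_diff tor_deg x0 0.
      have : @sdeg K n I 0 x0 (d : nat)%:Z (row_comp (d : nat)%:Z v).
        split; first exact: free_deg_row_comp.
        rewrite -AE -(@row_compM _ _ _ [:: 0] _ _ _ hA) v0 !mxE.
        by apply: zcomp_id; apply: zhomog0.
      by move=> /(mc_surj mc')[w _ <-]; exists w.
    have /fin_all_exists[w Hw] := Hd.
    exists (\sum_d w d); rewrite mulmx_suml {1}vE; apply: eq_bigr => d _.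
    exact: Hw.
  have [D {1}->] := row_comp_partition w (@stage_ge0 _ _ _ _ tor_deg x0 1).
  rewrite !mulmx_suml big1 // => d _.
  have dw : free_deg (d : nat)%:Z (row_comp (d : nat)%:Z w) by apply: free_deg_row_comp.
  by have [_ w0] := mc_deg mc' dw; apply/AP0; rewrite AE.
- by move=> i v; apply: stage_diff_exact.
- by move=> i j k; apply: stage_diff_minimal.
Qed.

(** * Heights *)

Section Heights.
Variables (K : fieldType) (n : nat).
Local Notation R := {mpoly K[n]}.
Implicit Types (s : {set 'I_n}) (P Q : {pred R}).

Definition kill_vars s (p : R) : R :=
  p \mPo [tuple (if i \in s then 0 else 'X_i) | i < n].

(** The ideal generated by the variables in [s], taken as the kernel of a ring morphism to a domain:
    it is then boolean, and primality is immediate. *)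
Definition var_ideal s : {pred R} := [pred p | kill_vars s p == 0].

Lemma kill_varsX s i : kill_vars s 'X_i = if i \in s then 0 else 'X_i.
Proof. by rewrite /kill_vars comp_mpolyXU -tnth_nth tnth_mktuple. Qed.

Lemma var_ideal_prime s : is_prime_ideal (var_ideal s).
Proof.
split; first split.
- by rewrite inE /kill_vars raddf0.
- by rewrite inE /kill_vars rmorph1 oner_eq0.
- move=> a p q; rewrite !inE /kill_vars => /eqP p0 /eqP q0.
  by rewrite rmorphD rmorphM /= p0 q0 mulr0 addr0.
- by move=> p q; rewrite !inE /kill_vars rmorphM /= mulf_eq0.
Qed.

Lemma kill_vars_mod s P (p : R) : is_prime_ideal P ->
  (forall i, i \in s -> 'X_i \in P) -> p - kill_vars s p \in P.
Proof.
move=> [[P0 _ PM] _] sP.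
have PD u v : u \in P -> v \in P -> u + v \in P.
  by move=> uP vP; rewrite -[u]mul1r; apply: PM.
have PMl a u : u \in P -> a * u \in P.
  by move=> uP; rewrite -[a * u]addr0; apply: PM.
have H u v : u - kill_vars s u \in P -> v - kill_vars s v \in P ->
    u * v - kill_vars s (u * v) \in P.
  move=> uP vP; rewrite /kill_vars rmorphM /= -!/(kill_vars s _).
  have -> : u * v - kill_vars s u * kill_vars s v =
    v * (u - kill_vars s u) + kill_vars s u * (v - kill_vars s v) by ring.
  by apply: PM => //; apply: PMl.
have H1 : 1 - kill_vars s 1 \in P by rewrite /kill_vars rmorph1 subrr.
have HX i : 'X_i - kill_vars s 'X_i \in P.
  by rewrite kill_varsX; case: ifP => [/sP|_]; rewrite ?subr0 ?subrr.
rewrite [p]mpolyE; apply: (big_ind (fun q => q - kill_vars s q \in P)).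
- by rewrite /kill_vars raddf0 subrr.
- move=> u v uP vP; rewrite /kill_vars raddfD /= -!/(kill_vars s _) opprD addrACA.
  exact: PD.
move=> m _; rewrite /kill_vars comp_mpolyZ -scalerBr -mul_mpolyC; apply: PMl.
rewrite -/(kill_vars s _) mpolyXE_id;
    apply: (big_ind (fun q => q - kill_vars s q \in P)) => // i _.
by elim: (m i) => [|k IH]; rewrite ?expr0 // exprS; apply: H.
Qed.

Lemma var_ideal_sub s P : is_prime_ideal P ->
  (forall i, i \in s -> 'X_i \in P) -> {subset var_ideal s <= P}.
Proof.
move=> pP sP p; rewrite inE => /eqP p0.
by have := kill_vars_mod p pP sP; rewrite p0 subr0.
Qed.

Lemma var_ideal_mono s (t : {set 'I_n}) : s \subset t ->
    {subset var_ideal s <= var_ideal t}.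
Proof.
move=> st; apply: var_ideal_sub; first exact: var_ideal_prime.
by move=> i /(subsetP st) it; rewrite inE kill_varsX it.
Qed.

Lemma var_ideal_proper s i : i \notin s -> proper_incl (var_ideal s) (var_ideal (i |: s)).
Proof.
move=> iNs; split; first by apply: var_ideal_mono; apply: subsetUr.
exists 'X_i; rewrite inE kill_varsX ?setU11 // (negbTE iNs).
by rewrite -msupp_eq0 msuppX.
Qed.

Lemma prime_chain_extend P Q m : is_prime_ideal Q -> proper_incl P Q ->
  has_prime_chain P m -> has_prime_chain Q m.+1.
Proof.
move=> pQ [PQ [x xQ xP]] [C [Cp Ci Cm]].
exists (fun i => if (i <= m)%N then C i else Q); split.
- by move=> i _; case: ifP => [/Cp|].
- move=> i; rewrite ltnS => im; rewrite im; case: ltnP => mi; first exact: Ci.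
  have -> : i = m by apply/eqP; rewrite eqn_leq im.
  split; first by move=> y; rewrite Cm; apply: PQ.
  by exists x; rewrite ?Cm.
- by move=> p; rewrite ltnn.
Qed.

Lemma eq_prime_chain P Q m : P =i Q -> has_prime_chain P m -> has_prime_chain Q m.
Proof. by move=> PQ [C [Cp Ci Cm]]; exists C; split=> // p; rewrite Cm. Qed.

Lemma var_ideal_extend s (t : {set 'I_n}) m : s \subset t ->
    has_prime_chain (var_ideal s) m ->
  has_prime_chain (var_ideal t) (m + #|t :\: s|).
Proof.
move cD: #|t :\: s| => k; elim: k t cD => [|k IH] t cD st ch.
  have -> : t = s by apply/eqP; rewrite eqEsubset st andbT -setD_eq0 -cards_eq0 cD.
  by rewrite addn0.
have /card_gt0P[i] : (0 < #|t :\: s|)%N by rewrite cD.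
rewrite inE => /andP[iNs it].
rewrite addnS -(setD1K it); apply: prime_chain_extend.
- exact: var_ideal_prime.
- by apply: var_ideal_proper; rewrite !inE eqxx.
- apply: IH => //; last by rewrite subsetD1 st.
  by have := cardsD1 i (t :\: s); rewrite inE iNs it cD setDDl setUC -setDDl => -[].
Qed.

Lemma var_ideal_chain s : has_prime_chain (var_ideal s) #|s|.
Proof.
have := @var_ideal_extend set0 s 0; rewrite setD0 add0n sub0set; apply=> //.
exists (fun=> var_ideal set0); split=> // i _; exact: var_ideal_prime.
Qed.

Definition indep_mod Q (T : finType) (u : T -> R) : Prop :=
  forall c : T -> K, \sum_t c t *: u t \in Q -> forall t, c t = 0.

(* Modulo [Q] a relation loses all terms but those with [f ^+ 0]; once these
   are gone, [f] can be divided out modulo [P]. *)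
Lemma indep_mod_step P Q (f : R) B (T : finType) (u : T -> R) :
  is_prime_ideal P -> {subset P <= Q} -> is_prime_ideal Q ->
  f \in Q -> f \notin P -> indep_mod Q u ->
  indep_mod P (fun x : 'I_B * T => f ^+ x.1 * u x.2).
Proof.
move=> [[P0 _ PM] Pp] PQ [[Q0 _ QM] _] fQ fP iu.
elim: B => [|B IH] c; first by move=> _ [[]].
move=> cP; have E : \sum_x c x *: (f ^+ x.1 * u x.2) =
    \sum_t c (ord0, t) *: u t + f * \sum_(x : 'I_B * T) c (fintype.lift ord0 x.1,
        x.2) *: (f ^+ x.1 * u x.2).
  transitivity (\sum_(x : 'I_B.+1 * T) c (x.1, x.2) *: (f ^+ x.1 * u x.2)).
    by apply: eq_bigr => -[].
  rewrite -(pair_bigA _ (fun (i : 'I_B.+1) t => c (i, t) *: (f ^+ i * u t))) /=.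
  rewrite big_ord_recl; congr (_ + _).
    by apply: eq_bigr => t _; rewrite expr0 mul1r.
  rewrite -(pair_bigA _ (fun (i : 'I_B) t => c (fintype.lift ord0 i, t) *: (f ^+ i *
      u t))) /=.
  rewrite mulr_sumr; apply: eq_bigr => i _; rewrite mulr_sumr; apply: eq_bigr => t _.
  by rewrite -scalerAr exprS mulrA.
set S := \sum_(x : 'I_B * T) _ in E.
have c0 : forall t, c (ord0, t) = 0.
  apply: iu; have cQ := PQ _ cP; rewrite E in cQ.
  have -> : \sum_t c (ord0, t) *: u t = - S * f + (\sum_t c (ord0, t) *: u t + f * S)
      by ring.
  exact: QM.
have SP : S \in P.
  move: cP; rewrite E big1 ?add0r => [|t _]; last by rewrite c0 scale0r.
  by move=> /Pp/orP[fP'|//]; rewrite fP' in fP.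
have cl := IH (fun x => c (fintype.lift ord0 x.1, x.2)) SP.
move=> [i t]; have [j ->|->] := unliftP ord0 i; last exact: c0.
exact: (cl (j, t)).
Qed.

Lemma msizeM_pred (p q : R) : (msize (p * q) <= (msize p + msize q).-1)%N.
Proof.
have [->|p0] := eqVneq p 0; first by rewrite mul0r msize0.
have [->|q0] := eqVneq q 0; first by rewrite mulr0 msize0.
by rewrite msizeM.
Qed.

(** The family consists of products of powers, with exponents below B, of the m witnesses of
    strictness. The constant e is the sum of their sizes and so does not depend on B. *)
Lemma chain_indep (C : nat -> {pred R}) m :
  (forall i, (i <= m)%N -> is_prime_ideal (C i)) ->
  (forall i, (i < m)%N -> proper_incl (C i) (C i.+1)) ->
  exists e : nat, forall B, exists (T : finType) (u : T -> R),
    [/\ indep_mod (C 0) u, #|T| = (B ^ m)%N & forall t, (msize (u t) <= e * B + 1)%N].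
Proof.
elim: m C => [|m IH] C Cp Ci.
  exists 0%N => B'; exists unit, (fun=> 1); split; rewrite ?card_unit ?msize1 //.
  have [[C0 C1 CM] _] := Cp 0%N isT.
  move=> c; rewrite (big_pred1 tt) => [|[]//] cC []; apply/eqP; apply: contraR C1 => nz.
  rewrite -[1](scale1r) -(mulVf nz) -scalerA -mul_mpolyC -[_ * _]addr0.
  exact: CM.
have [|i im|e He] := IH (fun i => C i.+1).
- by move=> i im; apply: Cp.
- by apply: Ci.
have [sub [f fQ fP]] := Ci 0%N isT.
exists (msize f + e)%N => B'; have [T [u [iu cT su]]] := He B'.
exists ('I_B' * T)%type, (fun x : 'I_B' * T => f ^+ x.1 * u x.2); split.
- by apply: (indep_mod_step (Q := C 1%N)) => //; apply: Cp.
- by rewrite card_prod card_ord cT expnS.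
- move=> [i t] /=.
  have f0 : (0 < msize f)%N.
    rewrite lt0n msize_poly_eq0; apply: contraNneq fP => ->.
    by have [[]] := Cp 0%N isT.
  have fi (j : nat) : (msize (f ^+ j) <= j * msize f + 1)%N.
    elim: j => [|j IHj]; first by rewrite expr0 msize1.
    by rewrite exprS; apply: leq_trans (msizeM_pred _ _) _; lia.
  have iB : (i * msize f + msize f <= B' * msize f)%N.
    by rewrite addnC -mulSn leq_mul2r ltn_ord orbT.
  apply: leq_trans (msizeM_pred _ _) _; have := fi i; have := su t; lia.
Qed.

Lemma indep_bound (C : {pred R}) (T : finType) (u : T -> R) D : 0 \in C ->
  indep_mod C u -> (forall t, (msize (u t) <= D)%N) -> (#|T| <= D ^ n)%N.
Proof.
move=> C0 iu uD.
have bd : (#|{: 'X_{1..n < D}}| <= D ^ n)%N.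
  case: D uD => [|D] uD.
    by rewrite eq_card0 // => m; have := bmdeg m.
  have -> : (D.+1 ^ n = #|{ffun 'I_n -> 'I_D.+1}|)%N by rewrite card_ffun !card_ord.
  pose F (m : 'X_{1..n < D.+1}) : {ffun 'I_n ->
      'I_D.+1} := [ffun i => inord ((m : 'X_{1..n}) i)].
  apply: (@leq_card _ _ F) => m m' /ffunP E; apply/val_inj/mnmP => i.
  have := congr1 val (E i); rewrite !ffunE /= !inordK //.
    by apply: leq_ltn_trans (bmdeg m'); rewrite mdegE (bigD1 i) //= leq_addr.
  by apply: leq_ltn_trans (bmdeg m); rewrite mdegE (bigD1 i) //= leq_addr.
apply: leq_trans bd; rewrite leqNgt; apply/negP => DT.
have [x x0 xA] := wide_kernel
  (\matrix_(i < #|T|, j < #|{: 'X_{1..n < D}}|) (u (enum_val i))@_(enum_val j :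
      'X_{1..n < D})) DT.
case/eqP: x0; apply/rowP => i; rewrite mxE -[i]enum_valK.
apply: (iu (fun t => x 0 (enum_rank t))).
suff -> : \sum_t x 0 (enum_rank t) *: u t = 0 by [].
apply/mpolyP => m; rewrite mcoeff0 raddf_sum /=.
have [mD|Dm] := ltnP (mdeg m) D; last first.
  rewrite big1 // => t _; rewrite mcoeffZ memN_msupp_eq0 ?mulr0 //.
  by apply: msize_mdeg_ge; apply: leq_trans Dm.
move/rowP/(_ (enum_rank (BMultinom mD))): xA; rewrite !mxE => xt; rewrite -[RHS]xt.
rewrite (reindex (@enum_val T predT)) /=; last exact/onW_bij/enum_val_bij.
by apply: eq_bigr => j _; rewrite mcoeffZ !mxE enum_valK enum_rankK.
Qed.

Lemma prime_chain_leq P m : has_prime_chain P m -> (m <= n)%N.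
Proof.
case=> C [Cp Ci _]; have [e He] := chain_indep Cp Ci.
rewrite leqNgt; apply/negP => nm.
(* Then B^n times (e + 1)^n is smaller than B^(n+1), contradicting the count of monomials when m >
   n. *)
pose B := ((e + 1) ^ n).+1.
have [T [u [iu cT su]]] := He B; have [[C0 _ _] _] := Cp 0%N isT.
have := indep_bound C0 iu su; rewrite cT leqNgt => /negP; apply.
have mono a b k : (a <= b -> a ^ k <= b ^ k)%N by case: k => // k; rewrite leq_exp2r.
have eB : (e * B + 1 <= (e + 1) * B)%N by rewrite mulnDl mul1n leq_add2l.
apply: leq_ltn_trans (_ : ((e + 1) * B) ^ n < _)%N; first exact: mono.
rewrite expnMn; apply: (@leq_trans (B ^ n.+1)%N); last by rewrite leq_pexp2l.
by rewrite expnS ltn_pmul2r ?expn_gt0.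
Qed.

(** A chain ending here extends by n - [#|s|] steps to the ideal of all variables, and no chain is
    longer than n. *)
Lemma var_ideal_height s : prime_height (var_ideal s) #|s|.
Proof.
split; first exact: var_ideal_chain.
move=> m /(var_ideal_extend (subsetT s))/prime_chain_leq.
have := cardsC s; rewrite setTD card_ord; lia.
Qed.

Definition vars_in P : {set 'I_n} := [set i | ('X_i : R) \in P].

Lemma prime_vars_chain P : is_prime_ideal P ->
  exists2 m, has_prime_chain P m & (#|vars_in P| <= m)%N.
Proof.
move=> pP; set s := vars_in P.
have sub : {subset var_ideal s <= P}.
  by apply: var_ideal_sub => // i; rewrite inE.
have [PV|] := classic ({subset P <= var_ideal s}).
  exists #|s| => //; apply: (eq_prime_chain (P := var_ideal s));
      last exact: var_ideal_chain.
  by move=> p; apply/idP/idP; [exact: sub|exact: PV].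
move=> H; have [x H'] := not_all_ex_not _ _ H; have [xP xs] := imply_to_and _ _ H'.
exists #|s|.+1 => //; apply: prime_chain_extend (var_ideal_chain s) => //.
by split=> //; exists x => //; apply/negP.
Qed.

Lemma stanley_reisner_var (Delta : {set {set 'I_n}}) s :
  ~: s \in Delta -> simplicial_complex Delta ->
  forall p : R, stanley_reisner Delta p -> p \in var_ideal s.
Proof.
move=> sD cD p [c ->]; rewrite inE /kill_vars raddf_sum /= big1 // => t tD.
rewrite rmorphM rmorph_prod /=.
have [i it iS] : exists2 i, i \in t & i \in s.
  have : ~~ (t \subset ~: s) by apply: contra tD => ts; apply: cD sD ts.
  by case/subsetPn => i it; rewrite inE negbK; exists i.
have kX := kill_varsX s i; rewrite iS /kill_vars in kX.
by rewrite (bigD1 i) // kX /= mul0r mulr0.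
Qed.

Lemma stanley_reisner_prime_face (Delta : {set {set 'I_n}}) P : is_prime_ideal P ->
  (forall p : R, stanley_reisner Delta p -> p \in P) ->
  ~: vars_in P \in Delta.
Proof.
move=> [[P0 P1 PM] Pp] IP; set s := vars_in P; apply: contraT => sD.
have : \prod_(i in ~: s) 'X_i \in P.
  apply: IP; exists (fun t => if t == ~: s then 1 else 0).
  rewrite (bigD1 (~: s)) //= eqxx mul1r [X in _ + X]big1 ?addr0 // => t /andP[_
      /negbTE ->].
  by rewrite mul0r.
apply: contraLR => _; apply: (big_ind (fun p => p \notin P)) => //.
- by move=> p q pP qP; apply/negP => /Pp/orP[]; apply/negP.
- by move=> i; rewrite !inE.
Qed.

(** The variables outside a prime containing the ideal form a face, and conversely the variables
    outside a face generate such a prime. Hence ideals of variables suffice to test the height. *)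
Lemma ideal_heightP (Delta : {set {set 'I_n}}) h : simplicial_complex Delta ->
  ideal_height (@stanley_reisner K n Delta) h <->
  (exists2 s, s \in Delta & (#|s| + h = n)%N) /\ (forall s, s \in Delta ->
      (#|s| + h <= n)%N).
Proof.
move=> cD; have cC s : (#|s| + #|~: s| = n)%N by rewrite cardsC card_ord.
split=> [[[P [pP IP hP]] minP]|[[s sD sh] Dh]].
  have bd s : s \in Delta -> (#|s| + h <= n)%N.
    move=> sD; have hs : (h <= #|~: s|)%N; last by have := cC s; lia.
    apply: (minP (var_ideal (~: s))); [exact: var_ideal_prime| |exact: var_ideal_height].
    by apply: stanley_reisner_var => //; rewrite setCK.
  split=> //; have fD := stanley_reisner_prime_face pP IP.
  exists (~: vars_in P) => //; apply/eqP; rewrite eqn_leq bd //=.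
  have [m chm lem] := prime_vars_chain pP; have := leq_trans lem (proj2 hP m chm).
  have := cC (vars_in P).
  by move: #|vars_in P| #|~: vars_in P| => a b; lia.
split.
  exists (var_ideal (~: s)); split; first exact: var_ideal_prime.
    by apply: stanley_reisner_var => //; rewrite setCK.
  have -> : h = #|~: s| by have := cC s; lia.
  exact: var_ideal_height.
move=> P m pP IP hP; have fD := Dh _ (stanley_reisner_prime_face pP IP).
have [m' chm lem] := prime_vars_chain pP; have := leq_trans lem (proj2 hP m' chm).
by have := cC (vars_in P); move: #|vars_in P| #|~: vars_in P| fD => a b; lia.
Qed.

End Heights.

(** * Betti diagrams *)

Section BettiPolynomial.
Variable n : nat.
Local Notation V := (betti_space n).
Implicit Types (beta : V) (i : 'I_n.+1) (d : int).

(** Cutting off outside degrees 0 to n gives a linear map on the whole space and loses nothing on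
    diagrams of proper squarefree ideals. *)
Definition betti_poly beta : {poly rat} :=
  \sum_(i < n.+1) \sum_(e < n.+1) ((-1) ^+ i * coeff (i, (e : nat)%:Z) beta) *: 'X^e.

Lemma betti_polyD beta beta' : betti_poly (beta + beta') = betti_poly beta +
    betti_poly beta'.
Proof.
rewrite -big_split; apply: eq_bigr => i _; rewrite -big_split; apply: eq_bigr => e _.
by rewrite coeffD mulrDr scalerDl.
Qed.

Lemma coeff_scale x c beta : coeff x (c *: beta) = c * coeff x beta :> rat.
Proof. by rewrite coeffZ. Qed.

Lemma betti_polyZ c beta : betti_poly (c *: beta) = c *: betti_poly beta.
Proof.
rewrite scaler_sumr; apply: eq_bigr => i _; rewrite scaler_sumr; apply: eq_bigr => e _.
by rewrite coeff_scale mulrCA scalerA.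
Qed.

Lemma betti_poly0 : betti_poly 0 = 0.
Proof. by rewrite -(scale0r 0) betti_polyZ scale0r. Qed.

Lemma coeff_sum_scale (T : finType) (c : T -> rat) (u : T -> V) x :
  coeff x (\sum_t c t *: u t) = \sum_t c t * coeff x (u t).
Proof. by rewrite raddf_sum; apply: eq_bigr => t _; rewrite /= coeff_scale. Qed.

Lemma coef_betti_poly beta (e : nat) : (e < n.+1)%N ->
  (betti_poly beta)`_e = \sum_(i < n.+1) (-1) ^+ i * coeff (i, e%:Z) beta.
Proof.
move=> en; rewrite coef_sum; apply: eq_bigr => i _; rewrite coef_sum.
rewrite (bigD1 (Ordinal en)) //= coefZ coefXn eqxx mulr1 big1 ?addr0 // => d.
by rewrite -val_eqE /= eq_sym coefZ coefXn => /negbTE ->; rewrite mulr0.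
Qed.

Lemma betti_ext beta beta' : (forall i d, coeff (i, d) beta = coeff (i, d) beta') ->
    beta = beta'.
Proof. by move=> H; apply/eqP/freeg_eqP => -[i d]. Qed.

Lemma betti_diagram_exists (K : fieldType) (I : {mpoly K[n]} -> Prop) :
  min_graded_resolution I -> exists beta, is_betti_diagram I beta.
Proof.
move=> F; exists (\sum_(i < n.+1) \sum_(a <- twists F i) << (i, a) >>); exists F => i d.
rewrite raddf_sum (bigD1 i) //= [X in _ + X]big1 ?addr0 => [|j ji].
  rewrite raddf_sum -sum1_count natr_sum [RHS]big_mkcond /=; apply: eq_bigr => a _.
  by rewrite coeffU mul1r xpair_eqE eqxx; case: eqP.
rewrite raddf_sum big1 // => a _ /=.
by rewrite coeffU xpair_eqE (negbTE ji) mulr0.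
Qed.

End BettiPolynomial.

(** * Support and polynomial of the diagram of a complex *)

Section Profile.
Variables (K : fieldType) (n : nat) (Delta : {set {set 'I_n}}) (beta : betti_space n).
Hypotheses (cD : simplicial_complex Delta) (D0 : set0 \in Delta)
  (bD : is_betti_diagram (@stanley_reisner K n Delta) beta).
Local Notation N := (nonface Delta).

Lemma sr_graded_ideal : graded_ideal (@stanley_reisner K n Delta).
Proof.
have [I0 IB IM IC] := mon_ideal_graded K (upset_nonface cD).
have E := @stanley_reisnerE K n Delta _ cD.
split.
- exact/E.
- by move=> p q /E Ip /E Iq; apply/E/IB.
- by move=> p q /E Iq; apply/E/IM.
- by move=> d p /E Ip; apply/E/IC.
Qed.

Lemma sr_tor i d : tor_vanish (ideal_deg (@stanley_reisner K n Delta)) i d <->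
  mon_tor_vanish K N i d.
Proof.
apply: eq_koszul_exact => e u; have E := @stanley_reisnerE K n Delta u cD.
by split=> -[hu /E Iu].
Qed.

Lemma nonface_card (s : {set 'I_n}) : N s -> (1 <= #|s|)%N.
Proof. by rewrite lt0n cards_eq0; apply: contraTneq => ->; rewrite /nonface D0. Qed.

Lemma nonface_tor_large i (d : int) : (n%:Z < d)%R -> mon_tor_vanish K N i d.
Proof.
move=> nd; apply: (@mon_tor_support K n setT) => //; first exact: upset_nonface.
  by move=> s; rewrite setIT.
by rewrite cardsT card_ord.
Qed.

Lemma nonface_tor_small i (d : int) : (d < i%:Z + 1)%R -> mon_tor_vanish K N i d.
Proof. by apply: mon_tor_low => //; [exact: upset_nonface|exact: nonface_card]. Qed.

Lemma coeff_twist (i : 'I_n.+1) d : coeff (i, d) beta != 0 <-> ~ mon_tor_vanish K N i d.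
Proof.
case: bD => F bF; rewrite bF pnatr_eq0 -lt0n -has_count has_pred1.
have [H1 H2] := resolution_twists F sr_graded_ideal i d.
split=> [/H1 H /sr_tor //|H]; apply/negPn/negP => /H2 /sr_tor; exact: H.
Qed.

Lemma betti_poly_hilb q : mon_hilb K N q -> betti_poly beta = 1 - q.
Proof.
case: bD => F bF hq.
(* All twists lie between 0 and n and stop after homological degree n, so the truncated diagram sees
   the entire resolution. *)
have tw i a : a \in twists F i -> (0 <= a <= n%:Z)%R.
  move=> ai; have [/(_ ai) H _] := resolution_twists F sr_graded_ideal i a.
  apply/andP; split; rewrite leNgt; apply/negP => Ha; apply/H/sr_tor.
    by apply: nonface_tor_small; lia.
  exact: nonface_tor_large.
have tw0 i : (n < i)%N -> twists F i = [::].
  move=> ni; case E: (twists F i) => [//|a s]; exfalso.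
  have ai : a \in twists F i by rewrite E mem_head.
  have [/(_ ai) H _] := resolution_twists F sr_graded_ideal i a; apply/H/sr_tor.
  by apply: nonface_tor_small; have := tw i a ai; lia.
have tw1 i a : a \in twists F i -> (0 <= a)%R by move=> /tw/andP[].
have H1 := resolution_hilb sr_graded_ideal tw1 tw0.
apply: (has_hilb_inj (K := K) (P := ideal_deg (@stanley_reisner K n Delta))); last first.
  move=> e; have [M hM eM] := hq e; exists M => //; apply: eq_has_dim hM => p.
  have E := @stanley_reisnerE K n Delta p cD.
  by split=> -[hp /E Ip].
suff -> : betti_poly beta = \sum_(j < n.+1) (-1) ^+ j *: twist_poly F j by [].
apply: eq_bigr => i _; rewrite /twist_poly scaler_sumr.
under eq_bigr do rewrite bF.
have := tw i; elim: (twists F i) => [|a s IH] sP.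
  by rewrite big_nil big1 // => e _; rewrite mulr0 scale0r.
rewrite big_cons -IH => [|b bs]; last by apply: sP; rewrite in_cons bs orbT.
have /andP[a0 an] := sP a (mem_head _ _).
have [a' aE] : exists a' : nat, a = a' by exists (absz a); rewrite gez0_abs.
have a'n : (a' < n.+1)%N by rewrite ltnS -lez_nat -aE.
rewrite aE /= [RHS]addrC.
transitivity (\sum_(e < n.+1) (((-1) ^+ i * (count_mem (e : nat)%:Z s)%:R) *: 'X^e +
    (if (e : nat) == a' then (-1) ^+ i *: 'X^a' else 0)) : {poly rat}).
  apply: eq_bigr => e _; rewrite eqz_nat natrD mulrDr scalerDl addrC; congr (_ + _).
  by rewrite eq_sym; case: eqP => [->|_]; rewrite ?mulr1 // mulr0 scale0r.
rewrite big_split /=; congr (_ + _).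
by rewrite (bigD1 (Ordinal a'n)) //= eqxx big1 ?addr0 // => e;
    rewrite -val_eqE /= => /negbTE ->.
Qed.

End Profile.

(** * Constraints on diagrams of given height *)

Section Diagrams.
Variables (K : fieldType) (n : nat).
Local Notation V := (betti_space n).

Implicit Types N : pred {set 'I_n}.

Definition sr_diagram h (beta : V) : Prop :=
  exists Delta : {set {set 'I_n}},
    [/\ simplicial_complex Delta,
        ideal_height (@stanley_reisner K n Delta) h
      & is_betti_diagram (@stanley_reisner K n Delta) beta].

(** The bounds reflect squarefree degrees, faces of at most n - h vertices, and at most h variables
    in an ideal of height h. *)
Definition betti_region h (i : nat) (d : int) : bool :=
  ((d <= n%:Z) && (i%:Z + 1 < d <= i%:Z + (n - h).+1%:Z) || (d == i%:Z + 1) && (i <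
      h)%N)%R.

(** For the diagram of an ideal the value at 1 is 1, and the difference is the numerator of the
    quotient ring. Using the value in place of the constant makes the condition linear. It amounts
    to the Herzog-Kühl equations: vanishing of derivatives at 1. *)
Definition herzog_kuhl h (beta : V) : Prop :=
  (('X - 1) ^+ h %| ((betti_poly beta).[1])%:P - betti_poly beta)%R.

Lemma depends_setT (N : pred {set 'I_n}) : depends_on setT N.
Proof. by move=> s; rewrite setIT. Qed.

Lemma mon_hilb_height N h : upset N -> (forall s, ~~ N s -> (#|s| + h <= n)%N) ->
  exists2 q, mon_hilb K N q & (('X - 1) ^+ h %| q)%R.
Proof.
move=> uN Nh; apply: (@mon_hilb_dvd K n setT) => //; first exact: depends_setT.
by move=> s _ /Nh; rewrite cardsT card_ord.
Qed.

Lemma root1_of_dvd h (q : {poly rat}) : (0 < h)%N -> (('X - 1) ^+ h %| q)%R -> q.[1] = 0.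
Proof.
case: h => // h _ /dvdpP[r ->].
have X1 : ('X - 1 : {poly rat}).[1] = 0 by rewrite !hornerE subrr.
by rewrite exprS !hornerM X1 mul0r mulr0.
Qed.

Lemma herzog_kuhl_hilb h beta q : (0 < h)%N -> betti_poly beta = 1 - q ->
  (('X - 1) ^+ h %| q)%R -> (betti_poly beta).[1] = 1 /\ herzog_kuhl h beta.
Proof.
move=> h0 bq dq; have q1 := root1_of_dvd h0 dq.
have b1 : (betti_poly beta).[1] = 1 by rewrite bq !hornerE q1 subr0.
by split=> //; rewrite /herzog_kuhl b1 bq polyC1 subKr.
Qed.

Lemma sr_diagramP h beta : (0 < h)%N -> (h < n)%N -> sr_diagram h beta ->
  (forall (i : 'I_n.+1) d, coeff (i, d) beta != 0 -> betti_region h i d) /\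
  herzog_kuhl h beta.
Proof.
move=> h0 hn [Delta [cD /(ideal_heightP _ _ cD)[[s0 s0D s0h] Dh] bD]].
have D0 : set0 \in Delta by apply: cD s0D (sub0set _).
have uN := upset_nonface cD.
have Nh s : ~~ nonface Delta s -> (#|s| + h <= n)%N by rewrite negbK; apply: Dh.
split; last first.
  have [q hq dq] := mon_hilb_height uN Nh.
  exact: proj2 (herzog_kuhl_hilb h0 (betti_poly_hilb cD D0 bD hq) dq).
move=> i d /(coeff_twist cD bD) nt; apply: contraT => nreg; case: nt.
have [nd|dn] := ltP n%:Z d; first exact: nonface_tor_large.
have [di|id] := ltP d (i%:Z + 1); first exact: nonface_tor_small.
have [large|small] := ltP (i%:Z + (n - h).+1%:Z) d.
  apply: (@mon_tor_reg K n setT _ (n - h).+1) => //; first exact: depends_setT.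
  by move=> s _ /Nh; lia.
have [dE hi] : d = i%:Z + 1 /\ (h <= i)%N by move: nreg; rewrite /betti_region; lia.
(* The variables in the ideal avoid every face, in particular [s0] of size n - h, so there are at
   most h. *)
pose Z := [set z | [set z] \notin Delta].
have Zh : (#|Z| <= h)%N.
  have : Z \subset ~: s0.
    apply/subsetP => z; rewrite !inE; apply: contra => zs.
    by apply: cD s0D _; rewrite sub1set.
  move=> /subset_leq_card; have := cardsC s0; rewrite card_ord; lia.
apply: (@mon_tor_linear K n _ Z 2) => //; last 2 first.
- by rewrite dE; lia.
- by apply/implyP => _; apply: leq_trans hi.
- by move=> z; rewrite inE.
move=> s Ns; have [s2|s1] := ltnP 1 #|s|; first by rewrite orbT.
have /cards1P[z sz] : #|s| == 1%N by rewrite eqn_leq s1 (nonface_card D0 Ns).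
apply/orP; left; apply/set0Pn; exists z; rewrite !inE sz set11 /=.
by move: Ns; rewrite /nonface sz.
Qed.

Lemma upset_sr_diagram N h : (0 < h)%N -> upset N -> ~~ N set0 ->
  (exists2 s : {set 'I_n}, ~~ N s & (#|s| + h = n)%N) ->
  (forall s, ~~ N s -> (#|s| + h <= n)%N) ->
  exists beta, [/\ sr_diagram h beta,
    forall (i : 'I_n.+1) d, coeff (i, d) beta != 0 <-> ~ mon_tor_vanish K N i d,
    (betti_poly beta).[1] = 1, herzog_kuhl h beta &
    forall q, mon_hilb K N q -> betti_poly beta = 1 - q].
Proof.
move=> h0 uN N0 [s0 Ns0 s0h] Nh.
pose Delta := [set s | ~~ N s].
have cD : simplicial_complex Delta.
  by move=> s t; rewrite !inE => Ns ts; apply: contra Ns; apply: uN.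
have D0 : set0 \in Delta by rewrite inE.
have NE : nonface Delta =1 N by move=> s; rewrite /nonface inE negbK.
have gI := @sr_graded_ideal K n _ cD.
have [F] : inhabited (min_graded_resolution (@stanley_reisner K n Delta)).
  apply: (@min_resolution_exists K n _ n gI) => i d Hn.
    by apply/(sr_tor K cD); apply: nonface_tor_large.
  apply/(sr_tor K cD); have [nd|dn] := ltP n%:Z d; first exact: nonface_tor_large.
  by apply: nonface_tor_small => //; lia.
have [beta bD] := betti_diagram_exists F.
have hq q : mon_hilb K N q -> betti_poly beta = 1 - q.
  move=> hq; apply: (betti_poly_hilb cD D0 bD); apply: eq_mon_hilb hq => s.
  by rewrite NE.
have [q mq dq] := mon_hilb_height uN Nh.
have [b1 hk] := herzog_kuhl_hilb h0 (hq q mq) dq.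
exists beta; split=> //.
  exists Delta; split=> //; apply/ideal_heightP => //; split.
    by exists s0; rewrite ?inE.
  by move=> s; rewrite inE; apply: Nh.
move=> i d; have E k e : mon_tor_vanish K (nonface Delta) k e <-> mon_tor_vanish K N k e.
  by split; apply: eq_mon_tor => s; rewrite NE.
by split=> [/(coeff_twist cD bD) H /E //|H]; apply/(coeff_twist cD bD) => /E.
Qed.

Definition ord_range a b : {set 'I_n} := [set i : 'I_n | (a <= i < b)%N].

Lemma card_ord_range a b : (b <= n)%N -> #|ord_range a b| = (b - a)%N.
Proof.
elim: b => [|b IH] bn.
  by rewrite sub0n; apply/eqP; rewrite cards_eq0; apply/eqP/setP => i; rewrite !inE; lia.
have [ab|ba] := leqP a b; last first.
  rewrite (_ : (b.+1 - a)%N = 0%N); last by lia.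
  by apply/eqP; rewrite cards_eq0; apply/eqP/setP => i; rewrite !inE; lia.
have -> : ord_range a b.+1 = Ordinal bn |: ord_range a b.
  by apply/setP => i; rewrite !inE -val_eqE /=; lia.
by rewrite cardsU1 IH ?inE /=; lia.
Qed.

End Diagrams.

(** * Two families of ideals *)

Section Families.
Variables (K : fieldType) (n h : nat).
Hypotheses (h_gt0 : (0 < h)%N) (h_lt_n : (h < n)%N).
Local Notation V := (betti_space n).
Implicit Types (s Z W S Y : {set 'I_n}).

Definition meets Z : pred {set 'I_n} := fun s => s :&: Z != set0.

Lemma meetsS Z s s' : s \subset s' -> meets Z s -> meets Z s'.
Proof.
move=> ss /set0Pn[i]; rewrite inE => /andP[/(subsetP ss) is' iZ].
by apply/set0Pn; exists i; rewrite inE is'.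
Qed.

Lemma meets0 Z : meets Z set0 = false.
Proof. by rewrite /meets set0I eqxx. Qed.

Lemma meets1 Z (i : 'I_n) : i \in Z -> meets Z [set i].
Proof. by move=> iZ; apply/set0Pn; exists i; rewrite !inE eqxx. Qed.

Lemma not_meets Z s : ~~ meets Z s -> s \subset ~: Z.
Proof.
rewrite negbK => /eqP sZ; apply/subsetP => i si; rewrite inE; apply/negP => iZ.
have : i \in s :&: Z by rewrite inE si.
by rewrite sZ inE.
Qed.

Lemma meetsI (U : {set 'I_n}) Z s : Z \subset U -> meets Z (s :&: U) = meets Z s.
Proof. by move=> ZU; rewrite /meets -setIA (setIidPr ZU). Qed.

Section Veronese.
Variables Z W : {set 'I_n}.
Variable c : nat.
Hypotheses (c_gt0 : (0 < c)%N) (ZW : [disjoint Z & W]).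

(* The variables in [Z] and the squarefree monomials of degree [c] on [W]. *)
Definition veronese : pred {set 'I_n} := fun s => meets Z s || (c <= #|s :&: W|)%N.

Lemma upset_veronese : upset veronese.
Proof.
move=> s s' ss /orP[/(meetsS ss) H|H]; apply/orP; [by left|right].
by apply: leq_trans H _; apply/subset_leq_card/setSI.
Qed.

Lemma veronese0 : ~~ veronese set0.
Proof. by rewrite /veronese meets0 set0I cards0 -ltnNge. Qed.

Lemma veronese_face s : ~~ veronese s -> (#|s| <= c.-1 + (n - #|Z| - #|W|))%N.
Proof.
rewrite negb_or -ltnNge => /andP[/not_meets sZ sW].
have -> : s = (s :&: W) :|: (s :\: W) by rewrite setID.
apply: leq_trans (leq_card_setU _ _) _; apply: leq_add; first by lia.
have : s :\: W \subset ~: (Z :|: W).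
  by rewrite setCU subsetI (subset_trans (subsetDl _ _) sZ) setDE subsetIr.
move=> /subset_leq_card; have := cardsC (Z :|: W); rewrite card_ord.
by have := leq_card_setU Z W; rewrite ZW => -[_ /eqP ->]; lia.
Qed.

Lemma veronese_tor (k : nat) (d : int) :
  ~~ [&& (d <= (#|Z| + #|W|)%N%:Z)%R &
      ((d == k%:Z + 1) && (k < #|Z|)%N) || (d == k%:Z + c%:Z)] ->
  mon_tor_vanish K veronese k d.
Proof.
have uN := upset_veronese.
have cV : #|Z :|: W| = (#|Z| + #|W|)%N.
  by have := leq_card_setU Z W; rewrite ZW => -[_ /eqP].
have dV : depends_on (Z :|: W) veronese.
  move=> s; rewrite /veronese meetsI ?subsetUl // -setIA (setIidPr (subsetUr Z W)) //.
have [Vd|dV'] := ltP (#|Z| + #|W|)%N%:Z d.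
  by move=> _; apply: (@mon_tor_support K n _ _ k d uN dV); rewrite cV.
have [dc _|cd] := ltP (k%:Z + c%:Z) d.
  apply: (@mon_tor_reg K n (Z :|: W) _ c) => // s sV.
  rewrite negb_or -ltnNge => /andP[/not_meets sZ]; rewrite (setIidPl _) //.
  apply/subsetP => i si; have := subsetP sV i si; rewrite inE => /orP[iZ|//].
  by have := subsetP sZ i si; rewrite inE iZ.
move=> Hd; have [E|dk] := eqVneq d (k%:Z + c%:Z); first by move: Hd; rewrite E; lia.
apply: (@mon_tor_linear K n _ Z c) => //.
- by move=> i iZ; rewrite /veronese meets1.
- move=> s /orP[H|H]; apply/orP; [by left|right].
  by apply: leq_trans H _; apply/subset_leq_card/subsetIl.
- by lia.
- by apply/implyP => dk1; lia.
Qed.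

Lemma veronese_linear_neq0 : (0 < #|Z|)%N ->
  ~ mon_tor_vanish K veronese #|Z|.-1 #|Z|%:Z.
Proof.
apply: mon_tor_linear_neq0; [exact: upset_veronese|exact: veronese0|].
by move=> i iZ; rewrite /veronese meets1.
Qed.

End Veronese.

Lemma disjoint_ord_range a b c : [disjoint ord_range n a b & ord_range n b c].
Proof.
rewrite disjoint_subset; apply/subsetP => i; rewrite !inE; lia.
Qed.

Lemma veronese_diagram c j : (1 < c)%N -> (h + c <= n.+1)%N -> (j <= h)%N ->
  exists beta, [/\ sr_diagram K h beta,
    forall (i : 'I_n.+1) d, coeff (i, d) beta != 0 ->
      ((d == i%:Z + 1) && (i < j)%N) || ((d == i%:Z + c%:Z) && (i < h)%N),
    forall i : 'I_n.+1, i.+1 = j -> coeff (i, j%:Z) beta != 0,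
    (betti_poly beta).[1] = 1 & herzog_kuhl h beta].
Proof.
(* On h + c - 1 - j variables the squarefree monomials of degree c generate an ideal of height h -
   j, which the j variables of [Z] raise to h. *)
move=> c1 hc jh; pose Z := ord_range n 0 j; pose W := ord_range n j (h + c).-1.
have cZ : #|Z| = j by rewrite card_ord_range ?subn0 //; lia.
have cW : #|W| = ((h + c).-1 - j)%N by rewrite card_ord_range //; lia.
have ZW : [disjoint Z & W] := disjoint_ord_range _ _ _.
have [|s|beta [sr bP b1 bh _]] :=
    @upset_sr_diagram K n _ h h_gt0 (@upset_veronese Z W c) (veronese0 _ _ (ltnW c1)).
(* This face takes c - 1 elements of [W] and all variables outside [Z] and [W], n - h in total. *)
- exists (ord_range n j (j + c).-1 :|: ord_range n (h + c).-1 n).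
    rewrite negb_or -ltnNge; apply/andP; split.
      by rewrite negbK; apply/eqP/setP => i; rewrite !inE; lia.
    apply: (@leq_ltn_trans #|ord_range n j (j + c).-1|).
      by apply/subset_leq_card/subsetP => i; rewrite !inE; have := ltn_ord i; lia.
    by rewrite card_ord_range; lia.
  have := leq_card_setU (ord_range n j (j + c).-1) (ord_range n (h + c).-1 n).
  have -> : [disjoint ord_range n j (j + c).-1 & ord_range n (h + c).-1 n].
    by rewrite disjoint_subset; apply/subsetP => i; rewrite !inE; lia.
  by move=> [_ /eqP ->]; rewrite !card_ord_range //; lia.
- by move=> /(veronese_face (ltnW c1) ZW); rewrite cZ cW; lia.
exists beta; split=> // [i d|i ij].
  move=> /bP nt; apply: contraT => H; case: nt; apply: (veronese_tor (ltnW c1) ZW).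
  by rewrite cZ cW; lia.
apply/bP; have := @veronese_linear_neq0 Z W c (ltnW c1).
by rewrite cZ -ij; apply.
Qed.

Lemma linear_diagram :
  exists beta, [/\ sr_diagram K h beta,
    forall (i : 'I_n.+1) d, coeff (i, d) beta != 0 -> d = i%:Z + 1 &
    forall i : 'I_n.+1, i.+1 = h -> coeff (i, h%:Z) beta != 0].
Proof.
pose Z := ord_range n 0 h; have cZ : #|Z| = h by rewrite card_ord_range ?subn0 //; lia.
have ZW : [disjoint Z & set0] by rewrite disjoint_sym disjoints_subset sub0set.
(* With [W] empty and c = n + 1 only the variables of [Z] generate, and row c lies beyond the degree
   bound h. *)
have [|s|beta [sr bP _ _ _]] :=
    @upset_sr_diagram K n _ h h_gt0 (@upset_veronese Z set0 n.+1) (veronese0 _ _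
        (ltn0Sn n)).
- exists (ord_range n h n); last by rewrite card_ord_range //; lia.
  rewrite negb_or setI0 cards0 andbT negbK.
  by apply/eqP/setP => i; rewrite !inE; lia.
- rewrite negb_or => /andP[/not_meets/subset_leq_card sZ _].
  by have := cardsC Z; rewrite card_ord; lia.
exists beta; split=> // [i d|i ih].
  move=> /bP nt; apply/eqP; apply: contraT => H; case: nt;
      apply: (veronese_tor _ ZW) => //.
  by rewrite cZ cards0; lia.
apply/bP; have := @veronese_linear_neq0 Z set0 n.+1 (ltn0Sn n).
by rewrite cZ -ih; apply.
Qed.

Section Cone.
Variables Z S Y : {set 'I_n}.
Hypotheses (SZ : [disjoint S & Z]) (SY : [disjoint S & Y]) (ZY : [disjoint Z & Y]).

(* The variables in [Z] and the products of the monomial on [S] with a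
   variable in [Y]. *)
Definition cone_set : pred {set 'I_n} := fun s => meets Z s || (S \subset s) && meets Y s.

Lemma upset_cone_set : upset cone_set.
Proof.
move=> s s' ss /orP[/(meetsS ss) H|/andP[Ss /(meetsS ss) H]]; apply/orP; [by left|right].
by rewrite H (subset_trans Ss ss).
Qed.

Lemma cone_set0 : ~~ cone_set set0.
Proof. by rewrite /cone_set !meets0 andbF. Qed.

(** A face avoids [Z] and, besides, either some variable of [S] or all of the nonempty [Y]. *)
Lemma cone_face s : (0 < #|S|)%N -> (0 < #|Y|)%N -> ~~ cone_set s ->
    (#|s| + #|Z|.+1 <= n)%N.
Proof.
move=> /card_gt0P[x xS] /card_gt0P[y yY]; rewrite negb_or => /andP[/not_meets sZ H].
have [i iZ si] : exists2 i, i \notin Z & i \notin s.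
  move: H; rewrite negb_and => /orP[/subsetPn[i iS si]|/not_meets sY].
    by exists i => //; rewrite (disjointFr SZ).
  exists y; first by rewrite (disjointFl ZY).
  by apply/negP => /(subsetP sY); rewrite inE yY.
have : s \subset ~: (i |: Z).
  apply/subsetP => k ks; rewrite !inE negb_or.
  have := subsetP sZ k ks; rewrite inE => ->; rewrite andbT.
  by apply: contraNneq si => <-.
move=> /subset_leq_card; have := cardsC (i |: Z); rewrite card_ord cardsU1 iZ; lia.
Qed.

Lemma cone_tor (k : nat) (d : int) :
  ~~ [&& (d <= (#|Z| + #|S| + #|Y|)%N%:Z)%R &
      ((d == k%:Z + 1) && (k < #|Z|)%N) || (d == k%:Z + #|S|.+1%:Z)] ->
  mon_tor_vanish K cone_set k d.
Proof.
have uN := upset_cone_set.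
have cV : #|Z :|: S :|: Y| = (#|Z| + #|S| + #|Y|)%N.
  have := leq_card_setU (Z :|: S) Y; have := leq_card_setU Z S.
  have -> : [disjoint Z & S] by rewrite disjoint_sym.
  move=> [_ /eqP <-].
  have -> : [disjoint Z :|: S & Y] by rewrite -setI_eq0 setIUl setU_eq0 !setI_eq0 ZY SY.
  by case=> _ /eqP.
have dV : depends_on (Z :|: S :|: Y) cone_set.
  move=> s; rewrite /cone_set !meetsI ?subsetUr // -?setUA ?subsetUl //.
  by rewrite subsetI [S \subset Z :|: _]subsetU ?subsetUl ?orbT ?andbT.
have [Vd|dV'] := ltP (#|Z| + #|S| + #|Y|)%N%:Z d.
  by move=> _; apply: (@mon_tor_support K n _ _ k d uN dV); rewrite cV.
have [dc _|cd] := ltP (k%:Z + #|S|.+1%:Z) d.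
  by apply: (@mon_tor_cone_reg K n _ Z S Y) => //; lia.
move=> Hd; have [E|dk] := eqVneq d (k%:Z + #|S|.+1%:Z); first by move: Hd; rewrite E; lia.
apply: (@mon_tor_linear K n _ Z #|S|.+1) => //.
- by move=> i iZ; rewrite /cone_set meets1.
- move=> s /orP[H|/andP[Ss /set0Pn[y]]]; first by apply/orP; left.
  rewrite inE => /andP[ys yY]; apply/orP; right.
  have ySs : y |: S \subset s by rewrite subUset sub1set ys.
  have := subset_leq_card ySs; rewrite cardsU1.
  by rewrite (disjointFl SY yY).
- by lia.
- by apply/implyP => dk1; lia.
Qed.

End Cone.

Lemma meets_hilb Z : mon_hilb K (meets Z) ((1 - 'X) ^+ #|Z|).
Proof.
move cZ: #|Z| => z; elim: z Z cZ => [|z IH] Z cZ.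
  rewrite expr0; apply: mon_hilb_none; first by move=> s s'; apply: meetsS.
  by move=> s; rewrite (cards0_eq cZ) /meets setI0 eqxx.
have /card_gt0P[i iZ] : (0 < #|Z|)%N by rewrite cZ.
have cZ' : #|Z :\ i| = z by have := cardsD1 i Z; rewrite iZ cZ; lia.
rewrite exprS -[_ * _]addr0 -(mulr0 'X); apply: (mon_hilb_step (i := i)).
- by move=> s s'; apply: meetsS.
- apply: eq_mon_hilb (IH _ cZ') => s; rewrite /deletion /meets.
  by congr (_ != _); apply/setP => k; rewrite !inE; case: (k == i); case: (k \in s).
- apply: mon_hilb_all => s; apply: (meetsS (subsetUl _ _)).
  exact: meets1.
Qed.

(** The ideal of products is the ideal of [Y] shifted by [#|S|], whence the power of t; the
    variables of [Z] are independent of it and contribute a factor. *)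
Lemma cone_hilb Z S Y : [disjoint S & Z] -> [disjoint S & Y] -> [disjoint Z & Y] ->
  mon_hilb K (cone_set Z S Y)
    ((1 - 'X) ^+ #|Z| * (1 + 'X^(#|S|) * ((1 - 'X) ^+ #|Y| - 1))).
Proof.
move cS: #|S| => m; elim: m S cS => [|m IH] S cS SZ SY ZY.
  rewrite (_ : _ * _ = (1 - 'X) ^+ (#|Z| + #|Y|)); last by rewrite exprD expr0; ring.
  have <- : #|Z :|: Y| = (#|Z| + #|Y|)%N.
    by have := leq_card_setU Z Y; rewrite ZY => -[_ /eqP].
  apply: eq_mon_hilb (meets_hilb (Z :|: Y)) => s.
  by rewrite /cone_set (cards0_eq cS) sub0set /meets setIUr setU_eq0 negb_and.
have /card_gt0P[i iS] : (0 < #|S|)%N by rewrite cS.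
have iZ : i \notin Z by rewrite (disjointFr SZ).
have iY : i \notin Y by rewrite (disjointFr SY).
have cS' : #|S :\ i| = m by have := cardsD1 i S; rewrite iS cS; lia.
have -> : (1 - 'X) ^+ #|Z| * (1 + 'X^(m.+1) * ((1 - 'X) ^+ #|Y| - 1)) =
  (1 - 'X) * (1 - 'X) ^+ #|Z| +
  'X * ((1 - 'X) ^+ #|Z| * (1 + 'X^m * ((1 - 'X) ^+ #|Y| - 1))) :> {poly rat}.
  by rewrite exprS; ring.
apply: (mon_hilb_step (i := i)); first exact: upset_cone_set.
  apply: eq_mon_hilb (meets_hilb Z) => s; rewrite /deletion /cone_set.
  have -> : (S \subset s :\ i) = false.
    by apply/negP => /subsetP/(_ _ iS); rewrite !inE eqxx.
  rewrite orbF /meets; congr (_ != _); apply/setP => k; rewrite !inE.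
  by case: eqP => // ->; rewrite (negbTE iZ) ?andbF.
have addI s (B : {set 'I_n}) : i \notin B -> meets B (i |: s) = meets B s.
  move=> iB; rewrite /meets; congr (_ != _); apply/setP => k; rewrite !inE.
  by case: eqP => // ->; rewrite (negbTE iB) ?andbF.
apply: eq_mon_hilb (IH (S :\ i) cS' _ _ ZY) => [s||].
- by rewrite /link /cone_set !addI // subDset.
- by apply: disjointWl SZ; apply: subsetDl.
- by apply: disjointWl SY; apply: subsetDl.
Qed.

Lemma coef_1subX_gt m k : (m < k)%N -> ((1 - 'X) ^+ m : {poly rat})`_k = 0.
Proof.
move=> mk; apply: nth_default; apply: leq_trans (size_poly_exp_leq _ _) _.
by rewrite -opprB size_polyN size_XsubC /= mul1n.
Qed.

Lemma coef_1subX m : ((1 - 'X) ^+ m : {poly rat})`_m = (-1) ^+ m.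
Proof.
elim: m => [|m IH]; first by rewrite !expr0 coef1.
rewrite exprS mulrBl mul1r coefB coefXM /= IH coef_1subX_gt //.
by rewrite sub0r exprS mulN1r.
Qed.

Lemma cone_diagram c i0 : (1 < c)%N -> (h <= i0)%N -> (i0 + c <= n)%N ->
  exists beta, [/\ sr_diagram K h beta,
    forall (i : 'I_n.+1) d, coeff (i, d) beta != 0 ->
      ((d == i%:Z + 1) && (i < h)%N) || ((d == i%:Z + c%:Z) && (i <= i0)%N) &
    forall i : 'I_n.+1, i = i0 :> nat -> coeff (i, (i0 + c)%:Z) beta != 0].
Proof.
move=> c1 hi ic.
(* The sizes h - 1, c - 1 and i0 + 2 - h add up to i0 + c: this is the last degree of the diagram,
   and only homological degree i0 reaches it. *)
pose Z := ord_range n 0 h.-1; pose S := ord_range n h.-1 (h.-1 + c.-1).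
pose Y := ord_range n (h.-1 + c.-1) (i0 + c).
have cZ : #|Z| = h.-1 by rewrite card_ord_range ?subn0 //; lia.
have cS : #|S| = c.-1 by rewrite card_ord_range; lia.
have cY : #|Y| = (i0 + 2 - h)%N by rewrite card_ord_range //; lia.
have SZ : [disjoint S & Z] by rewrite disjoint_sym disjoint_ord_range.
have SY : [disjoint S & Y] := disjoint_ord_range _ _ _.
have ZY : [disjoint Z & Y].
  by rewrite disjoint_subset; apply/subsetP => i; rewrite !inE; lia.
have [|s|beta [sr bP _ _ bq]] :=
    @upset_sr_diagram K n _ h h_gt0 (@upset_cone_set Z S Y) (cone_set0 _ _ _).
- exists (ord_range n h n); last by rewrite card_ord_range //; lia.
  rewrite negb_or; apply/andP; split.
    by rewrite negbK; apply/eqP/setP => i; rewrite !inE; lia.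
  rewrite negb_and; apply/orP; left; apply/subsetPn.
  have hn : (h.-1 < n)%N by lia.
  by exists (Ordinal hn); rewrite !inE /=; lia.
- by move=> /(cone_face SZ SY ZY); rewrite cS cY cZ; lia.
have supp (i : 'I_n.+1) d : coeff (i, d) beta != 0 ->
      ((d == i%:Z + 1) && (i < h.-1)%N) || ((d == i%:Z + c%:Z) && (i <= i0)%N).
  move=> /bP nt; apply: contraT => H; case: nt; apply: cone_tor => //.
  by rewrite cZ cS cY; lia.
exists beta; split=> // [i d /supp|i ii0]; first by lia.
(* The alternating sum in degree i0 + c is therefore a single entry up to sign, and the numerator
   has coefficient 1 or -1 there. *)
have := congr1 (fun p : {poly rat} => p`_(i0 + c)) (bq _ (cone_hilb SZ SY ZY)).
rewrite coef_betti_poly // (bigD1 i) //= [X in _ + X]big1 ?addr0 => [|k ki]; last first.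
  apply/eqP; rewrite mulf_eq0 signr_eq0 /=; apply: contraNT ki => /supp H.
  by apply/eqP/val_inj => /=; lia.
rewrite cZ cS cY; set q := (1 - 'X) ^+ _ * _.
have -> : 1 - q = 1 - (1 - 'X) ^+ h.-1 - 'X^(c.-1) * (1 - 'X) ^+ i0.+1 + 'X^(c.-1) *
    (1 - 'X) ^+ h.-1.
  rewrite /q (_ : i0.+1 = (h.-1 + (i0 + 2 - h))%N); last by lia.
  by rewrite exprD; ring.
rewrite coefD !coefB !coefXnM coef1 (_ : (i0 + c == 0)%N = false); last by lia.
rewrite (_ : (i0 + c < c.-1)%N = false); last by lia.
rewrite (_ : (i0 + c - c.-1)%N = i0.+1); last by lia.
rewrite coef_1subX !coef_1subX_gt; try by lia.
move=> E; apply/eqP => E0; move: E; rewrite E0 mulr0 => /esym/eqP.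
by rewrite subrr sub0r addr0 oppr_eq0 signr_eq0.
Qed.

End Families.

(** * Dimension of the cone *)

(** The functionals [theta] separate [W], so its dimension is at most [#|T|] and as many independent
    vectors span it: the matrix of values [theta t (b s)] is invertible. *)
Lemma span_of_injective (V : lmodType rat) (T : finType) (W : V -> Prop)
    (theta : T -> V -> rat) (b : T -> V) :
  (forall t, theta t 0 = 0) ->
  (forall t c u v, theta t (c *: u + v) = c * theta t u + theta t v) ->
  W 0 -> (forall c u v, W u -> W v -> W (c *: u + v)) ->
  (forall v, W v -> (forall t, theta t v = 0) -> v = 0) ->
  (forall t, W (b t)) ->
  (forall c : T -> rat, \sum_t c t *: b t = 0 -> forall t, c t = 0) ->
  forall v, W v -> exists c : T -> rat, v = \sum_t c t *: b t.
Proof.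
move=> th0 thD W0 WD inj Wb indep v Wv.
have Wsum (c : T -> rat) : W (\sum_t c t *: b t).
  elim/big_rec: _ => // t u _ Wu; exact: WD.
have thsum t (c : T -> rat) : theta t (\sum_s c s *: b s) = \sum_s c s * theta t (b s).
  by elim/big_rec2: _ => // s x u _ <-; rewrite thD.
pose M : 'M[rat]_#|T| := \matrix_(i, j) theta (enum_val j) (b (enum_val i)).
have xM (x : 'rV_#|T|) t :
    (x *m M) 0 (enum_rank t) = theta t (\sum_s x 0 (enum_rank s) *: b s).
  rewrite thsum mxE [RHS](reindex (@enum_val T predT)); last exact/onW_bij/enum_val_bij.
  by apply: eq_bigr => i _; rewrite !mxE enum_rankK enum_valK.
have Mu : M \in unitmx.
  rewrite -row_free_unit -kermx_eq0; apply/rowV0P => x /sub_kermxP xM0.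
  have x0 : \sum_s x 0 (enum_rank s) *: b s = 0.
    by apply: inj => // t; rewrite -xM xM0 mxE.
  apply/rowP => i; rewrite mxE -[i]enum_valK.
  exact: (indep (fun s => x 0 (enum_rank s))).
pose x := (\row_i theta (enum_val i) v) *m invmx M.
exists (fun s => x 0 (enum_rank s)).
apply/eqP; rewrite -subr_eq0; apply/eqP.
rewrite addrC -scaleN1r; apply: inj; first exact: WD.
move=> t; rewrite thD -xM mulmxKV // mxE enum_rankK mulN1r addNr.
by [].
Qed.

Lemma cone_dim_basis (V : lmodType rat) (C : V -> Prop) (T : finType) (b : T -> V) :
  (forall t, rat_span C (b t)) ->
  (forall c : T -> rat, \sum_t c t *: b t = 0 -> forall t, c t = 0) ->
  (forall v, rat_span C v -> exists c : T -> rat, v = \sum_t c t *: b t) ->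
  cone_dim C #|T|.
Proof.
move=> bC indep sp; exists (fun i => b (enum_val i)); split=> // [c c0 i|v /sp[c ->]].
  rewrite -[i]enum_valK; apply: (indep (fun t => c (enum_rank t))).
  rewrite -[RHS]c0 (reindex (@enum_val T predT)); last exact/onW_bij/enum_val_bij.
  by apply: eq_bigr => j _; rewrite enum_valK.
exists (fun i => c (enum_val i)).
by rewrite (reindex (@enum_val T predT)) //; exact/onW_bij/enum_val_bij.
Qed.

(** * Linear strands under the divisibility condition *)

Section HerzogKuhl.
Variables (n h : nat).
Hypotheses (h_gt0 : (0 < h)%N) (h_lt_n : (h < n)%N).
Local Notation V := (betti_space n).
Implicit Types (beta : V).

Lemma herzog_kuhl0 : herzog_kuhl h (0 : V).
Proof. by rewrite /herzog_kuhl betti_poly0 horner0 polyC0 subrr dvdp0. Qed.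

Lemma herzog_kuhlP c beta beta' : herzog_kuhl h beta -> herzog_kuhl h beta' ->
  herzog_kuhl h (c *: beta + beta').
Proof.
move=> H H'; rewrite /herzog_kuhl betti_polyD betti_polyZ hornerD hornerZ.
have -> : (c * (betti_poly beta).[1] + (betti_poly beta').[1])%:P -
    (c *: betti_poly beta + betti_poly beta') =
    c *: (((betti_poly beta).[1])%:P - betti_poly beta) +
    (((betti_poly beta').[1])%:P - betti_poly beta').
  by rewrite polyCD polyCM scalerBr -!mul_polyC; ring.
by apply: dvdp_add => //; rewrite -mul_polyC; apply: dvdp_mull.
Qed.

Lemma linear_strand_poly beta m : (m <= n)%N ->
  (forall (i : 'I_n.+1) d, coeff (i, d) beta != 0 -> d = i%:Z + 1 /\ (i < m)%N) ->
  (betti_poly beta)`_0 = 0 /\ (size (betti_poly beta) <= m.+1)%N.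
Proof.
move=> mn H; split.
  rewrite coef_betti_poly // big1 // => i _; apply/eqP; rewrite mulf_eq0.
  by apply/orP; right; apply: contraT => /H[]; lia.
apply/leq_sizeP => e me; have [en|ne] := ltnP e n.+1.
  rewrite coef_betti_poly // big1 // => i _; apply/eqP; rewrite mulf_eq0.
  by apply/orP; right; apply: contraT => /H[]; lia.
rewrite nth_default //; apply: leq_trans ne.
apply: (leq_trans (size_sum _ _ _)); apply/bigmax_leqP => i _.
apply: (leq_trans (size_sum _ _ _)); apply/bigmax_leqP => k _.
by apply: leq_trans (size_scale_leq _ _) _; rewrite size_polyXn.
Qed.

(** On the linear strand each degree belongs to one homological degree, so nothing cancels in the
    alternating sum. *)
Lemma linear_strand_eq0 beta :
  (forall (i : 'I_n.+1) d, coeff (i, d) beta != 0 -> d = i%:Z + 1 /\ (i < n)%N) ->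
  betti_poly beta = 0 -> beta = 0.
Proof.
move=> H b0; apply: betti_ext => i d; rewrite coeff0; apply/eqP; apply: contraT => nz.
have [dE iN] := H i d nz; have := congr1 (fun p : {poly rat} => p`_(i.+1)) b0.
rewrite coef0 coef_betti_poly // (bigD1 i) //= [X in _ + X]big1 ?addr0 => [|j ji].
  have <- : d = i.+1 by rewrite dE; lia.
  by move/eqP; rewrite mulf_eq0 signr_eq0 (negbTE nz).
apply/eqP; rewrite mulf_eq0; apply/orP; right; apply: contraNT ji => /H[E _].
by apply/eqP/val_inj => /=; lia.
Qed.

Lemma size_X1n : size (('X - 1) ^+ h : {poly rat}) = h.+1.
Proof. by rewrite -polyC1 size_exp_XsubC. Qed.

(** A polynomial of degree below h divisible by (t - 1)^h is zero; so the alternating sum is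
    constant, and its constant term is zero. *)
Lemma short_linear_strand_eq0 beta : herzog_kuhl h beta ->
  (forall (i : 'I_n.+1) d, coeff (i, d) beta != 0 -> d = i%:Z + 1 /\ (i.+1 < h)%N) ->
  beta = 0.
Proof.
move=> hk H.
have [|i d /H[] //|b0 bs] := @linear_strand_poly beta h.-1; [by lia|by split=> //; lia|].
have P0 : ((betti_poly beta).[1])%:P - betti_poly beta = 0.
  apply: contraTeq hk => P0; rewrite /herzog_kuhl; apply/negP => /(dvdp_leq P0).
  rewrite size_X1n leqNgt ltnS => /negP; apply.
  apply: leq_trans (size_polyD _ _) _; rewrite size_polyN geq_max.
  by rewrite (leq_trans (size_polyC_leq1 _) h_gt0) /= -(prednK h_gt0).
apply: linear_strand_eq0 => [i d /H[]|]; first by split=> //; lia.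
move/eqP: P0; rewrite subr_eq0 => /eqP E; rewrite -E.
by have := congr1 (fun p : {poly rat} => p`_0) E; rewrite b0 coefC /= => ->.
Qed.

(** By degree the alternating sum is a constant times (t - 1)^h, and its vanishing constant term
    forces that constant to be zero. *)
Lemma full_linear_strand_eq0 beta : herzog_kuhl h beta ->
  (forall (i : 'I_n.+1) d, coeff (i, d) beta != 0 -> d = i%:Z + 1 /\ (i < h)%N) ->
  (betti_poly beta).[1] = 0 -> beta = 0.
Proof.
move=> hk H b1.
have [|b0 bs] := @linear_strand_poly beta h _ H; first by lia.
apply: linear_strand_eq0 => [i d /H[]|]; first by split=> //; lia.
move: hk; rewrite /herzog_kuhl b1 polyC0 sub0r dvdpNr.
case/dvdpP=> r rE; have [r0|r0] := eqVneq r 0; first by rewrite rE r0 mul0r.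
have Xn0 : ('X - 1) ^+ h != 0 :> {poly rat} by rewrite -size_poly_gt0 size_X1n.
have rs : (size r <= 1)%N.
  by move: bs; rewrite rE size_mul // size_X1n addnS /= -[X in (_ <= X)%N]add1n leq_add2r.
move: b0; rewrite rE (size1_polyC rs) -horner_coef0 hornerM hornerC horner_exp.
have -> : ('X - 1 : {poly rat}).[0] = -1 by rewrite !hornerE.
by move=> /eqP; rewrite mulf_eq0 signr_eq0 orbF => /eqP ->; rewrite polyC0 mul0r.
Qed.

End HerzogKuhl.

(** * The basis and the count of positions *)

Section Basis.
Variables (K : fieldType) (n h : nat).
Hypotheses (h_gt0 : (0 < h)%N) (h_lt_n : (h < n)%N).
Local Notation V := (betti_space n).

(* [x] stands for the pair of the row [d - i] and the homological degree [i]
   of a position of the Betti diagram outside the linear strand. *)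
Definition position : finType := {c : 'I_(n - h) & 'I_(n.-1 - c)}.
Implicit Types x y : position.
Definition row x : nat := (tag x).+2.
Definition top x : nat := tagged x.

Lemma position_bounds x : (1 < row x <= (n - h).+1)%N /\ (top x + row x <= n)%N.
Proof.
rewrite /row /top; case: x => c i /=; have := ltn_ord c; have := ltn_ord i; lia.
Qed.

Lemma position_inj x y : row x = row y -> top x = top y -> x = y.
Proof.
case: x y => c i [c' i']; rewrite /row /top /= => -[] /val_inj cc;
    case: _ / cc i' => i' ii.
by congr existT; apply: val_inj.
Qed.

Lemma position_of (r i : nat) : (1 < r <= (n - h).+1)%N -> (i + r <= n)%N ->
  exists2 x, row x = r & top x = i.
Proof.
move=> rn ir; have cn : (r - 2 < n - h)%N by lia.
have iN : (i < n.-1 - Ordinal cn)%N by rewrite /=; lia.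
exists (Tagged (fun c : 'I_(n - h) => 'I_(n.-1 - c)) (Ordinal iN)) => //.
by rewrite /row /=; lia.
Qed.

(** Beyond the shape, only what the elimination consumes is kept: the top entry in row [row x] for
    the second family, the last linear entry for the first. For [top x = 0] there is no linear
    entry, and the value at 1 replaces it. *)
Definition basis_spec x (beta : V) : Prop :=
  [/\ sr_diagram K h beta,
      forall (i : 'I_n.+1) d, coeff (i, d) beta != 0 ->
        ((d == i%:Z + 1) && (i < h)%N) || ((d == i%:Z + (row x)%:Z) && (i <= maxn
            (top x) h.-1)%N),
      (h <= top x)%N -> forall i : 'I_n.+1, i = top x :> nat ->
        coeff (i, (top x + row x)%:Z) beta != 0 &
      (top x < h)%N ->
      [/\ forall (i : 'I_n.+1) d, coeff (i, d) beta != 0 -> d = i%:Z + 1 -> (i < top x)%N,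
          forall i : 'I_n.+1, i.+1 = top x -> coeff (i, (top x)%:Z) beta != 0 &
          (betti_poly beta).[1] = 1]].

Lemma basis_exists x : exists beta, basis_spec x beta.
Proof.
have [rx tx] := position_bounds x; have r1 : (1 < row x)%N by lia.
have [hi|ih] := leqP h (top x).
  have [beta [sr supp nz]] := cone_diagram K h_gt0 h_lt_n r1 hi tx.
  exists beta; split=> // [i d /supp|]; last by lia.
  by rewrite (maxn_idPl _); lia.
have hr : (h + row x <= n.+1)%N by lia.
have [beta [sr supp nz b1 hk]] := veronese_diagram K h_gt0 h_lt_n r1 hr (ltnW ih).
exists beta; split=> // [i d /supp||_]; first by rewrite (maxn_idPr _); lia.
  by lia.
by split=> // i d /supp; lia.
Qed.

Variables (b : position -> V) (z : V).
Hypotheses (bP : forall x, basis_spec x (b x)) (z_sr : sr_diagram K h z)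
  (z_supp : forall (i : 'I_n.+1) d, coeff (i, d) z != 0 -> d = i%:Z + 1)
  (z_top : forall i : 'I_n.+1, i.+1 = h -> coeff (i, h%:Z) z != 0).

Definition basis (t : option position) : V := if t is Some x then b x else z.

Section Independence.
Variable c : option position -> rat.
Hypothesis c0 : \sum_t c t *: basis t = 0.

Lemma coeff_relation p : c None * coeff p z + \sum_x c (Some x) * coeff p (b x) = 0.
Proof.
have := congr1 (coeff p) c0; rewrite coeff0 coeff_sum_scale => E; rewrite -[RHS]E.
rewrite [RHS](bigD1 None) //=; congr (_ + _).
rewrite [RHS](reindex_omap Some id) /=; last by case.
by apply: eq_big => // x; rewrite eqxx.
Qed.

Lemma relation_row (i : 'I_n.+1) d : d != i%:Z + 1 ->
    \sum_x c (Some x) * coeff (i, d) (b x) = 0.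
Proof.
move=> di; have := coeff_relation (i, d).
have [->|/z_supp dE] := eqVneq (coeff (i, d) z) 0; first by rewrite mulr0 add0r.
by rewrite dE eqxx in di.
Qed.

(** Descending induction on [top]: at the top entry of x, which is off the linear strand, only
    diagrams of the same row with at least the same [top] can be nonzero. *)
Lemma relation_high x : (h <= top x)%N -> c (Some x) = 0.
Proof.
move: {2}(n - top x)%N (leqnn (n - top x)) => m.
elim: m x => [|m IH] x nm hx; have [rx tx] := position_bounds x; first by lia.
have tn : (top x < n.+1)%N by lia.
have dN : (top x + row x)%:Z != (Ordinal tn)%:Z + 1 by rewrite /=; lia.
have := relation_row dN; rewrite (bigD1 x) //= [X in _ + X]big1 ?addr0 => [|y yx].
  have [_ _ /(_ hx (Ordinal tn) erefl) nz _] := bP x.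
  by move/eqP; rewrite mulf_eq0 (negbTE nz) orbF => /eqP.
apply/eqP; rewrite mulf_eq0 orbC -implyNb; apply/implyP => nz.
have [_ supp _ _] := bP y; have := supp _ _ nz => /= H.
have [ry ty] := position_bounds y.
have rE : row x = row y by lia.
have tE : top x != top y by apply: contraNneq yx => E; apply/eqP/esym/position_inj.
by rewrite IH //; lia.
Qed.

Definition row_sum r : V := \sum_(x | row x == r) c (Some x) *: b x.

Lemma coeff_row_sum r p : coeff p (row_sum r) = \sum_(x | row x == r) c (Some x) *
    coeff p (b x).
Proof. by rewrite raddf_sum; apply: eq_bigr => x _; rewrite /= coeff_scale. Qed.

Lemma row_sum_herzog_kuhl r : herzog_kuhl h (row_sum r).
Proof.
rewrite /row_sum; elim/big_rec: _ => [|x u _ hu]; first exact: herzog_kuhl0.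
apply: herzog_kuhlP => //; have [sr _ _ _] := bP x.
exact: (proj2 (sr_diagramP h_gt0 h_lt_n sr)).
Qed.

(** Distinct rows do not overlap off the linear strand, so the relation makes this sum vanish there.
    What remains is linear with i < [top x] < h, too short for the divisibility. *)
Lemma row_sum_eq0 r : row_sum r = 0.
Proof.
apply: (short_linear_strand_eq0 h_gt0 h_lt_n (row_sum_herzog_kuhl r)) => i d nz.
have [x /eqP xr] : exists2 x, row x == r & c (Some x) * coeff (i, d) (b x) != 0.
  apply/exists_inP; apply: contraNT nz; rewrite negb_exists_in => /forall_inP H.
  by rewrite coeff_row_sum big1 // => x xr; apply/eqP/negPn/H.
rewrite mulf_eq0 negb_or => /andP[cx bx].
have hx : (top x < h)%N by rewrite ltnNge; apply: contra cx => /relation_high ->.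
have [_ supp _ /(_ hx)[lin _ _]] := bP x; have [rx tx] := position_bounds x.
have [dE|dN] := eqVneq d (i%:Z + 1).
  by split=> //; have := lin _ _ bx dE; lia.
have dE : d = i%:Z + (row x)%:Z by have := supp _ _ bx;
    rewrite (negbTE dN) /= => /andP[/eqP].
case/eqP: nz; rewrite coeff_row_sum -[RHS](relation_row dN) big_mkcond /=.
apply: eq_bigr => y _; case: eqP => // yr; apply/eqP; rewrite eq_sym mulf_eq0.
apply/orP; right; apply/negPn/negP => nz; have [_ suppy _ _] := bP y.
have := suppy _ _ nz; have [ry ty] := position_bounds y; lia.
Qed.

(** Descending induction on [top] again, now at the last linear entry of x within the vanishing sum
    of its row. *)
Lemma relation_low x : (0 < top x < h)%N -> c (Some x) = 0.
Proof.
move: {2}(h - top x)%N (leqnn (h - top x)) => m.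
elim: m x => [|m IH] x hm hx; have [rx tx] := position_bounds x; first by lia.
have tn : ((top x).-1 < n.+1)%N by lia.
have := congr1 (coeff (Ordinal tn, (top x)%:Z)) (row_sum_eq0 (row x)).
have hx' : (top x < h)%N by lia.
rewrite coeff0 coeff_row_sum (bigD1 x) //= [X in _ + X]big1 ?addr0 => [|y /andP[/eqP
    yr yx]].
  have [_ _ _ /(_ hx')[_ nz _]] := bP x.
  move/eqP; rewrite mulf_eq0 (negbTE (nz (Ordinal tn) _)) ?orbF => [/eqP //|].
  by rewrite /= prednK //; lia.
have [hy|yh] := leqP h (top y); first by rewrite relation_high // mul0r.
apply/eqP; rewrite mulf_eq0 orbC -implyNb; apply/implyP => nz.
have [_ _ _ /(_ yh)[lin _ _]] := bP y.
have := lin _ _ nz; rewrite /= => H.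
have tE : top x != top y by apply: contraNneq yx => E; apply/eqP/position_inj.
have xy : ((top x).-1 < top y)%N by apply: H; lia.
by rewrite IH //; lia.
Qed.

Lemma relation_some x : c (Some x) = 0.
Proof.
have [hx|xh] := leqP h (top x); first exact: relation_high.
have [x0|x1] := posnP (top x); last by apply: relation_low; rewrite x1.
(* In the sum of this row only the coefficient with [top x = 0] is left, and its diagram has value 1
   at t = 1. *)
have := congr1 (fun u => (betti_poly u).[1]) (row_sum_eq0 (row x)).
rewrite /= betti_poly0 horner0 /row_sum (bigD1 x) //= [X in _ + X]big1 ?addr0 => [|y
    /andP[/eqP yr yx]].
  have [_ _ _ /(_ xh)[_ _ b1]] := bP x.
  by rewrite betti_polyZ hornerZ b1 mulr1.
have [hy|yh] := leqP h (top y); first by rewrite relation_high // scale0r.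
rewrite relation_low ?scale0r // yh andbT lt0n -x0.
by apply: contraNneq yx => E; apply/eqP/position_inj.
Qed.

Lemma relation_none : c None = 0.
Proof.
have hn : (h.-1 < n.+1)%N by lia.
have := coeff_relation (Ordinal hn, h%:Z).
rewrite big1 => [|x _]; last by rewrite relation_some mul0r.
move=> /eqP; rewrite addr0 mulf_eq0 (negbTE (z_top _)) ?orbF => [/eqP //|].
by rewrite /= prednK.
Qed.

End Independence.

Lemma basis_independent (c : option position -> rat) :
  \sum_t c t *: basis t = 0 -> forall t, c t = 0.
Proof. by move=> c0 [x|]; [exact: relation_some|exact: relation_none]. Qed.

Definition in_betti_range (beta : V) : Prop :=
  (forall (i : 'I_n.+1) d, coeff (i, d) beta != 0 -> betti_region n h i d) /\
  herzog_kuhl h beta.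

Lemma betti_range0 : in_betti_range 0.
Proof. by split=> [i d|]; [rewrite coeff0 eqxx|exact: herzog_kuhl0]. Qed.

Lemma betti_rangeP c u v : in_betti_range u -> in_betti_range v ->
    in_betti_range (c *: u + v).
Proof.
move=> [ru hu] [rv hv]; split; last exact: herzog_kuhlP.
move=> i d; rewrite coeffD coeff_scale => nz.
have [u0|/ru //] := eqVneq (coeff (i, d) u) 0.
by apply: rv; apply: contraNneq nz => ->; rewrite u0 mulr0 addr0.
Qed.

Lemma betti_range_sum (T : finType) (c : T -> rat) (u : T -> V) :
  (forall t, in_betti_range (u t)) -> in_betti_range (\sum_t c t *: u t).
Proof.
move=> H; elim/big_rec: _ => [|t v _ Hv]; first exact: betti_range0.
exact: betti_rangeP.
Qed.

Lemma span_betti_range v : rat_span (@sr_betti_cone K n h) v -> in_betti_range v.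
Proof.
move=> [m [c [u [Su ->]]]]; apply: betti_range_sum => t.
have [m' [c' [u' [Su' _ ->]]]] := Su t; apply: betti_range_sum => t'.
exact: (sr_diagramP h_gt0 h_lt_n (Su' t')).
Qed.

Lemma diagram_span beta : sr_diagram K h beta -> rat_span (@sr_betti_cone K n h) beta.
Proof.
move=> Sb; exists 1%N, (fun=> 1), (fun=> beta); split; last by rewrite big_ord1 scale1r.
move=> _; exists 1%N, (fun=> 1), (fun=> beta); split=> //.
by rewrite big_ord1 scale1r.
Qed.

Definition coordinate (t : option position) (beta : V) : rat :=
  if t is Some x then coeff (inord (top x), (top x + row x)%:Z) beta
  else (betti_poly beta).[1].

Lemma coordinate_inj beta : in_betti_range beta ->
    (forall t, coordinate t beta = 0) -> beta = 0.
Proof.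
move=> [reg hk] c0; apply: (full_linear_strand_eq0 h_gt0 h_lt_n hk);
    last exact: (c0 None).
move=> i d nz; have := reg i d nz.
case/orP=> [/and3P[dn d1 d2]|/andP[/eqP -> ->] //].
have [e dE] : exists e : nat, d = e by exists (absz d); lia.
have [||x rx tx] := @position_of (e - i) i.
- by lia.
- by lia.
have := c0 (Some x); rewrite /= tx rx (_ : (i + (e - i))%:Z = d); last by lia.
by rewrite inord_val => E; rewrite E eqxx in nz.
Qed.

Lemma basis_span v : rat_span (@sr_betti_cone K n h) v ->
  exists c : option position -> rat, v = \sum_t c t *: basis t.
Proof.
move=> /span_betti_range; apply: (span_of_injective (theta := coordinate)).
- by case=> [x|]; rewrite /= ?coeff0 // betti_poly0 horner0.
- case=> [x|] c u w /=; first by rewrite coeffD coeff_scale.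
  by rewrite betti_polyD betti_polyZ hornerD hornerZ.
- exact: betti_range0.
- exact: betti_rangeP.
- exact: coordinate_inj.
- case=> [x|]; apply: (@sr_diagramP K n h _ h_gt0 h_lt_n) => //.
  by rewrite /=; case: (bP x).
- exact: basis_independent.
Qed.

Lemma card_position : (#|{: option position}| = n * (n - 1) %/ 2 - h * (h - 1) %/ 2 +
    1)%N.
Proof.
rewrite card_option card_tagged sumnE big_map big_enum /=.
rewrite (eq_bigr (fun c : 'I_(n - h) => n.-1 - c)%N) => [|c _]; last by rewrite card_ord.
(* Doubling and moving h (h - 1) across avoids halves and truncated subtraction; h + k in place of n
   permits induction on k. *)
have H k : (2 * (\sum_(c < k) ((h + k).-1 - c)) + h * (h - 1) = (h + k) * (h + k - 1))%N.
  elim: k => [|k IH]; first by rewrite big_ord0 addn0.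
  rewrite big_ord_recl /= subn0.
  rewrite (eq_bigr (fun c : 'I_k => (h + k).-1 - c)%N) => [|c _];
      last by rewrite /bump /=; lia.
  move: (\sum_(c < k) _)%N IH => s IH; nia.
have := H (n - h)%N; rewrite subnKC; last exact: ltnW.
move: (\sum_(c < n - h) _)%N => s; move: (n * (n - 1))%N (h * (h - 1))%N => a a' E; lia.
Qed.

End Basis.

Local Close Scope ring_scope.

Theorem theorem3p4 (K : fieldType) (n h : nat) (h_gt0 : 0 < h) (h_lt_n : h < n) :
  cone_dim (@sr_betti_cone K n h)
    (n * (n - 1) %/ 2 - h * (h - 1) %/ 2 + 1).
Proof.
have [b bP] := fin_all_exists (@basis_exists K n h h_gt0 h_lt_n).
have [z [z_sr z_supp z_top]] := linear_diagram K h_gt0 h_lt_n.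
rewrite -card_position //; apply: (cone_dim_basis (b := basis b z)).
- case=> [x|]; apply: diagram_span => //.
  by rewrite /=; case: (bP x).
- exact: (basis_independent h_gt0 h_lt_n bP z_supp z_top).
- exact: (basis_span h_gt0 h_lt_n bP z_sr z_supp z_top).
Qed.
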